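(* Let $r,d\in\mathbb N$, $d\ge 3$, let $0\le k_1<k_2<\dots<k_d=r$ be integers, $\mathbf k=(k_1,\dots,k_d)$, $\mathbf k'=(k_2,\dots,k_d)$, $\mathbf k''=(k_2,\dots,k_{d-1})$. Let $X$ be one of the classes $L^{r,\cup}_{\infty,\infty}(\mathbb R_-)$ or $AM(\mathbb R_-)$. Let $M_{k_1},\dots,M_{k_d}$ be positive real numbers and put $M_{\mathbf k}=(M_{k_1},\dots,M_{k_d})$, $M_{\mathbf k'}=(M_{k_2},\dots,M_{k_d})$, $M_{\mathbf k''}=(M_{k_2},\dots,M_{k_{d-1}})$. (i) If $d$ is odd, then $M_{\mathbf k}\in A_{\mathbf k}(X)$ if and only if at least one of the following holds: (a) $M_{\mathbf k'}\in\operatorname{int}A_{\mathbf k'}(X)$ and $M_{k_1}\ge\|\phi^{(k_1)}(X,M_{\mathbf k'})\|$; (b) $M_{\mathbf k'}\in\partial A_{\mathbf k'}(X)\cap A_{\mathbf k'}(X)$, $k_1>0$ and $M_{k_1}=\|\phi^{(k_1)}(X,M_{\mathbf k'})\|$; (c) $M_{\mathbf k'}\in\partial A_{\mathbf k'}(X)\cap A_{\mathbf k'}(X)$, $k_1=0$ and $M_{k_1}\ge\|\phi^{(k_1)}(X,M_{\mathbf k'})\|$. (ii) If $d$ is even, then $M_{\mathbf k}\in A_{\mathbf k}(X)$ if and only if at least one of the following holds: (a) $M_{\mathbf k'}\in\operatorname{int}A_{\mathbf k'}(X)$ and $M_{k_1}>\|\phi^{(k_1)}(X,M_{\mathbf k''})\|$;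 (b) $M_{\mathbf k'}\in\partial A_{\mathbf k'}(X)\cap A_{\mathbf k'}(X)$, $k_1>0$ and $M_{k_1}=\|\phi^{(k_1)}(X,M_{\mathbf k''})\|$; (c) $M_{\mathbf k'}\in\partial A_{\mathbf k'}(X)\cap A_{\mathbf k'}(X)$, $k_1=0$ and $M_{k_1}\ge\|\phi^{(k_1)}(X,M_{\mathbf k''})\|$. (iii) Moreover, $M_{\mathbf k}\in\operatorname{int}A_{\mathbf k}(X)$ if and only if $M_{\mathbf k'}\in\operatorname{int}A_{\mathbf k'}(X)$ and $M_{k_1}>\|\phi^{(k_1)}(X,M_{\mathbf k'})\|$ (when $d$ is odd), respectively $M_{k_1}>\|\phi^{(k_1)}(X,M_{\mathbf k''})\|$ (when $d$ is even).
   Context: $\mathbb R_-=(-\infty,0]$ and $\|\cdot\|$ is the $L_\infty(\mathbb R_-)$ norm. For $r\in\mathbb N$, $L^r_{\infty,\infty}(\mathbb R_-)$ is the set of functions $x\in L_\infty(\mathbb R_-)$ whose derivative $x^{(r-1)}$ is locally absolutely continuous and for which $x^{(r)}\in L_\infty(\mathbb R_-)$. $L^{r,\cup}_{\infty,\infty}(\mathbb R_-)$ is the class of nonnegative $x\in L^r_{\infty,\infty}(\mathbb R_-)$ such that $x^{(k)}$ is nondecreasing and convex for $k=0,\dots,r-1$. $AM(\mathbb R_-)$ (absolutely monotone functions) is the class of infinitely differentiable functions on $\mathbb R_-$ (one-sided derivatives at $0$) which are nonnegative on $\mathbb R_-$ together with all their derivatives. For a vector $\mathbf k=(k_1,\dots,k_N)$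 of integers $0\le k_1<\dots<k_N\le r$ and $x\in X$ put $M_{\mathbf k}(x)=(\|x^{(k_1)}\|,\dots,\|x^{(k_N)}\|)$. $A_{\mathbf k}(X)\subset\mathbb R^N$ is the set of all nonzero vectors of the form $M_{\mathbf k}(x)$, $x\in X$. Interior $\operatorname{int}$ and boundary $\partial$ are taken in $\mathbb R^N$. Ideal splines (of order $r$). Let $m\ge 0$ be an integer, $\lambda_1,\dots,\lambda_m>0$ and $a_1,\dots,a_m>0$ pairwise distinct. An $L^{r,\cup}_{\infty,\infty}(\mathbb R_-)$-ideal spline with $m$ knots $-a_1,\dots,-a_m$ is $\phi(t)=\frac1{r!}\sum_{s=1}^m\lambda_s(a_s+t)_+^r$. An $AM(\mathbb R_-)$-ideal spline with $m$ knots $-a_1,\dots,-a_m$ is $\phi(t)=\sum_{s=1}^m\lambda_s a_s^r e^{t/a_s}$. (For $m=0$ the sum is $0$.) The spline $\phi(X,M)$. Let $\mathbf l=(l_1,\dots,l_{2n})$ be a vector of an even number of integers with $0<l_1<\dots<l_{2n}\le r$, and let $M\in A_{\mathbf l}(X)$. If $M\in\operatorname{int}A_{\mathbf l}(X)$, then $\phi(X,M)$ denotes the unique $X$-ideal spline with $n$ knots such that $M_{\mathbf l}(\phi(X,M))=M$. If $M\in\partial A_{\mathbf l}(X)\cap A_{\mathbf l}(X)$, then $\phi(X,M)$ denotes the unique $X$-ideal spline with at most $\left[\frac{2n-1}{2}\right]=n-1$ knots such that $M_{\mathbf l}(\phi(X,M))=M$. (Existence and uniqueness hold in both cases.) $\phi^{(k_1)}(X,M)$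 denotes its $k_1$-th derivative. In the claim this is applied to $M_{\mathbf k'}$ for $d$ odd and to $M_{\mathbf k''}$ for $d$ even; in each condition of the claim the relevant tuple lies in the corresponding set $A$, since $M_{\mathbf k'}\in A_{\mathbf k'}(X)$ with positive entries implies $M_{\mathbf k''}\in A_{\mathbf k''}(X)$. *)

(* Defs.v *)
From HB Require Import structures.
From mathcomp Require Import all_boot all_order all_algebra.
From mathcomp Require Import all_classical all_reals all_analysis.

Set Implicit Arguments.
Unset Strict Implicit.
Unset Printing Implicit Defensive.

Import Order.TTheory GRing.Theory Num.Theory.
Import numFieldNormedType.Exports.

Local Open Scope classical_set_scope.
Local Open Scope ring_scope.

(* A function on R_- is represented by a total function [f : R -> R]. Every
   notion below depends on [f] only through its values on R_-. *)

Section HalfLine.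
Context {R : realType}.
Implicit Types (f x : R -> R) (t a b : R).

Definition Rneg : set R := [set t | t <= 0].

Definition diff_quot f t : R -> R := fun s => (f s - f t) / (s - t).

(* Derivatives are relative to R_-: two-sided at [t < 0], left-sided at 0. *)
Definition derivable_neg f t : Prop :=
  cvg (diff_quot f t s @[s --> within Rneg (dnbhs t)]).

Definition deriv_neg f : R -> R :=
  fun t => lim (diff_quot f t s @[s --> within Rneg (dnbhs t)]).

Definition derivn_neg (j : nat) f : R -> R := iter j deriv_neg f.

(* The value of [lim] where the limit does not exist is irrelevant here, since
   this is an essential supremum and [derivn_neg r x] is only required to exist
   almost everywhere for [x] in the class [Lr]. *)
Definition norm_neg f : \bar R :=
  Lnorm (@lebesgue_measure R) +oo%E (EFin \o (f \_ Rneg)).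

(* Measurability is Borel measurability; this is no restriction in [Lr], where
   it is only required of a continuous function and of the derivative of a
   continuous function. *)
Definition Linfty_neg f : Prop :=
  measurable_fun Rneg f /\ (norm_neg f < +oo)%E.

Definition abs_cont_on f a b : Prop :=
  forall e : R, 0 < e -> exists2 d : R, 0 < d &
    forall (n : nat) (u v : 'I_n -> R),
      (forall i, a <= u i /\ u i <= v i /\ v i <= b) ->
      trivIset setT (fun i => `]u i, v i[%classic) ->
      \sum_(i < n) (v i - u i) < d ->
      \sum_(i < n) `|f (v i) - f (u i)| < e.

Definition loc_abs_cont_neg f : Prop :=
  forall a b, a <= b -> b <= 0 -> abs_cont_on f a b.

Definition nondecreasing_neg f : Prop :=
  forall s t, s <= t -> t <= 0 -> f s <= f t.

Definition convex_neg f : Prop := convex_function Rneg f.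

Definition Lr (r : nat) : set (R -> R) :=
  [set x | [/\ Linfty_neg x,
    (forall j t, (j < r.-1)%N -> t <= 0 -> derivable_neg (derivn_neg j x) t),
    loc_abs_cont_neg (derivn_neg r.-1 x)
    & Linfty_neg (derivn_neg r x)]].

Definition Lr_cup (r : nat) : set (R -> R) :=
  [set x | [/\ Lr r x,
    (forall t, t <= 0 -> 0 <= x t)
    & forall j, (j < r)%N ->
        nondecreasing_neg (derivn_neg j x) /\ convex_neg (derivn_neg j x)]].

Definition AM : set (R -> R) :=
  [set x | forall j t, t <= 0 ->
    derivable_neg (derivn_neg j x) t /\ 0 <= derivn_neg j x t].

End HalfLine.

Inductive function_class := Class_Lr_cup | Class_AM.

Section Kolmogorov.
Context {R : realType}.
Variable r : nat.
Implicit Types (X : function_class) (x : R -> R).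

Definition class_set X : set (R -> R) :=
  match X with Class_Lr_cup => Lr_cup r | Class_AM => AM end.

Definition has_norms N (l : 'I_N -> nat) (M : 'rV[R]_N) x : Prop :=
  forall i, norm_neg (derivn_neg (l i) x) = (M 0 i)%:E.

Definition admissible X N (l : 'I_N -> nat) : set 'rV[R]_N :=
  [set M | M != 0 /\ exists2 x, class_set X x & has_norms l M x].

Definition spline_fun X m (lam a : 'I_m -> R) : R -> R :=
  match X with
  | Class_Lr_cup => fun t =>
      (r`!%:R)^-1 * \sum_(s < m) lam s * (Num.max (a s + t) 0) ^+ r
  | Class_AM => fun t => \sum_(s < m) lam s * a s ^+ r * expR (t / a s)
  end.

(* The knots are the points [- a s]. *)
Definition ideal_spline X (m : nat) : set (R -> R) :=
  [set f | exists lam a : 'I_m -> R,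
    [/\ forall s, 0 < lam s, forall s, 0 < a s, injective a
      & f = spline_fun X lam a]].

Definition boundary (T : topologicalType) (A : set T) : set T :=
  closure A `\` A°.

(* The defining property of phi(X, M); it is meant for [N = 2n] even, so that
   [N./2 = n] and [N.-1./2 = n - 1]. *)
Definition is_phi X N (l : 'I_N -> nat) (M : 'rV[R]_N) (f : R -> R) : Prop :=
  has_norms l M f /\
  ((admissible X l)° M /\ ideal_spline X N./2 f \/
   (boundary (admissible X l) `&` admissible X l) M /\
     exists2 m, (m <= N.-1./2)%N & ideal_spline X m f).

Definition phi X N (l : 'I_N -> nat) (M : 'rV[R]_N) : R -> R :=
  get (is_phi X l M).

End Kolmogorov.

(* Main.v *)
(* Up to positive weights, the norms of [x] are the power moments of a positive
   measure on ]0, +oo[ (representing [x] as a mixture of one-knot splines), plus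
   a mass at 0 for [x(-oo)]. The measure exists in atomic form because a
   nonnegative sparse polynomial pairs nonnegatively with [x], by integration by
   parts, and pairing to zero confines the measure to the roots. The admissible
   set is thus a moment cone, and ideal splines are the atomic measures. By
   Descartes' rule a nonnegative polynomial supported on [E] has at most
   [(#|E| - 1)/2] positive roots, and one with prescribed double roots exists;
   such polynomials separate points from the cone and give all the bounds. *)

Require Import Defs.
From HB Require Import structures.
From mathcomp Require Import all_boot all_order all_algebra.
From mathcomp Require Import all_classical all_reals all_analysis.
From mathcomp Require Import polyrcf polyorder ess_sup_inf.
From mathcomp Require Import measurable_realfun measurable_fun_approximation.
From mathcomp Require cauchyreals.
From mathcomp Require Import zify ring lra.

Set Implicit Arguments.
Unset Strict Implicit.
Unset Printing Implicit Defensive.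

Import Order.TTheory GRing.Theory Num.Theory.
Import numFieldNormedType.Exports.

Local Open Scope classical_set_scope.
Local Open Scope ring_scope.

(** * Sparse polynomials *)

(** A knot [-a] becomes an atom at [u = 1/a]; the two classes then differ only through the weights
    [wt]. The cone is not closed: a mass [u ^ -r] moving to infinity leaves only the top moment.
    Hence separation is applied at points that are merely not interior and yields a weak inequality.
    For even [d] the same escape makes the inequality strict over an interior [M']: equality would
    require the excess of the top moment to sit at infinity. A mass at [u = 0] is seen only by the
    exponent 0, which is the whole difference between [k1 = 0] and [k1 > 0] over a boundary point.
    No integral representation of [x] is proved. A vector outside the cone yields a sparse
    polynomial on which the functional of [x] must vanish, and a positive functional with such a
    zero is already a finite sum of point evaluations, which contradicts the choice of the vector.
    For absolutely monotone functions positivity is the limit of positivity at finite order, as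
    [(1 + t u / n) ^ n] tends to [e ^ (t u)]. *)

Section Descartes.
Context {R : rcfType}.
Implicit Types (p q : {poly R}) (s : seq R).

Definition nterms p := (\sum_(i < size p) (p`_i != 0)%R)%N.

Lemma nterms_widen p n : (size p <= n)%N -> nterms p = (\sum_(i < n) (p`_i != 0)%R)%N.
Proof.
move=> pn; rewrite /nterms.
rewrite (big_ord_widen _ (fun i => (p`_i != 0)%R : nat) pn) big_mkcond.
by apply: eq_bigr => i _; case: ltnP => // h; rewrite nth_default ?eqxx.
Qed.

Lemma nterms_deriv p : p`_0 != 0 -> nterms p = (nterms p^`()).+1.
Proof.
move=> p0; have spp : (0 < size p)%N by rewrite lt0n; apply: contraNneq p0 => /size0nil ->.
have := leqnn (size p); rewrite -{2}(prednK spp) => h.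
rewrite (nterms_widen h) big_ord_recl /= p0 add1n; congr S.
rewrite (@nterms_widen _ (size p).-1); last by rewrite -ltnS prednK // lt_size_deriv // -size_poly_gt0.
by apply: eq_bigr => i _; rewrite coef_deriv mulrn_eq0.
Qed.

Lemma nterms_mulX p : nterms (p * 'X) = nterms p.
Proof.
have [->|p0] := eqVneq p 0; first by rewrite mul0r.
rewrite (@nterms_widen (p * 'X) (size p).+1) ?size_mulX // big_ord_recl coefMX /= eqxx add0n.
by apply: eq_bigr => i _; rewrite coefMX.
Qed.

Lemma mup_deriv p z : p^`() != 0 -> (mup z p <= (mup z p^`()).+1)%N.
Proof.
move=> p'0; have p0 : p != 0 by apply: contra_neq p'0 => ->; rewrite derivC.
case E : (mup z p) => [|n] //; rewrite ltnS mup_geq //.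
have : ('X - z%:P) ^+ n.+1 %| p by rewrite -mup_geq // E.
move=> /dvdpP[q ->]; rewrite derivM deriv_exp /=; apply: dvdp_add.
  by rewrite exprS mulrA dvdp_mull.
by rewrite -scaler_nat -scalerAr dvdpZr ?pnatr_eq0 // !dvdp_mull.
Qed.

Lemma mup_gt0 p z : p != 0 -> (0 < mup z p)%N = root p z.
Proof. by move=> p0; rewrite -XsubC_dvd // dvdp_XsubCl. Qed.

(** Rolle between consecutive zeros. The new points avoid the old zeros, so that both families can
    be counted together. *)
Lemma rolle_seq p x s : path <%R x s -> all (root p) (x :: s) ->
  exists m : seq R, [/\ size m = size s, path <%R x m, all (root p^`()) m
    & forall z, z \in m -> z \notin x :: s].
Proof.
elim: s x => [|y s IH] x /=; first by exists [::].
move=> /andP[xy ys] /and3P[rx ry rs].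
have [|m [sm pm rm hm]] := IH y ys; first by rewrite /= ry.
have [|c /itvP cxy rc] := @poly_rolle _ x y p xy; first by rewrite (eqP rx) (eqP ry).
exists (c :: m); split => /=.
- by rewrite sm.
- rewrite cxy /=; case: m pm {sm rm hm} => //= a m /andP[ya ->]; rewrite andbT.
  by rewrite (lt_trans _ ya) // cxy.
- by rewrite rm andbT /root rc.
- have ltall : forall (a : R) t, path <%R a t -> forall b, b \in t -> a < b.
    by move=> a t h; exact/allP/(lt_path_min h).
  move=> z; rewrite inE => /orP[/eqP ->|zm].
    rewrite inE (gt_eqF) ?cxy //= inE lt_eqF ?cxy //=.
    apply/negP => /(ltall _ _ ys) yc.
    by have := lt_trans yc (_ : c < y); rewrite ltxx cxy => /(_ isT).
  rewrite inE negb_or hm // andbT gt_eqF //.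
  exact: lt_trans xy (ltall _ _ pm _ zm).
Qed.

(** Each distinct zero of [p] loses one unit of multiplicity in the derivative, and Rolle gives one
    unit back in every gap; there is one gap fewer than zeros. *)
Lemma sum_mup_deriv p s : p^`() != 0 -> uniq s -> all (fun z => 0 < z) s ->
  exists s', [/\ uniq s', all (fun z => 0 < z) s' &
    (\sum_(z <- s) mup z p <= (\sum_(z <- s') mup z p^`()).+1)%N].
Proof.
move=> p'0 us ps; have p0 : p != 0 by apply: contra_neq p'0 => ->; rewrite derivC.
set t := sort <=%R [seq z <- s | root p z].
have ut : uniq t by rewrite sort_uniq filter_uniq.
have pt : all (fun z => 0 < z) t.
  by apply/allP => z; rewrite mem_sort mem_filter => /andP[_ /(allP ps)].
have rt : all (root p) t by apply/allP => z; rewrite mem_sort mem_filter => /andP[].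
have st : sorted <%R t by rewrite lt_sorted_uniq_le ut sort_le_sorted.
have -> : (\sum_(z <- s) mup z p = \sum_(z <- t) mup z p)%N.
  have pe : perm_eq t [seq z <- s | root p z] by rewrite /t perm_sort.
  rewrite (perm_big _ pe) /= big_filter [RHS]big_mkcond; apply: eq_bigr => z _.
  by case: ifPn => // /mupNroot ->.
case: t ut pt rt st => [|x t] ut pt rt st; first by exists [::]; rewrite big_nil.
have [m [sm pm rm hm]] := rolle_seq st rt.
exists ((x :: t) ++ m); split.
- rewrite cat_uniq ut; apply/andP; split => //; apply/andP; split.
    by apply/hasPn => z /hm.
  have : sorted <%R m by case: (m) pm => //= a m' /andP[].
  by move=> /lt_sorted_uniq.
- rewrite all_cat pt; apply/allP => z zm.
  have xz : x < z by exact: (allP (lt_path_min pm)).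
  by apply: lt_trans xz; move: pt => /= /andP[].
rewrite big_cat /=.
have h1 : (\sum_(z <- x :: t) mup z p <= \sum_(z <- x :: t) mup z p^`() + (size t).+1)%N.
  have -> : ((size t).+1 = \sum_(z <- x :: t) 1)%N by rewrite sum1_size.
  rewrite -big_split /=; apply: leq_sum => z _; rewrite addn1; exact: mup_deriv.
apply: leq_trans h1 _; rewrite addnS ltnS leq_add2l -sm -sum1_size.
rewrite !big_seq; apply: leq_sum => z zm; rewrite mup_gt0 //; exact: (allP rm).
Qed.

(** Once powers of ['X] are divided out, differentiation removes exactly one term and costs at most
    one positive zero. *)
Lemma descartes p s : p != 0 -> uniq s -> all (fun z => 0 < z) s ->
  (\sum_(z <- s) mup z p < nterms p)%N.
Proof.
have [n] := ubnP (size p); elim: n => // n IH in p s *; rewrite ltnS => sp p0 us ps.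
have [c0|c0] := eqVneq p`_0 0.
  have : root p 0 by rewrite /root horner_coef0 c0.
  rewrite -dvdp_XsubCl subr0 => /dvdpP[q pq].
  have q0 : q != 0 by apply: contra_neq p0; rewrite pq => ->; rewrite mul0r.
  rewrite pq nterms_mulX.
  have -> : (\sum_(z <- s) mup z (q * 'X) = \sum_(z <- s) mup z q)%N.
    rewrite !big_seq; apply: eq_bigr => z /(allP ps) z0; rewrite mupMl //.
    by rewrite rootX gt_eqF.
  by apply: IH => //; move: sp; rewrite pq size_mulX.
rewrite nterms_deriv // ltnS.
have [p'0|p'0] := eqVneq p^`() 0.
  have sp1 : (size p <= 1)%N.
    by move/eqP: p'0; rewrite -size_poly_eq0 size_deriv; case: (size p) => [|[]].
  rewrite big1 // => z _; rewrite mupNroot //.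
  by rewrite (size1_polyC sp1) rootC.
have [s' [us' ps' hs']] := sum_mup_deriv p'0 us ps.
apply: leq_trans hs' _; apply: IH => //.
exact: leq_trans (lt_size_deriv p0) sp.
Qed.


Definition supp_in (E : seq nat) p := forall j, p`_j != 0 -> j \in E.

Lemma nterms_count E p : uniq E -> supp_in E p ->
  nterms p = count (fun j => p`_j != 0) E.
Proof.
move=> uE sE.
have -> : nterms p = size [seq j <- iota 0 (size p) | p`_j != 0].
  rewrite -sum1_size big_filter big_mkcond /nterms.
  rewrite -(big_mkord xpredT (fun i => (p`_i != 0)%R : nat)) /index_iota subn0 /=.
  by apply: eq_bigr => i _; case: ifP.
rewrite -size_filter; apply: perm_size; apply: uniq_perm.
- by rewrite filter_uniq // iota_uniq.
- by rewrite filter_uniq.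
move=> j; rewrite !mem_filter mem_iota add0n /=.
have [//|pj] := eqVneq p`_j 0; rewrite (sE _ pj) /=.
by rewrite ltnNge; apply: contra pj => h; rewrite nth_default.
Qed.

Lemma nterms_le_size E p : uniq E -> supp_in E p -> (nterms p <= size E)%N.
Proof. by move=> uE sE; rewrite (nterms_count uE sE) count_size. Qed.

Lemma nterms_full E p : uniq E -> supp_in E p -> (size E <= nterms p)%N ->
  forall j, j \in E -> p`_j != 0.
Proof.
move=> uE sE; rewrite (nterms_count uE sE) => h j jE.
have : all (fun j => p`_j != 0) E.
  by rewrite all_count eqn_leq count_size h.
by move=> /allP/(_ _ jE).
Qed.

(** The residues of the monomials of [E] modulo [D] outnumber the dimension of the residue space,
    hence are dependent; the coefficients of a dependency are those of [p]. *)
Lemma sparse_multiple E (D : {poly R}) : uniq E -> D != 0 -> (size D <= size E)%N ->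
  exists p, [/\ p != 0, supp_in E p & D %| p].
Proof.
move=> uE D0 sDE.
set n := (size D).-1; set N := size E.
pose A : 'M[R]_(N, n) := \matrix_(i < N) poly_rV ('X^(nth 0%N E i) %% D).
have : (0 < \rank (kermx A))%N.
  rewrite mxrank_ker subn_gt0; apply: leq_ltn_trans (rank_leq_col A) _.
  by rewrite /n; apply: leq_trans sDE; rewrite prednK // lt0n size_poly_eq0.
rewrite lt0n mxrank_eq0 => /rowV0Pn[v /sub_kermxP vA v0].
pose p : {poly R} := \sum_(i < N) v 0 i *: 'X^(nth 0%N E i).
have cp : forall i : 'I_N, p`_(nth 0%N E i) = v 0 i.
  move=> i; rewrite coef_sum (bigD1 i) //= big1 ?addr0.
    by rewrite coefZ coefXn eqxx mulr1.
  by move=> j ji; rewrite coefZ coefXn nth_uniq // eq_sym (inj_eq val_inj) (negbTE ji) mulr0.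
exists p; split.
- have [i vi] : exists i, v 0 i != 0.
    apply/existsP; apply: contraR v0; rewrite negb_exists => /forallP v0.
    by apply/eqP/rowP => i; rewrite mxE; apply/eqP; have := v0 i; rewrite negbK.
  by apply: contra_neq vi; rewrite -cp => ->; rewrite coef0.
- move=> j; rewrite coef_sum; apply: contra_neqT => jE.
  rewrite big1 // => i _; rewrite coefZ coefXn; case: eqP => [ji|_]; last by rewrite mulr0.
  by rewrite ji mem_nth in jE.
rewrite /dvdp -[X in X == _](_ : rVpoly (v *m A) = _); first by rewrite vA linear0.
rewrite mulmx_sum_row linear_sum /=.
have -> : p %% D = \sum_(i < N) (v 0 i *: 'X^(nth 0%N E i)) %% D.
  by rewrite /p; elim/big_rec2 : _ => [|i a b _ <-]; rewrite ?mod0p ?modpD.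
apply: eq_bigr => i _; rewrite linearZ /= rowK poly_rV_K; last first.
  by rewrite -ltnS prednK ?ltn_modp // lt0n size_poly_eq0.
by rewrite modpZl.
Qed.

Definition nonneg_pos p := forall u, 0 < u -> 0 <= p.[u].

Lemma horner_near0 p : exists2 K, 0 <= K & forall u, 0 <= u <= 1 -> `|p.[u] - p`_0| <= K * u.
Proof.
elim/poly_ind: p => [|p c [K K0 hK]].
  by exists 0 => // u _; rewrite horner0 coef0 subrr normr0 mul0r.
exists (K + `|p`_0|) => [|u /andP[u0 u1]]; first by rewrite addr_ge0.
rewrite hornerMXaddC coefD coefMX coefC /= add0r addrK normrM (ger0_norm u0).
rewrite ler_wpM2r // -(subrK p`_0 p.[u]) (le_trans (ler_normD _ _)) // lerD2r.
apply: (le_trans (hK u _)); rewrite ?u0 //.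
by rewrite -[leRHS]mulr1 ler_wpM2l.
Qed.

Lemma nonneg_coef0 p : nonneg_pos p -> 0 <= p`_0.
Proof.
move=> pp; rewrite leNgt; apply/negP => p0.
have [K K0 hK] := horner_near0 p.
(* Small enough that the deviation [K * u] is at most half the modulus of the negative constant
   coefficient. *)
pose u := - p`_0 / (2 * (K - p`_0)).
have d0 : 0 < 2 * (K - p`_0) by lra.
have u0 : 0 < u by rewrite divr_gt0 //; lra.
have u1 : u <= 1 by rewrite /u ler_pdivrMr //; lra.
have := hK u; rewrite (ltW u0) u1 => /(_ isT).
have := pp _ u0.
have : K * u <= - p`_0 / 2.
  rewrite /u mulrA ler_pdivrMr // -[leRHS]mulrA.
  by have : 0 <= p`_0 ^+ 2 := sqr_ge0 _; nra.
by rewrite ler_norml => ? ? /andP[? ?]; lra.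
Qed.

Lemma nonneg_low p e : nonneg_pos p -> (forall j, (j < e)%N -> p`_j = 0) -> 0 <= p`_e.
Proof.
move=> pp pl.
have : 'X^e %| p.
  rewrite (_ : p = \poly_(i < size p) p`_i); last by rewrite coefK.
  rewrite poly_def; apply: (big_ind (fun q => 'X^e %| q)); rewrite ?dvdp0 //.
    by move=> q1 q2; exact: dvdp_add.
  move=> i _; have [ie|ie] := ltnP i e; first by rewrite pl // scale0r dvdp0.
  by rewrite -(subnK ie) exprD scalerAl dvdp_mull.
move=> /dvdpP[q pq]; have -> : p`_e = q`_0 by rewrite pq coefMXn ltnn subnn.
apply: nonneg_coef0 => u u0; have := pp u u0.
by rewrite pq hornerM hornerXn pmulr_lge0 // exprn_gt0.
Qed.

Definition rev_poly n p := \poly_(i < n.+1) p`_(n - i).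

Lemma horner_rev n p u : (size p <= n.+1)%N -> u != 0 ->
  (rev_poly n p).[u] = u ^+ n * p.[u^-1].
Proof.
move=> sp u0; rewrite /rev_poly horner_poly (horner_coef_wide _ sp) mulr_sumr.
rewrite (reindex_inj rev_ord_inj) /=; apply: eq_bigr => i _.
have ni : (i <= n)%N by rewrite -ltnS.
rewrite subSS subKn // mulrCA; congr (_ * _).
have -> : u ^+ n = u ^+ (n - i) * u ^+ i by rewrite -exprD subnK.
by rewrite exprVn mulfK // expf_neq0.
Qed.

Lemma coef_rev n p j : (j <= n)%N -> (rev_poly n p)`_j = p`_(n - j).
Proof. by move=> jn; rewrite coef_poly ltnS jn. Qed.

Lemma nonneg_top p e : nonneg_pos p -> (forall j, (e < j)%N -> p`_j = 0) -> 0 <= p`_e.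
Proof.
move=> pp pl; have sp : (size p <= e.+1)%N by apply/leq_sizeP => j; exact: pl.
rewrite -{1}(subn0 e) -coef_rev //; apply: nonneg_coef0 => u u0.
by rewrite horner_rev ?gt_eqF // mulr_ge0 ?exprn_ge0 ?(ltW u0) // pp // invr_gt0.
Qed.

(** With [p = q * ('X - z)], nonnegativity of [p] makes [q] nonnegative to the right of [z] and
    nonpositive to the left, so [q] vanishes at [z] too. The compositions [qz] and [qz'] move the
    two sides to the origin. *)
Lemma mup_ge2P p a b z : p != 0 -> a < z -> z < b -> (forall u, a < u < b -> 0 <= p.[u]) ->
  root p z -> (1 < mup z p)%N.
Proof.
move=> p0 az zb pp; rewrite -dvdp_XsubCl => /dvdpP[q pq].
rewrite mup_geq // pq exprS expr1 dvdp_mul2r ?polyXsubC_eq0 // dvdp_XsubCl /root.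
have hq u : p.[u] = q.[u] * (u - z) by rewrite pq hornerM !hornerE.
pose qz := q \Po ('X + z%:P); pose qz' := q \Po (z%:P - 'X).
have cz : qz`_0 = q.[z] by rewrite -horner_coef0 horner_comp !hornerE ?add0r ?subr0.
have cz' : qz'`_0 = q.[z] by rewrite -horner_coef0 horner_comp !hornerE ?add0r ?subr0.
rewrite eq_le; apply/andP; split; [rewrite -cz'|rewrite -cz].
  rewrite leNgt; apply/negP => h.
  have [K K0 hK] := horner_near0 qz'.
  pose u := Num.min (Num.min 1 ((z - a) / 2)) (qz'`_0 / (2 * (K + 1))).
  have u0 : 0 < u by rewrite !lt_min ltr01 !divr_gt0 //; lra.
  have u1 : u <= 1 by rewrite /u !ge_min lexx.
  have u2 : u <= (z - a) / 2 by rewrite /u !ge_min lexx orbT.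
  have u3 : (K + 1) * u <= qz'`_0 / 2.
    have u4 : u <= qz'`_0 / (2 * (K + 1)) by rewrite /u ge_min lexx orbT.
    by move: u4; rewrite ler_pdivlMr; lra.
  have := hK u; rewrite (ltW u0) u1 => /(_ isT).
  have /pp : a < z - u < b by lra.
  rewrite hq (_ : z - u - z = - u); last by ring.
  rewrite mulrN oppr_ge0 pmulr_lle0 // => h1.
  rewrite horner_comp !hornerE ler_norml => /andP[h2 _].
  by nra.
rewrite leNgt; apply/negP => h.
have [K K0 hK] := horner_near0 qz.
pose u := Num.min (Num.min 1 ((b - z) / 2)) (- qz`_0 / (2 * (K + 1))).
have u0 : 0 < u by rewrite !lt_min ltr01 !divr_gt0 //; lra.
have u1 : u <= 1 by rewrite /u !ge_min lexx.
have u2 : u <= (b - z) / 2 by rewrite /u !ge_min lexx orbT.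
have u3 : (K + 1) * u <= - qz`_0 / 2.
    have u4 : u <= - qz`_0 / (2 * (K + 1)) by rewrite /u ge_min lexx orbT.
    by move: u4; rewrite ler_pdivlMr; lra.
have := hK u; rewrite (ltW u0) u1 => /(_ isT).
have /pp : a < u + z < b by lra.
rewrite hq (_ : u + z - z = u); last by ring.
rewrite pmulr_lge0 // => h1.
rewrite horner_comp !hornerE ler_norml => /andP[_ h2].
by nra.
Qed.

Lemma nonneg_mup_ge2 p z : p != 0 -> nonneg_pos p -> 0 < z -> root p z -> (1 < mup z p)%N.
Proof.
move=> p0 pp z0; apply: (@mup_ge2P p 0 (z + 1)) => //; first by lra.
by move=> u /andP[u0 _]; exact: pp.
Qed.

(** Positive zeros of a nonnegative polynomial are at least double, so Descartes' rule counts each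
    of them twice. *)
Lemma nonneg_zeros E p s : uniq E -> supp_in E p -> p != 0 -> nonneg_pos p ->
  uniq s -> all (fun z => 0 < z) s -> all (root p) s -> ((size s).*2 < size E)%N.
Proof.
move=> uE sE p0 pp us ps rs.
apply: leq_trans (nterms_le_size uE sE); apply: leq_trans (descartes p0 us ps).
rewrite ltnS -muln2 -sum1_size big_distrl /= !big_seq; apply: leq_sum => z zs.
by rewrite mul1n nonneg_mup_ge2 // ?(allP ps) ?(allP rs).
Qed.

(** A sparse multiple of the squared product saturates Descartes' rule. Saturation gives everything
    else: no coefficient on [E] vanishes, there is no further positive zero, and the cofactor keeps
    one sign on the half-line. *)
Lemma nonneg_double E s : uniq E -> size E = (size s).*2.+1 ->
  uniq s -> all (fun z => 0 < z) s ->
  exists p, [/\ p != 0, supp_in E p, nonneg_pos p, all (root p) s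
    & forall j, j \in E -> p`_j != 0] /\ (forall u, 0 < u -> root p u -> u \in s).
Proof.
move=> uE sE us ps.
set D : {poly R} := (\prod_(z <- s) ('X - z%:P)) ^+ 2.
have mD : D \is monic by rewrite monic_exp // monic_prod_XsubC.
have sD : size D = size E.
  rewrite size_monicM ?monic_prod_XsubC ?monic_neq0 ?monic_prod_XsubC //.
  by rewrite !size_prod_XsubC sE -addnn addnS.
have [|p [p0 sp Dp]] := sparse_multiple uE (monic_neq0 mD); first by rewrite sD.
have mge z : z \in s -> (1 < mup z p)%N.
  move=> zs; rewrite mup_geq //; apply: dvdp_trans Dp; apply: dvdp_exp2r.
  by rewrite dvdp_XsubCl root_prod_XsubC.
have sum2 : (\sum_(z <- s) 2 = (size s).*2)%N by rewrite big_const_seq count_predT iter_addn_0 mul2n.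
have ge2 : ((size s).*2 <= \sum_(z <- s) mup z p)%N.
  by rewrite -sum2 !big_seq; apply: leq_sum => z /mge.
have full : forall j, j \in E -> p`_j != 0.
  apply: nterms_full => //; rewrite sE.
  exact: leq_ltn_trans ge2 (descartes p0 us ps).
have nt : (nterms p <= (size s).*2.+1)%N by rewrite -sE nterms_le_size.
have nomore u : 0 < u -> root p u -> u \in s.
  move=> u0 ru; apply: contraLR isT => us'.
  have := @descartes p (u :: s) p0; rewrite /= us' us u0 ps => /(_ isT isT).
  rewrite big_cons => /leq_trans/(_ nt); rewrite ltnS leqNgt => /negP[].
  by apply: leq_ltn_trans ge2 _; rewrite -[X in (X < _)%N]add0n ltn_add2r mup_gt0.
have [q pq] := dvdpP _ _ Dp.
have q0 : q != 0 by apply: contra_neq p0; rewrite pq => ->; rewrite mul0r.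
have qnr u : 0 < u -> ~~ root q u.
  move=> u0; apply/negP => ru.
  have us' : u \in s by apply: nomore => //; rewrite pq rootM ru.
  have : (2 < mup u p)%N.
    have a1 : (1 <= mup u q)%N by rewrite mup_gt0.
    have a2 : (2 <= mup u D)%N.
      by rewrite mup_geq ?monic_neq0 // dvdp_exp2r // dvdp_XsubCl root_prod_XsubC.
    by rewrite pq mupM ?(monic_neq0 mD) // (leq_trans _ (leq_add a1 a2)).
  move=> h3; have := leq_trans (descartes p0 us ps) nt.
  rewrite ltnS leqNgt => /negP; apply.
  rewrite -sum2 !(perm_big _ (perm_to_rem us')) /= !big_cons -addSn leq_add //.
  rewrite !big_seq; apply: leq_sum => z zr; apply: mge; exact: mem_rem zr.
have D_ge0 u : 0 <= D.[u] by rewrite horner_exp sqr_ge0.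
have sg u : 0 < u -> 0 < q.[u] * q.[1].
  move=> u0; rewrite lt_neqAle eq_sym mulf_neq0 /=; last exact: qnr; last exact: qnr.
  rewrite leNgt; apply/negP => h; have [u1|/ltW u1] := leP u 1.
    have [c cc rc] := poly_ivtoo u1 h; have := qnr c; rewrite rc => /(_ _)/negP; apply => //.
    by apply: lt_trans u0 _; rewrite (itvP cc).
  rewrite mulrC in h; have [c cc rc] := poly_ivtoo u1 h.
  have := qnr c; rewrite rc => /(_ _)/negP; apply => //.
  by apply: lt_trans (@ltr01 R) _; rewrite (itvP cc).
have q10 : q.[1] != 0 by apply: qnr.
(* The cofactor has constant sign, so its value at 1 is the factor that makes the product
   nonnegative. *)
exists (q.[1] *: p); split; last by move=> u u0; rewrite rootZ //; exact: nomore.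
split.
- by rewrite scaler_eq0 negb_or q10.
- by move=> j; rewrite coefZ mulf_eq0 negb_or => /andP[_ /sp].
- by move=> u u0; rewrite hornerZ pq hornerM mulrA mulr_ge0 // mulrC ltW // sg.
- by apply/allP => z /mge h; rewrite rootZ // -mup_gt0 // ltnW.
- by move=> j jE; rewrite coefZ mulf_neq0 // full.
Qed.

End Descartes.

(** * Separation for convex cones in finite dimension *)

Section Separation.
Context {R : realType}.

Definition dotv n (c v : 'rV[R]_n) : R := \sum_i c 0 i * v 0 i.

Lemma dotvDr n (c u v : 'rV[R]_n) : dotv c (u + v) = dotv c u + dotv c v.
Proof. by rewrite /dotv -big_split; apply: eq_bigr => i _; rewrite mxE mulrDr. Qed.

Lemma dotvZr n (c v : 'rV[R]_n) t : dotv c (t *: v) = t * dotv c v.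
Proof. by rewrite /dotv mulr_sumr; apply: eq_bigr => i _; rewrite mxE mulrCA. Qed.

Lemma dotvNr n (c v : 'rV[R]_n) : dotv c (- v) = - dotv c v.
Proof. by rewrite -scaleN1r dotvZr mulN1r. Qed.

Lemma dotv_row_mx n (a : 'rV[R]_1) (c : 'rV[R]_n) b v :
  dotv (row_mx a c) (row_mx b v) = a 0 0 * b 0 0 + dotv c v.
Proof.
rewrite /dotv big_split_ord big_ord1 /= !row_mxEl; congr (_ + _).
by apply: eq_bigr => i _; rewrite !row_mxEr.
Qed.

Definition convex_cone n (C : set 'rV[R]_n) := [/\ C 0,
  forall u v, C u -> C v -> C (u + v) & forall t u, 0 <= t -> C u -> C (t *: u)].

(** Hahn-Banach, one coordinate at a time. Vectors with first coordinate 1 bound the new coefficient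
    from below, those with first coordinate -1 from above; [hA] makes the bounds compatible, and the
    least admissible value is taken. *)
Lemma superlinear_le_dotv n (f : 'rV[R]_n -> R) :
  (forall u v, f u + f v <= f (u + v)) ->
  (forall t u, 0 < t -> t * f u <= f (t *: u)) ->
  exists c, forall v, f v <= dotv c v.
Proof.
elim: n f => [|n IH] f fD fZ.
  exists 0 => v; have := fD v v; rewrite [v + v]thinmx0 [v]thinmx0 /dotv big_ord0.
  by lra.
have row1 (t s : R) (w : 'rV[R]_n) : t *: row_mx s%:M w = row_mx (t * s)%:M (t *: w).
  by rewrite scale_row_mx scale_scalar_mx.
have rowD (s t : R) (u w : 'rV[R]_n) :
    row_mx s%:M u + row_mx t%:M w = row_mx (s + t)%:M (u + w).
  by rewrite add_row_mx -raddfD.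
have [c0 hc0] : exists c, forall w : 'rV[R]_n, f (row_mx 0%:M w) <= dotv c w.
  apply: IH => [u v|t u t0].
    by rewrite -[in leRHS](addr0 0) -rowD; exact: fD.
  by rewrite -[in leRHS](mulr0 t) -row1; exact: fZ.
pose A := [set f (row_mx 1%:M w) - dotv c0 w | w in [set: 'rV[R]_n]].
have hA w w' : f (row_mx 1%:M w) - dotv c0 w <= dotv c0 w' - f (row_mx (-1)%:M w').
  have := fD (row_mx 1%:M w) (row_mx (-1)%:M w'); rewrite rowD subrr.
  by have := hc0 (w + w'); rewrite dotvDr; lra.
have supA : has_sup A.
  split; first by exists (f (row_mx 1%:M 0) - dotv c0 0), 0.
  by exists (dotv c0 0 - f (row_mx (-1)%:M 0)) => _ [w _ <-]; exact: hA.
have up w : f (row_mx 1%:M w) <= sup A + dotv c0 w.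
  by rewrite -lerBlDr; apply: ub_le_sup; [exact: supA.2|exists w].
have dn w : f (row_mx (-1)%:M w) <= - sup A + dotv c0 w.
  rewrite addrC lerBrDl -lerBrDr; apply: ge_sup => [|_ [w' _ <-]]; first exact: supA.1.
  exact: hA.
have rowE (v : 'rV[R]_(1 + n)) : v = row_mx (lsubmx v 0 0)%:M (rsubmx v).
  by rewrite -mx11_scalar hsubmxK.
exists (row_mx (sup A)%:M c0).
suff H (v : 'rV[R]_(1 + n)) : f v <= @dotv (1 + n) (row_mx (sup A)%:M c0) v by exact: H.
rewrite (rowE v); set s := lsubmx v 0 0; set w := rsubmx v.
rewrite dotv_row_mx !mxE eqxx !mulr1n.
have [s0|s0|->] := ltgtP s 0; last first.
- by rewrite mulr0 add0r; exact: hc0.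
- have := fZ s^-1 (row_mx s%:M w); rewrite invr_gt0 => /(_ s0).
  rewrite row1 mulVf ?gt_eqF // => h; have := le_trans h (up _).
  by rewrite dotvZr mulrC ler_pdivrMr // mulrDl mulrAC mulVf ?gt_eqF // mul1r mulrC.
have s0' : 0 < - s by lra.
have := fZ (- s)^-1 (row_mx s%:M w); rewrite invr_gt0 => /(_ s0').
rewrite row1 (_ : (- s)^-1 * s = -1); last by rewrite invrN mulNr mulVf ?lt_eqF.
move=> h; have := le_trans h (dn _).
rewrite dotvZr mulrC ler_pdivrMr // mulrDl [_ * _ * - s]mulrAC mulVf ?gt_eqF // mul1r.
by rewrite mulrNN mulrC.
Qed.

(** The first coordinate is projected out. A proper projection already carries a functional, by
    induction; otherwise [D] lies on one side of the graph of a superlinear function, and a linear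
    function dominates the latter. *)
Lemma convex_cone_functional n (D : set 'rV[R]_n) : convex_cone D -> D != setT ->
  exists2 c, c != 0 & forall v, D v -> 0 <= dotv c v.
Proof.
elim: n D => [|n IH].
  move=> D [D0 _ _] /eqP[]; apply/seteqP; split => // v _; by rewrite [v]thinmx0.
rewrite -[n.+1]/(1 + n)%N => D [D0 DD DZ] DT.
have row1 (t s : R) (w : 'rV[R]_n) : t *: row_mx s%:M w = row_mx (t * s)%:M (t *: w).
  by rewrite scale_row_mx scale_scalar_mx.
have rowD (s t : R) (u w : 'rV[R]_n) :
    row_mx s%:M u + row_mx t%:M w = row_mx (s + t)%:M (u + w).
  by rewrite add_row_mx -raddfD.
have rowE (v : 'rV[R]_(1 + n)) : v = row_mx (lsubmx v 0 0)%:M (rsubmx v).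
  by rewrite -mx11_scalar hsubmxK.
pose E := [set w : 'rV[R]_n | exists h, D (row_mx h%:M w)].
have cE : convex_cone E.
  split.
  - by exists 0; rewrite raddf0 row_mx0.
  - by move=> u v [a Da] [b Db]; exists (a + b); rewrite -rowD; exact: DD.
  - by move=> t u t0 [a Da]; exists (t * a); rewrite -row1; exact: DZ.
have [ET|/IH -/(_ cE)[c c0 hc]] := eqVneq E setT; last first.
  exists (row_mx 0 c : 'rV[R]_(1 + n)) => [|v Dv].
    by apply: contra_neq c0 => h; rewrite -(row_mxKr (0 : 'rV_1) c) h raddf0.
  rewrite (rowE v) dotv_row_mx mxE mul0r add0r; apply: hc.
  by exists (lsubmx v 0 0); rewrite -rowE.
(* If both directions of the first axis were in [D], then [D] would contain every vertical line over
   a full projection. *)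
have [sg [sg2 Nsg]] : exists sg : R, sg * sg = 1 /\ ~ D (row_mx sg%:M 0).
  apply: contrapT => Nsg.
  case/eqP: DT; apply/seteqP; split => // v _.
  have D1 : D (row_mx 1%:M 0).
    by apply: contrapT => h; apply: Nsg; exists 1; rewrite mulr1.
  have DN1 : D (row_mx (-1)%:M 0).
    by apply: contrapT => h; apply: Nsg; exists (-1); rewrite mulrNN mulr1.
  have Ds s : D (row_mx s%:M 0).
    have [s0|s0] := leP 0 s.
      by rewrite -(mulr1 s) -(scaler0 _ s) -row1; exact: DZ.
    rewrite (_ : s = - s * -1); last by rewrite mulrNN mulr1.
    by rewrite -(scaler0 _ (- s)) -row1; apply: DZ => //; lra.
  have : E (rsubmx v) by rewrite ET.
  move=> [h Dh]; rewrite (rowE v).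
  have := DD _ _ Dh (Ds (lsubmx v 0 0 - h)).
  by rewrite rowD addr0 addrC subrK.
have Eall w : exists h, D (row_mx h%:M w) by have : E w by rewrite ET.
have sgN0 : sg != 0 by apply: contra_eq_neq sg2 => ->; rewrite mulr0 eq_sym oner_neq0.
have bnd w h h' : D (row_mx h%:M w) -> D (row_mx h'%:M (- w)) -> sg * h <= - (sg * h').
  move=> Dh Dh'; rewrite leNgt; apply/negP => hh.
  apply: Nsg; have := DD _ _ Dh Dh'; rewrite rowD subrr => Dhh.
  have s0 : 0 < sg * (h + h') by lra.
  have /DZ/(_ Dhh) : 0 <= (sg * (h + h'))^-1 by rewrite invr_ge0 ltW.
  rewrite row1 scaler0 invfM -mulrA mulVf ?mulr1; last first.
    by apply: contraTneq s0 => ->; rewrite mulr0 ltxx.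
  by rewrite (_ : sg^-1 = sg) // -[sg^-1]mulr1 -sg2 mulKf.
(* The vertical section of [D] over [w], oriented so that it is bounded above. *)
pose S w := [set sg * h | h in [set h | D (row_mx h%:M w)]].
have supS w : has_sup (S w).
  split; first by have [h Dh] := Eall w; exists (sg * h), h.
  have [h' Dh'] := Eall (- w).
  by exists (- (sg * h')) => _ [h Dh <-]; exact: bnd Dh Dh'.
have Sle w h : D (row_mx h%:M w) -> sg * h <= sup (S w).
  by move=> Dh; apply: ub_le_sup; [exact: (supS w).2|exists h].
have [||c hc] := @superlinear_le_dotv n (fun w => sup (S w)).
- move=> u v; rewrite -lerBrDr; apply: ge_sup => [|_ [a Da <-]]; first exact: (supS u).1.
  rewrite lerBrDr -lerBrDl; apply: ge_sup => [|_ [b Db <-]]; first exact: (supS v).1.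
  by rewrite lerBrDl -mulrDr; apply: Sle; rewrite -rowD; exact: DD.
- move=> t u t0; rewrite mulrC -ler_pdivlMr //; apply: ge_sup => [|_ [a Da <-]].
    exact: (supS u).1.
  rewrite ler_pdivlMr // -mulrA [a * t]mulrC; apply: Sle; rewrite -row1.
  by apply: DZ => //; exact: ltW.
exists (row_mx (- sg)%:M c : 'rV[R]_(1 + n)) => [|v Dv].
  apply: contra_neq sgN0 => h.
  have : (- sg)%:M = 0 :> 'rV_1 by rewrite -(row_mxKl (- sg)%:M c) h raddf0.
  by move=> /matrixP/(_ 0 0)/eqP; rewrite !mxE eqxx mulr1n oppr_eq0 => /eqP.
rewrite (rowE v); set s := lsubmx v 0 0.
rewrite dotv_row_mx !mxE eqxx !mulr1n mulNr addrC subr_ge0.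
by apply: le_trans (hc _); apply: Sle; rewrite -rowE.
Qed.

Lemma interior_rVP n (A : set 'rV[R]_n) (M : 'rV[R]_n) :
  A° M <-> exists2 e : R, 0 < e & forall v : 'rV[R]_n, (forall i, `|v 0 i - M 0 i| < e) -> A v.
Proof.
split.
- move=> /nbhs_ballP[e e0 eA]; exists e => // v vM; apply: eA.
  split=> // i j; rewrite ord1 /ball /= distrC; exact: vM.
move=> [e e0 eA]; apply/nbhs_ballP; exists e => // v [_ vM].
by apply: eA => i; rewrite distrC; exact: vM.
Qed.

Lemma interior_shift n (A : set 'rV[R]_n) (M c : 'rV[R]_n) : A° M ->
  exists2 e : R, 0 < e & A (M - e *: c).
Proof.
move=> /interior_rVP[e e0 eA].
have s0 : 0 <= \sum_i `|c 0 i| by rewrite sumr_ge0.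
exists (e / (1 + \sum_i `|c 0 i|)); first by rewrite divr_gt0 //; lra.
apply: eA => i; rewrite !mxE addrAC subrr add0r normrN normrM ger0_norm; last first.
  by rewrite divr_ge0 ?ltW //; lra.
rewrite mulrAC ltr_pdivrMr; last by lra.
rewrite ltr_pM2l // (bigD1 i) //=.
have : 0 <= \sum_(j < n | j != i) `|c 0 j| by rewrite sumr_ge0.
by lra.
Qed.

(** The cone [D] is [C] minus the ray of [M]; a functional that is nonnegative on it is nonnegative
    on [C] and nonpositive at [M]. If [D] were everything, each signed basis vector plus a multiple
    of [M] would lie in [C], and [M] would be interior. *)
Lemma separation n (C : set 'rV[R]_n) (M : 'rV[R]_n) : convex_cone C -> ~ C° M ->
  exists c, [/\ c != 0, forall v, C v -> 0 <= dotv c v & dotv c M <= 0].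
Proof.
move=> [C0 CD CZ] NM.
pose D := [set w | exists2 t, 0 <= t & C (w + t *: M)].
have cD : convex_cone D.
  split.
  - by exists 0; rewrite // scale0r addr0.
  - move=> u v [a a0 Ca] [b b0 Cb]; exists (a + b); rewrite ?addr_ge0 //.
    by rewrite scalerDl addrACA; exact: CD.
  - move=> t u t0 [a a0 Ca]; exists (t * a); rewrite ?mulr_ge0 //.
    by rewrite -scalerA -scalerDr; exact: CZ.
have [DT|DT] := eqVneq D setT; last first.
  have [c c0 hc] := convex_cone_functional cD DT.
  exists c; split=> // [v Cv|]; first by apply: hc; exists 0; rewrite // scale0r addr0.
  rewrite -oppr_ge0 -dotvNr; apply: hc; exists 1 => //.
  by rewrite scale1r addNr.
have Dall w : exists t : R, 0 <= t /\ C (w + t *: M).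
  by have : D w by [rewrite DT]; case=> t; exists t.
have CM : C M.
  have [t [t0 Ct]] := Dall M.
  have t1 : 0 < 1 + t by lra.
  have /CZ/(_ Ct) : 0 <= (1 + t)^-1 by rewrite invr_ge0 ltW.
  by rewrite -{1}(scale1r M) -scalerDl scalerA mulVf ?scale1r // gt_eqF.
have /choice[t ht] : forall ib : 'I_n * bool, exists t, 0 <= t /\
    C ((-1) ^+ ib.2 *: delta_mx 0 ib.1 + t *: M) by move=> ib; exact: Dall.
pose T := 1 + \sum_ib t ib.
have T1 : 0 < T.
  by rewrite /T addrC ltr_pwDr // sumr_ge0 // => ib _; have [] := ht ib.
have hT (ib : 'I_n * bool) : C ((-1) ^+ ib.2 *: delta_mx 0 ib.1 + T *: M).
  have [t0 Ct] := ht ib.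
  rewrite (_ : T = t ib + (1 + \sum_(j | j != ib) t j)); last first.
    by rewrite /T (bigD1 ib) //= addrCA.
  rewrite scalerDl addrA; apply: CD => //; apply: CZ => //.
  by rewrite addr_ge0 // sumr_ge0 // => j _; have [] := ht j.
case: NM; apply/interior_rVP; exists (T^-1 / (n.+1)%:R) => [|v hv].
  by rewrite divr_gt0 ?invr_gt0.
pose d i := v 0 i - M 0 i.
have sd : \sum_i `|d i| <= T^-1.
  have : \sum_(i < n) `|d i| <= \sum_(i < n) (T^-1 / n.+1%:R).
    by apply: ler_sum => i _; exact: ltW (hv i).
  move=> /le_trans; apply; rewrite sumr_const card_ord -[_ *+ n]mulr_natr -mulrA ger_pMr ?invr_gt0 //.
  by rewrite mulrC ler_pdivrMr // mul1r ler_nat.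
(* A point near [M] is a combination of [M] and of the vectors of [hT]; [sd] keeps the coefficient
   of [M] nonnegative. *)
have -> : v = (1 - T * \sum_i `|d i|) *: M +
    \sum_i `|d i| *: ((-1) ^+ (d i < 0)%R *: delta_mx 0 i + T *: M).
  apply/rowP => j; rewrite !mxE summxE.
  have E (i : 'I_n) : (`|d i| *: ((-1) ^+ (d i < 0)%R *: delta_mx 0 i + T *: M)) 0 j =
      d i * (j == i)%:R + `|d i| * (T * M 0 j).
    rewrite !mxE eqxx /= mulrDr mulrA; congr (_ * _ + _).
    by rewrite mulrC -realEsign // num_real.
  rewrite (eq_bigr _ (fun i _ => E i)) big_split /= -mulr_suml.
  set S := \sum_i `|d i|; rewrite (bigD1 j) //= big1 => [|i ij].
    rewrite eqxx mulr1 addr0 {1}/d; move: S => S; ring.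
  by rewrite eq_sym (negbTE ij) mulr0.
apply: (CD).
  apply: (CZ) => //; rewrite subr_ge0 mulrC -ler_pdivlMr // mul1r.
  exact: sd.
apply: (big_ind C) => [||i _]; [exact: C0|exact: CD|apply: CZ => //; exact: (hT (i, _))].
Qed.

End Separation.

(** * Moment cones *)

Section Moments.
Context {R : realType}.
Variable w : nat -> R.
Hypothesis w_gt0 : forall j, 0 < w j.
Let w_neq0 j : w j != 0. Proof. by rewrite gt_eqF. Qed.
Local Hint Resolve w_gt0 w_neq0 : core.
Implicit Types (s : seq (R * R)) (p q : {poly R}) (P : pred R).

(* [s] lists pairs (mass, position). *)
Definition mint s p := \sum_(x <- s) x.1 * p.[x.2].

Definition atoms_in P s := all (fun x => (0 < x.1) && P x.2) s.

Definition pos_atoms := atoms_in (fun u => 0 < u).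

Definition represents N (k : 'I_N -> nat) s kap (M : 'rV[R]_N) :=
  forall i, M 0 i = w (k i) * (mint s 'X^(k i) + kap * (k i == 0%N)%:R).

(* The moment cone; [kap] is the contribution of a mass at [u = 0]. *)
Definition mcone P N (k : 'I_N -> nat) : set 'rV[R]_N :=
  [set M | exists s kap, [/\ atoms_in P s, 0 <= kap & represents k s kap M]].

(** The linear functional whose values on the monomials of [k] are the normalised coordinates of
    [M]. *)
Definition ev N (k : 'I_N -> nat) (M : 'rV[R]_N) p :=
  \sum_i p`_(k i) * (M 0 i / w (k i)).

Lemma mintD s p q : mint s (p + q) = mint s p + mint s q.
Proof. by rewrite -big_split; apply: eq_bigr => x _; rewrite hornerD mulrDr. Qed.

Lemma mintZ s a p : mint s (a *: p) = a * mint s p.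
Proof. by rewrite mulr_sumr; apply: eq_bigr => x _; rewrite hornerZ mulrCA. Qed.

Lemma mint_sum s I (r : seq I) (F : I -> {poly R}) :
  mint s (\sum_(i <- r) F i) = \sum_(i <- r) mint s (F i).
Proof.
elim/big_rec2 : _ => [|i a b _ <-]; last by rewrite mintD.
by rewrite /mint big1 // => x _; rewrite horner0 mulr0.
Qed.

Lemma mint_cat s1 s2 p : mint (s1 ++ s2) p = mint s1 p + mint s2 p.
Proof. by rewrite /mint big_cat. Qed.

Lemma mint_scale t s p : mint [seq (t * x.1, x.2) | x <- s] p = t * mint s p.
Proof. by rewrite /mint big_map mulr_sumr; apply: eq_bigr => x _; rewrite mulrA. Qed.

Lemma mint_ge0 P s p : atoms_in P s -> (forall u, P u -> 0 <= p.[u]) -> 0 <= mint s p.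
Proof.
move=> sP pP; rewrite /mint big_seq sumr_ge0 // => x /(allP sP)/andP[x0 xP].
by rewrite mulr_ge0 ?(ltW x0) ?pP.
Qed.

Lemma mint_root s p : all (root p) (map snd s) -> mint s p = 0.
Proof.
move=> /allP rs; rewrite /mint big_seq big1 // => x xs.
by rewrite (eqP (rs _ (map_f _ xs))) mulr0.
Qed.

Lemma mint_eq0 P s p : atoms_in P s -> (forall u, P u -> 0 <= p.[u]) -> mint s p = 0 ->
  all (root p) (map snd s).
Proof.
elim: s => //= x s IH /andP[/andP[x0 Px] sP] pP.
rewrite /mint big_cons => h.
have h1 : 0 <= x.1 * p.[x.2] by rewrite mulr_ge0 ?(ltW x0) ?pP.
have h2 := mint_ge0 sP pP; move: h2 h; rewrite /mint => h2 h.
have h3 : x.1 * p.[x.2] = 0 by lra.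
move/eqP: (h3); rewrite mulf_eq0 gt_eqF //= -rootE => -> /=.
by apply: IH => //; rewrite /mint; lra.
Qed.

Lemma pos_atoms_snd s : pos_atoms s -> all (fun z => 0 < z) (map snd s).
Proof. by rewrite all_map; apply: sub_all => x /andP[]. Qed.

Lemma merge_atoms P s : atoms_in P s -> exists s',
  [/\ atoms_in P s', map snd s' = undup (map snd s) & forall p, mint s' p = mint s p].
Proof.
move=> sP; pose mass z := \sum_(x <- s | x.2 == z) x.1.
exists [seq (mass z, z) | z <- undup (map snd s)]; split.
- rewrite /atoms_in all_map; apply/allP => z; rewrite mem_undup /= => /mapP[x xs ->].
  have /andP[x0 ->] := allP sP _ xs; rewrite andbT /mass.
  rewrite (big_rem _ xs) /= eqxx ltr_pwDl // big_seq_cond sumr_ge0 // => y /andP[yr _].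
  by have /andP[/ltW] := allP sP _ (mem_rem yr).
- by rewrite -map_comp map_id_in.
move=> p; rewrite /mint big_map /=.
under eq_bigr do rewrite /mass mulr_suml.
rewrite (exchange_big_dep xpredT) //= !big_seq; apply: eq_bigr => x xs.
rewrite -big_filter -(eq_filter (a1 := pred1 x.2)); last by move=> z /=; rewrite eq_sym.
rewrite filter_pred1_uniq ?undup_uniq ?mem_undup ?map_f //.
by rewrite big_seq1.
Qed.

Section Index.
Variables (N : nat) (k : 'I_N -> nat).
Hypothesis k_inj : injective k.

Lemma codom_uniq : uniq (codom k).
Proof. by rewrite map_inj_uniq ?enum_uniq. Qed.

Lemma sparseE p : supp_in (codom k) p -> p = \sum_i p`_(k i) *: 'X^(k i).
Proof.
move=> sp; apply/polyP => j; rewrite coef_sum.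
have [pj|pj] := eqVneq p`_j 0.
  rewrite big1 // => i _; rewrite coefZ coefXn; case: eqP => [<-|_]; last by rewrite mulr0.
  by rewrite pj mul0r.
have /codomP[i ji] := sp _ pj.
rewrite (bigD1 i) //= big1 ?addr0; first by rewrite ji coefZ coefXn eqxx mulr1.
move=> i' ii'; rewrite ji coefZ coefXn; case: eqP => [/k_inj e|_]; last by rewrite mulr0.
by rewrite e eqxx in ii'.
Qed.

Lemma ev_represents s kap M p : represents k s kap M -> supp_in (codom k) p ->
  ev k M p = mint s p + kap * p`_0.
Proof.
move=> rM sp; rewrite {2 3}(sparseE sp) mint_sum coef_sum mulr_sumr -big_split /=.
apply: eq_bigr => i _; rewrite rM mintZ coefZ coefXn [w _ * _]mulrC mulfK //.
by rewrite mulrDr; congr (_ + _); rewrite mulrCA; case: (k i).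
Qed.

Lemma mcone_ev_ge0 P M p : mcone P k M -> supp_in (codom k) p ->
  (forall u, P u -> 0 <= p.[u]) -> 0 <= p`_0 -> 0 <= ev k M p.
Proof.
move=> [s [kap [sP kap0 rM]]] sp pP p0; rewrite (ev_represents rM sp).
by rewrite addr_ge0 ?mulr_ge0 // (mint_ge0 sP).
Qed.

Lemma mcone_convex P : convex_cone (mcone P k).
Proof.
split.
- exists [::], 0; split=> // i; by rewrite mxE /mint big_nil mul0r addr0 mulr0.
- move=> u v [s1 [a1 [sP1 a10 r1]]] [s2 [a2 [sP2 a20 r2]]].
  exists (s1 ++ s2), (a1 + a2); split; rewrite ?addr_ge0 //.
    by rewrite /atoms_in all_cat; apply/andP.
  by move=> i; rewrite mxE r1 r2 mint_cat; ring.
- move=> t u; rewrite le_eqVlt => /orP[/eqP <- _|t0 [s [a [sP a0 rs]]]].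
    rewrite scale0r; exists [::], 0; split=> // i.
    by rewrite mxE /mint big_nil mul0r addr0 mulr0.
  exists [seq (t * x.1, x.2) | x <- s], (t * a); split; rewrite ?mulr_ge0 ?(ltW t0) //.
    by rewrite /atoms_in all_map; apply: sub_all sP => x /=; rewrite pmulr_rgt0.
  by move=> i; rewrite mxE rs mint_scale; ring.
Qed.

Lemma ev_dotv M p : ev k M p = dotv (\row_i (p`_(k i) / w (k i))) M.
Proof. by apply: eq_bigr => i _; rewrite mxE mulrAC mulrA. Qed.

(** The separating vector is read as a list of coefficients. Its sign on a single atom at [u] is the
    sign of [p.[u]], and its sign on the pure mass at 0 is that of the constant coefficient. *)
Lemma mcone_separation P M : ~ (mcone P k)° M ->
  exists p, [/\ p != 0, supp_in (codom k) p, forall u, P u -> 0 <= p.[u],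
    0 <= p`_0 & ev k M p <= 0].
Proof.
move=> /(separation (mcone_convex P))[c [c0 hc cM]].
pose p : {poly R} := \sum_i (c 0 i * w (k i)) *: 'X^(k i).
have cp i : p`_(k i) = c 0 i * w (k i).
  rewrite coef_sum (bigD1 i) //= big1 ?addr0.
    by rewrite coefZ coefXn eqxx mulr1.
  move=> j ji; rewrite coefZ coefXn; case: eqP => [/k_inj e|_]; last by rewrite mulr0.
  by rewrite e eqxx in ji.
have sp : supp_in (codom k) p.
  move=> j; apply: contra_neqT => jE.
  rewrite coef_sum big1 // => i _; rewrite coefZ coefXn; case: eqP => [ji|_]; last by rewrite mulr0.
  by rewrite ji codom_f in jE.
have ep v : ev k v p = dotv c v.
  rewrite ev_dotv; congr dotv; apply/rowP => i; rewrite mxE cp mulfK //.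
have hp v : mcone P k v -> 0 <= ev k v p by rewrite ep; exact: hc.
exists p; split => //.
- have [i ci] : exists i, c 0 i != 0.
    apply/existsP; apply: contraR c0; rewrite negb_exists => /forallP c0.
    by apply/eqP/rowP => i; rewrite mxE; apply/eqP; have := c0 i; rewrite negbK.
  apply: contra_neq ci => p0; have := cp i; rewrite p0 coef0 => /esym/eqP.
  by rewrite mulf_eq0 (negbTE (w_neq0 _)) orbF => /eqP.
- move=> u Pu; pose v : 'rV[R]_N := \row_i (w (k i) * u ^+ k i).
  have rv : represents k [:: (1, u)] 0 v.
    by move=> i; rewrite mxE /mint big_seq1 hornerXn mul1r mul0r addr0.
  have /hp : mcone P k v by exists [:: (1, u)], 0; split=> //=; rewrite ltr01 Pu.
  by rewrite (ev_represents rv sp) mul0r addr0 /mint big_seq1 mul1r.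
- pose v : 'rV[R]_N := \row_i (w (k i) * (k i == 0%N)%:R).
  have rv : represents k [::] 1 v.
    by move=> i; rewrite mxE /mint big_nil mul1r add0r.
  have /hp : mcone P k v by exists [::], 1; split.
  by rewrite (ev_represents rv sp) mul1r /mint big_nil add0r.
- by rewrite ep.
Qed.

(** An interior point stays in the cone when moved a little against the coefficient vector of [p],
    which lowers [ev] by a positive multiple of the squared length of that vector. *)
Lemma mcone_interior_ev P M p : (mcone P k)° M -> p != 0 -> supp_in (codom k) p ->
  (forall u, P u -> 0 <= p.[u]) -> 0 <= p`_0 -> 0 < ev k M p.
Proof.
move=> iM p0 sp pP pc0; set c := \row_i (p`_(k i) / w (k i)).
have [e e0 /mcone_ev_ge0 h] := interior_shift c iM.
apply: lt_le_trans (_ : e * dotv c c <= _).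
  rewrite mulr_gt0 //.
  have cge i : 0 <= c 0 i * c 0 i by rewrite -expr2 sqr_ge0.
  have [i pi] : exists i, p`_(k i) != 0.
    apply: contrapT => hi; case/eqP: p0; rewrite (sparseE sp) big1 // => i _.
    by have [->|pi] := eqVneq p`_(k i) 0; [rewrite scale0r|case: hi; exists i].
  rewrite /dotv (bigD1 i) //= ltr_pwDl ?sumr_ge0 //.
  by rewrite lt_neqAle cge eq_sym mulf_neq0 // mxE mulf_neq0 // invr_eq0 gt_eqF.
have := h p sp pP pc0; rewrite !ev_dotv -/c -scaleNr dotvDr dotvZr mulNr.
by rewrite subr_ge0.
Qed.

End Index.

Definition pcone := mcone (fun u => 0 < u).

Lemma pos_separation N (k : 'I_N -> nat) M : injective k -> ~ (pcone k)° M ->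
  exists p, [/\ p != 0, supp_in (codom k) p, nonneg_pos p & ev k M p <= 0].
Proof. by move=> ki /(mcone_separation ki)[p [p0 sp pp _ pM]]; exists p. Qed.

Lemma pos_interior_ev N (k : 'I_N -> nat) M p : injective k -> (pcone k)° M ->
  p != 0 -> supp_in (codom k) p -> nonneg_pos p -> 0 < ev k M p.
Proof. by move=> ki iM p0 sp pp; apply: (mcone_interior_ev ki iM) => //; exact: nonneg_coef0. Qed.

Lemma pos_ev_ge0 N (k : 'I_N -> nat) M p : injective k -> pcone k M ->
  supp_in (codom k) p -> nonneg_pos p -> 0 <= ev k M p.
Proof. by move=> ki CM sp pp; apply: (mcone_ev_ge0 ki CM) => //; exact: nonneg_coef0. Qed.

(** A supporting polynomial at [M] has integral zero, so every atom is one of its positive zeros. *)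
Lemma boundary_atoms N (k : 'I_N -> nat) s kap M : injective k -> pos_atoms s ->
  0 <= kap -> represents k s kap M -> ~ (pcone k)° M ->
  ((size (undup (map snd s))).*2 < N)%N.
Proof.
move=> ki sP kap0 rM /(pos_separation ki)[p [p0 sp pp]].
rewrite (ev_represents ki rM sp) => h.
have h1 := mint_ge0 sP pp; have h2 : 0 <= kap * p`_0 by rewrite mulr_ge0 ?nonneg_coef0.
have /(mint_eq0 sP pp) rs : mint s p = 0 by lra.
rewrite -[X in (_ < X)%N](card_ord N) -(size_codom k).
apply: (nonneg_zeros (codom_uniq ki) sp) => //; first exact: undup_uniq.
  by apply/allP => z; rewrite mem_undup; apply/allP/pos_atoms_snd.
by apply/allP => z; rewrite mem_undup; apply/allP.
Qed.

(** With fewer atoms some nonnegative polynomial supported on [k] would vanish at all of them,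
    against strict positivity at interior points. *)
Lemma interior_atoms N (k : 'I_N -> nat) s M : injective k -> pos_atoms s ->
  represents k s 0 M -> (pcone k)° M -> (N <= (size (undup (map snd s))).*2)%N.
Proof.
move=> ki sP rM iM; rewrite leqNgt; apply/negP => hN.
set Z := undup (map snd s) in hN.
have sE : size (codom k) = N by rewrite size_codom card_ord.
have [||||p [[p0 sp pp rp _] _]] := @nonneg_double _ (take (size Z).*2.+1 (codom k)) Z.
- by rewrite take_uniq // codom_uniq.
- by rewrite size_takel // sE.
- exact: undup_uniq.
- by apply/allP => z; rewrite mem_undup; apply/allP/pos_atoms_snd.
have sp' : supp_in (codom k) p by move=> j /sp /mem_take.
have := pos_interior_ev ki iM p0 sp' pp.
rewrite (ev_represents ki rM sp') mul0r addr0 mint_root ?ltxx //.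
by apply/allP => z zs; apply: (allP rp); rewrite mem_undup.
Qed.

(** A polynomial supported on [e] and as many exponents of [E] as there are atoms vanishes at all
    atoms of both measures. By Descartes' rule its coefficient at [e] is nonzero, so it expresses
    the moment at [e] through those on [E], identically for both. *)
Lemma moment_unique (E : seq nat) e s1 s2 : uniq (e :: E) -> pos_atoms s1 -> pos_atoms s2 ->
  (forall j, j \in E -> mint s1 'X^j = mint s2 'X^j) ->
  (size (undup (map snd (s1 ++ s2))) <= size E)%N -> mint s1 'X^e = mint s2 'X^e.
Proof.
move=> uE p1 p2 hE; set Z := undup _ => ZE.
pose E' := take (size Z) E.
have sE' : size E' = size Z by rewrite size_takel.
have uE' : uniq (e :: E').
  by move: uE => /= /andP[eE /take_uniq ->]; rewrite andbT; apply: contra eE => /mem_take.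
have pZ : all (fun z => 0 < z) Z.
  apply/allP => z; rewrite mem_undup map_cat mem_cat => /orP[]; apply/allP; exact: pos_atoms_snd.
pose D : {poly R} := \prod_(z <- Z) ('X - z%:P).
have [||p [p0 sp Dp]] := @sparse_multiple _ (e :: E') D uE'.
- by rewrite monic_neq0 // monic_prod_XsubC.
- by rewrite size_prod_XsubC /= sE'.
have rp z : z \in Z -> root p z.
  by move=> zZ; rewrite -dvdp_XsubCl; apply: dvdp_trans Dp; rewrite dvdp_XsubCl root_prod_XsubC.
have pe : p`_e != 0.
  apply/eqP => pe.
  have sp' : supp_in E' p.
    by move=> j pj; have := sp _ pj; rewrite inE => /orP[/eqP je|//]; rewrite je pe eqxx in pj.
  have uE'' : uniq E' by case/andP: uE'.
  have := leq_trans (descartes p0 (undup_uniq _) pZ) (nterms_le_size uE'' sp').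
  rewrite sE' ltnNge => /negP; apply.
  rewrite -sum1_size !big_seq; apply: leq_sum => z zZ; by rewrite mup_gt0 ?rp.
have pE : p = \sum_(j <- e :: E') p`_j *: 'X^j.
  apply/polyP => j; rewrite coef_sum.
  have [pj|pj] := eqVneq p`_j 0.
    rewrite big1_seq // => i _; rewrite coefZ coefXn.
    by case: eqP => [<-|_]; rewrite ?pj ?mul0r ?mulr0.
  have jE := sp _ pj.
  rewrite (bigD1_seq j jE uE') /= big1 ?addr0; first by rewrite coefZ coefXn eqxx mulr1.
  move=> i ij.
  by rewrite coefZ coefXn eq_sym (negbTE ij) mulr0.
have h1 : mint s1 p = 0.
  by apply: mint_root; apply/allP => z zs; apply: rp; rewrite mem_undup map_cat mem_cat zs.
have h2 : mint s2 p = 0.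
  by apply: mint_root; apply/allP => z zs; apply: rp; rewrite mem_undup map_cat mem_cat zs orbT.
have : mint s1 p - mint s2 p = p`_e * (mint s1 'X^e - mint s2 'X^e).
  rewrite {1 2}pE !mint_sum !big_cons !mintZ.
  rewrite (eq_big_seq (fun j => mint s2 (p`_j *: 'X^j))); first by ring.
  by move=> j /mem_take jE; rewrite !mintZ hE.
rewrite h1 h2 subrr => /esym/eqP; rewrite mulf_eq0 (negbTE pe) /= subr_eq0.
by move/eqP.
Qed.


Lemma horner_continuous p : continuous (fun u => p.[u]).
Proof. by move=> u; apply: differentiable_continuous; apply/derivable1_diffP/derivable_horner. Qed.

(* Off the zeros of [p] in the compact interval, [p] is bounded away from 0. *)
Lemma nonneg_perturb p q (a b e : R) : (forall u, a <= u <= b -> 0 <= p.[u]) ->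
  (forall u, a <= u <= b -> root p u -> 0 <= q.[u]) -> 0 < e ->
  exists2 K, 0 <= K & forall u, a <= u <= b -> 0 <= (q + e%:P + K *: p).[u].
Proof.
move=> pp qp e0.
pose B := [set` `[a, b]] `&` [set u | q.[u] <= - e].
have cB : compact B.
  apply: compact_closedI; first exact: segment_compact.
  apply: (preimage_closed _ (@closed_le _ _)) => u _; exact: horner_continuous.
have [B0|/set0P B0] := eqVneq B set0.
  exists 0 => // u ab; rewrite scale0r addr0 !hornerE leNgt; apply/negP => h.
  have : B u by split => /=; [rewrite in_itv|lra].
  by rewrite B0.
have cp (r : {poly R}) : {within B, continuous (fun u => r.[u])}.
  by apply: continuous_subspaceT => u; exact: horner_continuous.
have [u0 /set_mem[/= u0ab u0q] hu0] := compact_EVT_min B0 cB (cp p).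
have [u1 /set_mem[/= u1ab u1q] hu1] := compact_EVT_min B0 cB (cp q).
have pu0 : 0 < p.[u0].
  rewrite in_itv /= in u0ab; rewrite lt_neqAle pp // andbT eq_sym; apply/negP => r0.
  by have := qp _ u0ab r0; lra.
exists (- q.[u1] / p.[u0]); first by rewrite divr_ge0 ?(ltW pu0) //; lra.
move=> u ab; rewrite !hornerE.
have [uq|uq] := leP q.[u] (- e); last first.
  have h1 : 0 <= - q.[u1] / p.[u0] * p.[u].
    by rewrite mulr_ge0 ?pp // divr_ge0 ?(ltW pu0) //; lra.
  by lra.
have uB : u \in B by apply/mem_set; split => //=; rewrite in_itv.
have := hu1 _ uB; have := hu0 _ uB => h0 h1.
have : - q.[u1] <= - q.[u1] / p.[u0] * p.[u].
  rewrite -{1}(mulr1 (- q.[u1])) -mulrA ler_wpM2l //; first by lra.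
  by rewrite mulrC ler_pdivlMr // mul1r.
by lra.
Qed.

(** Lagrange interpolation with prescribed exponents: a sparse multiple of the remaining linear
    factors cannot vanish at [z] as well, since it has too few terms for that many positive
    zeros. *)
Lemma sparse_dual E (Z : seq R) z : uniq E -> uniq Z -> all (fun z => 0 < z) Z ->
  (size Z <= size E)%N -> z \in Z ->
  exists q, [/\ supp_in E q, q.[z] = 1 & forall y, y \in Z -> y != z -> root q y].
Proof.
move=> uE uZ pZ ZE zZ.
pose E' := take (size Z) E.
have sE' : size E' = size Z by rewrite size_takel.
have uE' : uniq E' by rewrite take_uniq.
pose D : {poly R} := \prod_(y <- rem z Z) ('X - y%:P).
have [||p [p0 sp Dp]] := @sparse_multiple _ E' D uE'.
- by rewrite monic_neq0 // monic_prod_XsubC.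
- have Z0 : (0 < size Z)%N by case: (Z) zZ.
  by rewrite size_prod_XsubC size_rem // prednK // sE'.
have rp y : y \in Z -> y != z -> root p y.
  move=> yZ yz; rewrite -dvdp_XsubCl; apply: dvdp_trans Dp.
  by rewrite dvdp_XsubCl root_prod_XsubC mem_rem_uniq // inE yz.
have pz : p.[z] != 0.
  apply/negP => pz.
  have rZ y : y \in Z -> root p y by move=> yZ; have [->//|] := eqVneq y z; exact: rp.
  have := leq_trans (descartes p0 uZ pZ) (nterms_le_size uE' sp).
  rewrite sE' ltnNge => /negP; apply.
  by rewrite -sum1_size !big_seq; apply: leq_sum => y yZ; rewrite mup_gt0 ?rZ.
exists (p.[z]^-1 *: p); split.
- by move=> j; rewrite coefZ mulf_eq0 negb_or => /andP[_ /sp /mem_take].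
- by rewrite hornerZ mulVf.
- by move=> y yZ yz; rewrite rootZ ?invr_eq0 // rp.
Qed.

(* On a compact interval two of the zeros may be simple endpoint zeros, but then
   the sign of the lowest coefficient rules the left one out. *)
Lemma nonneg_itv_zeros E m p (a b : R) Z : uniq E -> size E = m.*2.+1 -> supp_in E p ->
  p != 0 -> 0 < a < b -> (forall u, a <= u <= b -> 0 <= p.[u]) -> 0 <= p`_0 -> 0%N \in E ->
  uniq Z -> all (fun z => a <= z <= b) Z -> all (root p) Z -> (size Z <= m)%N.
Proof.
move=> uE sE sp p0 /andP[a0 ab] pp pc0 E0 uZ Zab rZ.
rewrite leqNgt; apply/negP => mZ.
have pZ : all (fun z => 0 < z) Z.
  by apply/allP => z /(allP Zab)/andP[az _]; exact: lt_le_trans az.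
have nt : (nterms p <= m.*2.+1)%N by rewrite -sE nterms_le_size.
have desc (Y : seq R) : uniq Y -> all (fun z => 0 < z) Y -> (\sum_(z <- Y) mup z p <= m.*2)%N.
  by move=> uY pY; rewrite -ltnS; apply: leq_trans nt; exact: descartes.
have m1 z : z \in Z -> (1 <= mup z p)%N by move=> /(allP rZ); rewrite mup_gt0.
have m2 z : z \in Z -> z != a -> z != b -> (2 <= mup z p)%N.
  move=> zZ za zb; have /andP[az bz] := allP Zab _ zZ.
  apply: (@mup_ge2P _ p a b) => //.
  - by rewrite lt_neqAle eq_sym za.
  - by rewrite lt_neqAle zb.
  - by move=> u /andP[/ltW ua /ltW ub]; apply: pp; rewrite ua.
  - exact: (allP rZ).
pose Zi := [seq z <- Z | (z != a) && (z != b)].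
have sumZ : ((size Z).*2 <= \sum_(z <- Z) mup z p + (a \in Z) + (b \in Z))%N.
  have -> : ((size Z).*2 = \sum_(z <- Z) 2)%N by rewrite big_const_seq count_predT iter_addn_0 mul2n.
  have ct (y : R) : ((y \in Z) = \sum_(z <- Z) (z == y) :> nat)%N.
    by rewrite -count_uniq_mem // -sum1_count big_mkcond; apply: eq_bigr => z _ /=; case: (z == _).
  rewrite !ct -!big_split /= !big_seq; apply: leq_sum => z zZ.
  have h1 := m1 _ zZ; have h2 := m2 _ zZ; move: h1 h2; case: (eqVneq z a) => [_|za]; case: (eqVneq z b) => [_|zb] h1 h2.
  - by rewrite !addn1.
  - by rewrite addn1 addn0 ltnS.
  - by rewrite addn0 addn1 ltnS.
  - by rewrite !addn0 h2.
have := desc _ uZ pZ => sumle.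
(* Zeros other than the endpoints count twice and the total is at most [m.*2], so more than [m]
   zeros force both endpoints to occur. *)
have [aZ bZ] : a \in Z /\ b \in Z.
  have key : forall (S n l : nat) (x y : bool),
      (n.*2 <= S + x + y)%N -> (S <= l.*2)%N -> (l < n)%N -> x /\ y.
    by clear; move=> S n l [] []; lia.
  exact: key sumZ sumle mZ.
rewrite aZ bZ in sumZ.
(* Descartes' rule is now saturated, so no coefficient on [E] vanishes. *)
have pc : 0 < p`_0.
  rewrite lt_neqAle pc0 eq_sym andbT; apply: (nterms_full uE sp _ E0).
  have key : forall S n l t : nat, (n.*2 <= S + true + true)%N -> (l < n)%N ->
      (S < t)%N -> (l.*2.+1 <= t)%N by clear; lia.
  by rewrite sE; exact: key sumZ mZ (descartes p0 uZ pZ).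
have noroot c : 0 < c -> c < a -> ~~ root p c.
  move=> c0 ca; apply/negP => rc.
  have cZ : c \notin Z by apply/negP => /(allP Zab)/andP[]; rewrite leNgt ca.
  have := desc (c :: Z); rewrite /= cZ uZ c0 pZ big_cons => /(_ isT isT).
  have mc : (1 <= mup c p)%N by rewrite mup_gt0.
  have key : forall S n l t : nat, (n.*2 <= S + true + true)%N -> (l < n)%N ->
      (1 <= t)%N -> (t + S <= l.*2)%N -> False by clear; lia.
  exact: key sumZ mZ mc.
(* With a positive value at 0 and no zero before [a], nonnegativity extends to the left of [a]. This
   makes [a] at least a double zero, one more than the count allows. *)
have ppb u : 0 < u < b -> 0 <= p.[u].
  move=> /andP[u0 ub]; have [ua|au] := ltP u a; last by rewrite pp // au ltW.
  rewrite leNgt; apply/negP => h.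
  have [|c cc rc] := @poly_ivtoo _ p 0 u (ltW u0).
    by rewrite horner_coef0 pmulr_rlt0.
  have := noroot c; rewrite rc => /(_ _ _)/negP; apply => //; rewrite ?(itvP cc) //.
  by apply: lt_trans ua; rewrite (itvP cc).
have ma : (2 <= mup a p)%N by apply: (@mup_ge2P _ p 0 b) => //; exact: (allP rZ).
have : (\sum_(z <- Z) 2 <= \sum_(z <- Z) mup z p + (b \in Z))%N.
  have -> : ((b \in Z) = \sum_(z <- Z) (z == b) :> nat)%N.
    by rewrite -count_uniq_mem // -sum1_count big_mkcond; apply: eq_bigr => z _ /=; case: (z == _).
  rewrite -big_split /= !big_seq; apply: leq_sum => z zZ.
  have [->|za] := eqVneq z a; first by rewrite (leq_trans ma) // leq_addr.
  have [zb|zb] := eqVneq z b; first by rewrite addn1 ltnS m1.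
  by rewrite addn0 m2.
rewrite big_const_seq count_predT iter_addn_0 mul2n bZ.
have key : forall S n l : nat, (n.*2 <= S + true)%N -> (l < n)%N -> (S <= l.*2)%N -> False.
  by clear; lia.
by move=> h; exact: key h mZ sumle.
Qed.

(** Prepends the exponent 0, so that the total mass becomes one more moment. *)
Definition cons_index N (k : 'I_N -> nat) : 'I_N.+1 -> nat :=
  fun i => if unlift ord0 i is Some j then k j else 0%N.

Lemma cons_index0 N (k : 'I_N -> nat) : cons_index k ord0 = 0%N.
Proof. by rewrite /cons_index unlift_none. Qed.

Lemma cons_index_lift N (k : 'I_N -> nat) i : cons_index k (lift ord0 i) = k i.
Proof. by rewrite /cons_index liftK. Qed.

(* Minimise the total mass among the representing measures carried by a compact
   interval: the zeros of a supporting polynomial at the minimum carry [M]. *)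
Lemma lower_principal N (k : 'I_N -> nat) m (M : 'rV[R]_N) : injective k -> (forall i, 0 < k i)%N ->
  N = m.*2 -> (pcone k)° M ->
  exists s, [/\ pos_atoms s, uniq (map snd s), size s = m & represents k s 0 M].
Proof.
move=> ki k0 Nm iM.
have [s0 [kap0 [s0P kap00 r0]]] := interior_subset iM.
(* An interval containing the atoms of one representation of [M]: the restricted problem is
   feasible, and mass can escape neither to 0 nor to infinity. *)
have [a [b [/andP[a0 ab] s0ab]]] : exists a b : R, 0 < a < b /\ all (fun x => a <= x.2 <= b) s0.
  elim: s0 s0P {r0} => [_|x s IH /= /andP[/andP[_ x0] /IH[a [b [/andP[a0 ab] sab]]]]].
    by exists 1, 2; rewrite ltr01 ltr1n.
  exists (Num.min a x.2), (Num.max b x.2); rewrite lt_min a0 x0 gt_min !lt_max ab /=.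
  rewrite ge_min lexx orbT le_max lexx orbT; split=> //.
  by apply: sub_all sab => y /andP[? ?]; rewrite ge_min le_max; apply/andP; split; apply/orP; left.
pose P := [pred u : R | a <= u <= b].
pose k1 := cons_index k.
have k1i : injective k1.
  move=> i j; rewrite /k1; case: (unliftP ord0 i) => [i' ->|->]; case: (unliftP ord0 j) => [j' ->|->] //;
    rewrite ?cons_index0 ?cons_index_lift.
  - by move=> /ki ->.
  - by move=> e; have := k0 i'; rewrite e.
  - by move=> e; have := k0 j'; rewrite -e.
have Ek1 : codom k1 = 0%N :: codom k.
  rewrite !codomE enum_ordSl /= /k1 cons_index0 -map_comp; congr cons.
  by apply: eq_map => i /=; rewrite cons_index_lift.
have uE := codom_uniq k1i.
have sE : size (codom k1) = m.*2.+1 by rewrite size_codom card_ord Nm.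
pose M1 t : 'rV[R]_N.+1 := \row_i (if unlift ord0 i is Some j then M 0 j else t * w 0).
have evM1 t p : ev k1 (M1 t) p = p`_0 * t + ev k M p.
  rewrite /ev big_ord_recl /k1 cons_index0 mxE unlift_none mulfK //; congr (_ + _).
  by apply: eq_bigr => i _; rewrite cons_index_lift mxE liftK.
pose S := [set t | mcone P k1 (M1 t)].
have S0 : S !=set0.
  exists (mint s0 1), s0, 0; split=> //.
    apply/allP => x xs; have /andP[-> _] := allP s0P _ xs.
    exact: (allP s0ab).
  move=> i; rewrite mxE /k1; case: unliftP => [j ->|->].
    rewrite cons_index_lift mul0r addr0 r0; congr (_ * _).
    by rewrite gtn_eqF ?mulr0 ?addr0.
  by rewrite cons_index0 mul0r addr0 mulrC expr0.
have Sge t : S t -> exists t', [/\ t' <= t, S t' & forall p, supp_in (codom k1) p ->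
    (forall u, P u -> 0 <= p.[u]) -> 0 <= p`_0 * t' + ev k M p].
  move=> [s [kap [sP kap_ge0 rs]]].
  have rs' : represents k1 s 0 (M1 (t - kap)).
    move=> i; have := rs i; rewrite !mxE /k1; case: unliftP => [j ->|->].
      rewrite cons_index_lift => ->; congr (_ * (_ + _)).
      by rewrite gtn_eqF ?mulr0.
    by rewrite cons_index0 /= mulr1 mul0r addr0 mulrDr => h; rewrite mulrBl h; ring.
  exists (t - kap); split; first by lra.
    by exists s, 0; split.
  move=> p sp pP; rewrite -evM1 (ev_represents k1i rs' sp) mul0r addr0.
  exact: mint_ge0 sP pP.
have ev0 (M' : 'rV[R]_N) c : ev k M' c%:P = 0.
  by rewrite /ev big1 // => i _; rewrite coefC gtn_eqF ?mul0r.
have suppC (c : R) : supp_in (codom k1) c%:P.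
  by move=> j; rewrite coefC Ek1; case: j => // j; rewrite eqxx.
have S_ge0 t : S t -> 0 <= t.
  move=> /Sge[t' [t't _ /(_ 1%:P (suppC 1))]]; rewrite ev0 coefC mul1r addr0 => h.
  by apply: le_trans t't; apply: h => u _; rewrite hornerC.
have infS : has_inf S by split=> //; exists 0 => t; exact: S_ge0.
set t0 := inf S.
have t0_ge0 : 0 <= t0 by apply: lb_le_inf.
pose L p := ev k1 (M1 t0) p.
have LD p q : L (p + q) = L p + L q.
  by rewrite /L /ev -big_split; apply: eq_bigr => i _; rewrite coefD mulrDl.
have LZ c p : L (c *: p) = c * L p.
  by rewrite /L /ev mulr_sumr; apply: eq_bigr => i _; rewrite coefZ mulrA.
have LC c : L c%:P = c * t0 by rewrite /L evM1 ev0 coefC addr0.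
(* Positivity passes to the infimum even if it is not known to be attained: for a negative constant
   coefficient a larger total mass is compared, for a positive one the inequality is a lower bound
   on every feasible mass. *)
have L_ge0 p : supp_in (codom k1) p -> (forall u, P u -> 0 <= p.[u]) -> 0 <= L p.
  move=> sp pP; rewrite /L evM1; have [pc|pc] := ltP p`_0 0.
    have [t /Sge[t' [_ St' /(_ p sp pP) h]]] := S0; apply: le_trans h _.
    rewrite lerD2r ler_wnM2l ?(ltW pc) //; apply: ge_inf => //; exact: infS.2.
  move: pc; rewrite le_eqVlt => /orP[/eqP pc|pc].
    have [t /Sge[t' [_ St' /(_ p sp pP)]]] := S0.
    by rewrite -pc !mul0r.
  rewrite -lerBlDr sub0r mulrC -ler_pdivrMr //.
  apply: lb_le_inf => // t /Sge[t' [t't _ /(_ p sp pP) h]]; apply: le_trans t't.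
  by rewrite ler_pdivrMr // mulrC; lra.
(* An interior point would admit a smaller total mass. *)
have nint : ~ (mcone P k1)° (M1 t0).
  pose c : 'rV[R]_N.+1 := \row_i (if unlift ord0 i is Some j then 0 else w 0).
  move=> /(interior_shift c)[e e0]; rewrite (_ : _ - _ = M1 (t0 - e)); last first.
    apply/rowP => i; rewrite !mxE; case: unliftP => [j _|_]; first by rewrite mulr0 subr0.
    by rewrite mulrBl.
  move=> /(ge_inf infS.2); rewrite -/t0; lra.
have [p [p0 sp pP pc0 Lp]] := mcone_separation k1i nint.
have {}Lp : L p = 0 by apply/eqP; rewrite eq_le Lp L_ge0.
pose Z := [seq z <- roots p (a - 1) (b + 1) | a <= z <= b].
have ZE z : a <= z <= b -> root p z -> z \in Z.
  move=> zab rz; rewrite mem_filter zab in_roots rz p0 andbT /= in_itv /=.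
  by case/andP: zab => az bz; apply/andP; split; lra.
have uZ : uniq Z by rewrite filter_uniq // uniq_roots.
have Zab : all (fun z => a <= z <= b) Z by apply/allP => z; rewrite mem_filter => /andP[].
have rZ : all (root p) Z.
  by apply/allP => z; rewrite mem_filter in_roots => /andP[_ /and3P[]].
have Zpos : all (fun z => 0 < z) Z.
  by apply/allP => z /(allP Zab)/andP[az _]; exact: lt_le_trans az.
have Zm : (size Z <= m)%N.
  apply: (nonneg_itv_zeros uE sE sp p0 _ pP pc0 _ uZ Zab rZ); first by rewrite a0 ab.
  by rewrite Ek1 inE.
(* Adding a small constant and a large multiple of [p], on which [L] vanishes, makes [q] nonnegative
   on the whole interval. So [L] sees only the values at [Z], and the dual basis below yields the
   masses. *)
have L_geZ q : supp_in (codom k1) q -> (forall z, z \in Z -> 0 <= q.[z]) -> 0 <= L q.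
  move=> sq qZ; rewrite leNgt; apply/negP => Lq.
  pose e := - L q / (2 * (t0 + 1)).
  have e0 : 0 < e by rewrite divr_gt0 //; lra.
  have [K K0 hK] := nonneg_perturb pP (fun u uab ru => qZ u (ZE u uab ru)) e0.
  have : 0 <= L (q + e%:P + K *: p).
    apply: L_ge0 => // j; rewrite !coefD coefZ => hj.
    have [qj|/sq//] := eqVneq q`_j 0; have [pj|/sp//] := eqVneq p`_j 0.
    by move: hj; rewrite qj pj mulr0 addr0 add0r => /suppC.
  rewrite !LD LC LZ Lp mulr0 addr0.
  have : e * (t0 + 1) = - L q / 2 by rewrite /e; field; rewrite gt_eqF //; lra.
  by nra.
have /choice[d hd] : forall z, exists q, z \in Z ->
    [/\ supp_in (codom k1) q, q.[z] = 1 & forall y, y \in Z -> y != z -> root q y].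
  move=> z; have [zZ|_] := boolP (z \in Z); last by exists 0.
  have [|q hq] := sparse_dual uE uZ Zpos _ zZ; last by exists q.
  by rewrite sE (leq_trans Zm) // -addnn -addnS leq_addr.
have dy z y : z \in Z -> y \in Z -> (d z).[y] = (y == z)%:R.
  move=> zZ yZ; have [_ h1 h2] := hd z zZ; have [->|yz] := eqVneq y z; first exact: h1.
  by apply/eqP; exact: h2.
have Ld z : z \in Z -> 0 <= L (d z).
  move=> zZ; have [sd _ _] := hd z zZ; apply: L_geZ => // y yZ.
  by rewrite dy // ler0n.
have L_eq i : L 'X^(k i) = \sum_(z <- Z) L (d z) * z ^+ k i.
  pose r : {poly R} := 'X^(k i) - \sum_(z <- Z) z ^+ k i *: d z.
  have Lr : L r = L 'X^(k i) - \sum_(z <- Z) L (d z) * z ^+ k i.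
    rewrite LD -scaleN1r LZ mulN1r; congr (_ - _).
    elim/big_rec2 : _ => [|z y1 y2 _ <-]; last by rewrite LD LZ mulrC.
    by rewrite -[0]/(0%:P) LC mul0r.
  have sr c : supp_in (codom k1) (c *: r).
    move=> j; rewrite coefZ mulf_eq0 negb_or => /andP[_].
    apply: contra_neqT => jE; rewrite coefB coefXn coef_sum big_seq big1 ?subr0.
      case: eqP => // ji; move: jE; rewrite ji Ek1 inE codom_f orbT //.
    move=> z /hd[sd _ _]; rewrite coefZ; apply/eqP; rewrite mulf_eq0; apply/orP; right.
    by apply: contraR jE => /sd.
  have rZ0 z : z \in Z -> r.[z] = 0.
    move=> zZ; rewrite !hornerE horner_sum (bigD1_seq z) //= big_seq_cond big1.
      by rewrite hornerZ dy // eqxx mulr1 addr0 subrr.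
    by move=> y /andP[yZ yz]; rewrite hornerZ dy // eq_sym (negbTE yz) mulr0.
  have h1 : 0 <= L (1 *: r) by apply: L_geZ => // z zZ; rewrite hornerZ rZ0 // mulr0.
  have h2 : 0 <= L (-1 *: r) by apply: L_geZ => // z zZ; rewrite hornerZ rZ0 // mulr0.
  by move: h1 h2; rewrite !LZ Lr; lra.
pose s := [seq (L (d z), z) | z <- [seq z <- Z | 0 < L (d z)]].
have sE' : map snd s = [seq z <- Z | 0 < L (d z)] by rewrite /s -map_comp map_id_in.
have us : uniq (map snd s) by rewrite sE' filter_uniq.
have rs : represents k s 0 M.
  move=> i; have : L 'X^(k i) = M 0 i / w (k i).
    rewrite /L evM1 coefXn [(_ == _)%N](_ : _ = false) ?mul0r ?add0r; last first.
      by apply/negbTE; rewrite eq_sym -lt0n.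
    rewrite /ev (bigD1 i) //= big1 ?addr0; first by rewrite coefXn eqxx mul1r.
    by move=> j ji; rewrite coefXn (inj_eq ki) (negbTE ji) mul0r.
  rewrite L_eq => h; rewrite mul0r addr0 mulrC; apply: (mulIf (invr_neq0 (w_neq0 (k i)))).
  rewrite -h mulfK // /mint big_map big_filter [RHS]big_mkcond /=.
  rewrite !big_seq; apply: eq_bigr => z zZ; rewrite hornerXn.
  case: ltP => // h'; have -> : L (d z) = 0 by apply/eqP; rewrite eq_le h' Ld.
  by rewrite mul0r.
have sP : pos_atoms s.
  apply/allP => x /mapP[z + ->]; rewrite mem_filter => /andP[h zZ]; rewrite h /=.
  exact: (allP Zpos).
exists s; split => //.
(* Interior points need at least [m] atoms, and [Z] offers at most [m]. *)
have := interior_atoms ki sP rs iM; rewrite undup_id // size_map Nm leq_double => h1.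
apply/eqP; rewrite eqn_leq h1 andbT -(size_map snd) sE' size_filter.
by apply: leq_trans (count_size _ _) Zm.
Qed.

End Moments.

(** * Adding or removing an extreme exponent *)

Section Extension.
Context {R : realType}.
Variable w : nat -> R.
Hypothesis w_gt0 : forall j, 0 < w j.
Let w_neq0 j : w j != 0. Proof. by rewrite gt_eqF. Qed.
Local Hint Resolve w_gt0 w_neq0 : core.
Implicit Types (s : seq (R * R)) (p q : {poly R}).

Definition incr N (k : 'I_N -> nat) := forall i j : 'I_N, (i < j)%N -> (k i < k j)%N.

Definition ktail N (k : 'I_N.+1 -> nat) : 'I_N -> nat := fun i => k (lift ord0 i).

Definition kinit N (k : 'I_N.+1 -> nat) : 'I_N -> nat := fun i => k (lift ord_max i).

Lemma incr_inj N (k : 'I_N -> nat) : incr k -> injective k.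
Proof.
move=> ki i j kij; apply: val_inj; case: (ltngtP i j) => // /ki; by rewrite kij ltnn.
Qed.

Lemma incr_tail N (k : 'I_N.+1 -> nat) : incr k -> incr (ktail k).
Proof. by move=> ki i j ij; apply: ki; rewrite !lift0 ltnS. Qed.

Lemma incr_init N (k : 'I_N.+1 -> nat) : incr k -> incr (kinit k).
Proof. by move=> ki i j ij; apply: ki; rewrite !lift_max. Qed.

Lemma codom_tail N (k : 'I_N.+1 -> nat) : codom k = k ord0 :: codom (ktail k).
Proof. by rewrite !codomE enum_ordSl /= -map_comp. Qed.

Lemma mem_codom_init N (k : 'I_N.+1 -> nat) j :
  (j \in codom k) = (j == k ord_max) || (j \in codom (kinit k)).
Proof.
apply/codomP/orP => [[i ->]|[/eqP ->|/codomP[i ->]]]; last 2 first.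
- by exists ord_max.
- by exists (lift ord_max i).
by case: (unliftP ord_max i) => [i' ->|->]; [right; exact: codom_f (kinit k) i'|left].
Qed.

Lemma ev_tail N (k : 'I_N.+1 -> nat) M p :
  ev w k M p = p`_(k ord0) * (M 0 ord0 / w (k ord0)) + ev w (ktail k) (col' ord0 M) p.
Proof.
rewrite /ev big_ord_recl; congr (_ + _); apply: eq_bigr => i _.
by rewrite mxE.
Qed.

Lemma ev_init N (k : 'I_N.+1 -> nat) M p :
  ev w k M p = ev w (kinit k) (col' ord_max M) p + p`_(k ord_max) * (M 0 ord_max / w (k ord_max)).
Proof.
rewrite /ev big_ord_recr /=; congr (_ + _); apply: eq_bigr => i _.
by rewrite mxE /kinit (_ : widen_ord _ i = lift ord_max i) //; apply: val_inj; rewrite /= /bump leqNgt ltn_ord.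
Qed.

Lemma tail_lt N (k : 'I_N.+1 -> nat) : incr k -> forall j, j \in codom (ktail k) -> (k ord0 < j)%N.
Proof. by move=> ki j /codomP[i ->]; apply: ki. Qed.

Lemma init_lt N (k : 'I_N.+1 -> nat) : incr k -> forall j, j \in codom (kinit k) -> (j < k ord_max)%N.
Proof. by move=> ki j /codomP[i ->]; apply: ki; rewrite lift_max. Qed.

Lemma low_coef_ge0 N (k : 'I_N.+1 -> nat) p : incr k -> supp_in (codom k) p -> nonneg_pos p ->
  0 <= p`_(k ord0).
Proof.
move=> ki sp pp; apply: nonneg_low => // j jk; apply: contraTeq jk => /sp.
by rewrite codom_tail inE -leqNgt => /orP[/eqP -> //|/(tail_lt ki)/ltnW].
Qed.

Lemma top_coef_ge0 N (k : 'I_N.+1 -> nat) p : incr k -> supp_in (codom k) p -> nonneg_pos p ->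
  0 <= p`_(k ord_max).
Proof.
move=> ki sp pp; apply: nonneg_top => // j jk; apply: contraTeq jk => /sp.
by rewrite mem_codom_init -leqNgt => /orP[/eqP -> //|/(init_lt ki)/ltnW].
Qed.

Lemma supp_tail N (k : 'I_N.+1 -> nat) p : supp_in (codom k) p -> p`_(k ord0) = 0 ->
  supp_in (codom (ktail k)) p.
Proof.
move=> sp p0 j pj; have := sp _ pj; rewrite codom_tail inE => /orP[/eqP jk|//].
by rewrite jk p0 eqxx in pj.
Qed.

Lemma tail_supp N (k : 'I_N.+1 -> nat) p : incr k -> supp_in (codom (ktail k)) p ->
  supp_in (codom k) p /\ p`_(k ord0) = 0.
Proof.
move=> ki sp; split; first by move=> j /sp; rewrite codom_tail inE orbC => ->.
by apply/eqP; apply: contraT => /sp /(tail_lt ki); rewrite ltnn.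
Qed.

Lemma init_supp N (k : 'I_N.+1 -> nat) p : incr k -> supp_in (codom (kinit k)) p ->
  supp_in (codom k) p /\ p`_(k ord_max) = 0.
Proof.
move=> ki sp; split; first by move=> j /sp; rewrite mem_codom_init orbC => ->.
by apply/eqP; apply: contraT => /sp /(init_lt ki); rewrite ltnn.
Qed.

(** Polynomials supported on the tail are supported on [k], so they inherit strict positivity from
    [M]. *)
Lemma interior_tail N (k : 'I_N.+1 -> nat) (M : 'rV[R]_N.+1) : incr k ->
  (pcone w k)° M -> (pcone w (ktail k))° (col' ord0 M).
Proof.
move=> ki iM; apply: contrapT => /(pos_separation w_gt0 (incr_inj (incr_tail ki))).
move=> [p [p0 sp pp]]; apply/negP; rewrite -ltNge.
have [sp' p00] := tail_supp ki sp.
have := pos_interior_ev w_gt0 (incr_inj ki) iM p0 sp' pp.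
by rewrite ev_tail p00 mul0r add0r.
Qed.

Lemma interior_init N (k : 'I_N.+1 -> nat) (M : 'rV[R]_N.+1) : incr k ->
  (pcone w k)° M -> (pcone w (kinit k))° (col' ord_max M).
Proof.
move=> ki iM; apply: contrapT => /(pos_separation w_gt0 (incr_inj (incr_init ki))).
move=> [p [p0 sp pp]]; apply/negP; rewrite -ltNge.
have [sp' p00] := init_supp ki sp.
have := pos_interior_ev w_gt0 (incr_inj ki) iM p0 sp' pp.
by rewrite ev_init p00 mul0r addr0.
Qed.

Lemma represents_tail N (k : 'I_N.+1 -> nat) s kap M : incr k ->
  represents w k s kap M -> represents w (ktail k) s 0 (col' ord0 M).
Proof.
move=> ki rM i; rewrite mxE rM mul0r addr0 gtn_eqF ?mulr0 ?addr0 //.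
by apply: leq_ltn_trans (ki ord0 _ _).
Qed.

Lemma represents_init N (k : 'I_N.+1 -> nat) s kap M :
  represents w k s kap M -> represents w (kinit k) s kap (col' ord_max M).
Proof. by move=> rM i; rewrite mxE rM. Qed.

Lemma represents_cons N (k : 'I_N.+1 -> nat) s kap M : incr k -> 
  represents w (ktail k) s 0 (col' ord0 M) ->
  M 0 ord0 = w (k ord0) * (mint s 'X^(k ord0) + kap * (k ord0 == 0%N)%:R) ->
  represents w k s kap M.
Proof.
move=> ki rM M0 i; case: (unliftP ord0 i) => [j ->|-> //].
have := rM j; rewrite mxE => ->; rewrite mul0r; congr (_ * (_ + _)).
rewrite gtn_eqF ?mulr0 //; exact: leq_ltn_trans (ki ord0 _ _).
Qed.

(** Since [s] represents all coordinates but the lowest, [M] differs from the moment vector of [s]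
    in that one only. *)
Lemma ev_low N (k : 'I_N.+1 -> nat) s M p : incr k -> supp_in (codom k) p ->
  represents w (ktail k) s 0 (col' ord0 M) ->
  ev w k M p = p`_(k ord0) * (M 0 ord0 / w (k ord0) - mint s 'X^(k ord0)) + mint s p.
Proof.
move=> ki sp rM.
pose M1 : 'rV[R]_N.+1 := \row_i (w (k i) * mint s 'X^(k i)).
have r1 : represents w k s 0 M1 by move=> i; rewrite mxE mul0r addr0.
have := ev_represents w_gt0 (incr_inj ki) r1 sp; rewrite mul0r addr0 => <-.
rewrite !ev_tail mxE [w _ * _ / _]mulrAC mulfV // mul1r.
rewrite (_ : col' ord0 M1 = col' ord0 M); first by ring.
by apply/rowP => i; rewrite rM !mxE mul0r addr0.
Qed.

(** A test polynomial with positive lowest coefficient gains from the strict gap; one with zero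
    lowest coefficient lives on the tail, where the point is interior. *)
Lemma interior_above N (k : 'I_N.+1 -> nat) s (M : 'rV[R]_N.+1) : incr k -> pos_atoms s ->
  (pcone w (ktail k))° (col' ord0 M) -> represents w (ktail k) s 0 (col' ord0 M) ->
  w (k ord0) * mint s 'X^(k ord0) < M 0 ord0 -> (pcone w k)° M.
Proof.
move=> ki sP iM rM lt; apply: contrapT => /(pos_separation w_gt0 (incr_inj ki)).
move=> [p [p0 sp pp]]; apply/negP; rewrite -ltNge.
have := low_coef_ge0 ki sp pp; rewrite le_eqVlt => /orP[/eqP/esym pk|pk].
  rewrite ev_tail pk mul0r add0r.
  exact: (pos_interior_ev w_gt0 (incr_inj (incr_tail ki)) iM p0 (supp_tail sp pk) pp).
rewrite (ev_low ki sp rM) ltr_pwDl ?(mint_ge0 sP) // mulr_gt0 // subr_gt0.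
by rewrite ltr_pdivlMr // mulrC.
Qed.

Section Odd.
Variables (N m : nat) (k : 'I_N.+1 -> nat) (s : seq (R * R)) (M : 'rV[R]_N.+1).
Hypotheses (ki : incr k) (Nm : N = m.*2) (sP : pos_atoms s).
Hypotheses (us : uniq (map snd s)) (ss : size s = m).
Hypothesis rM : represents w (ktail k) s 0 (col' ord0 M).

(** The [m.*2.+1] exponents of [k] are just enough for double zeros at the [m] atoms. By [ev_low]
    such a polynomial leaves only the gap in the lowest coordinate, with a positive factor. *)
Lemma odd_supporting : exists p, [/\ p != 0, supp_in (codom k) p, nonneg_pos p,
  0 < p`_(k ord0) & mint s p = 0].
Proof.
have [||||p [[p0 sp pp rp ne] _]] := @nonneg_double _ (codom k) (map snd s).
- exact: codom_uniq (incr_inj ki).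
- by rewrite size_codom card_ord size_map ss Nm.
- exact: us.
- exact: pos_atoms_snd sP.
exists p; split=> //; last exact: mint_root.
by rewrite lt_neqAle eq_sym ne ?codom_f // low_coef_ge0.
Qed.

Lemma odd_lower_bound : pcone w k M -> w (k ord0) * mint s 'X^(k ord0) <= M 0 ord0.
Proof.
move=> CM; have [p [p0 sp pp pk mp]] := odd_supporting.
have := pos_ev_ge0 w_gt0 (incr_inj ki) CM sp pp.
rewrite (ev_low ki sp rM) mp addr0 pmulr_rge0 // subr_ge0.
by rewrite ler_pdivlMr // mulrC.
Qed.

Lemma odd_lower_bound_strict : (pcone w k)° M -> w (k ord0) * mint s 'X^(k ord0) < M 0 ord0.
Proof.
move=> CM; have [p [p0 sp pp pk mp]] := odd_supporting.
have := pos_interior_ev w_gt0 (incr_inj ki) CM p0 sp pp.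
rewrite (ev_low ki sp rM) mp addr0 pmulr_rgt0 // subr_gt0.
by rewrite ltr_pdivlMr // mulrC.
Qed.

End Odd.

Section Even.
Variables (n q : nat) (k : 'I_n.+3 -> nat) (s : seq (R * R)) (M : 'rV[R]_n.+3).
Hypotheses (ki : incr k) (nq : n.+1 = q.*2) (sP : pos_atoms s).
Let k' := ktail k.
Let M' := col' ord0 M.
Let k'' := kinit k'.
Let M'' := col' ord_max M'.
Hypothesis rM : represents w k'' s 0 M''.

(** Here [s] represents the middle coordinates only, so there is a gap at either extreme
    exponent. *)
Lemma even_ev p : supp_in (codom k) p ->
  ev w k M p = p`_(k ord0) * (M 0 ord0 / w (k ord0) - mint s 'X^(k ord0))
    + p`_(k ord_max) * (M 0 ord_max / w (k ord_max) - mint s 'X^(k ord_max)) + mint s p.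
Proof.
move=> sp; have km : k' ord_max = k ord_max.
  by rewrite /k' /ktail (_ : lift ord0 ord_max = ord_max) //; apply: val_inj.
have Mm : M' 0 ord_max = M 0 ord_max.
  by rewrite mxE (_ : lift ord0 ord_max = ord_max) //; apply: val_inj.
pose M1 : 'rV[R]_n.+3 := \row_i (w (k i) * mint s 'X^(k i)).
have r1 : represents w k s 0 M1 by move=> i; rewrite mxE mul0r addr0.
have := ev_represents w_gt0 (incr_inj ki) r1 sp; rewrite mul0r addr0 => <-.
rewrite !(ev_tail k) -/k' -/M' !(ev_init k') -/k'' km Mm.
rewrite !mxE (_ : lift ord0 ord_max = ord_max); last exact: val_inj.
rewrite ![w _ * _ / _]mulrAC !mulfV // !mul1r.
rewrite (_ : col' ord_max (col' ord0 M1) = M''); first by ring.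
by apply/rowP => i; rewrite rM !mxE mul0r addr0.
Qed.

(** Over a non-interior point [s1] has at most [q] distinct atoms. Together with [s] this makes at
    most [q.*2], the number of middle exponents, so the common middle moments determine the lowest
    one. *)
Lemma even_boundary_eq s1 : pos_atoms s1 -> (size s <= q)%N ->
  represents w k' s1 0 M' -> ~ (pcone w k')° M' ->
  mint s1 'X^(k ord0) = mint s 'X^(k ord0).
Proof.
move=> s1P ss r1 nM.
have ki' := incr_tail ki; have ki'' := incr_init ki'.
have h1 := boundary_atoms w_gt0 (incr_inj ki') s1P (lexx 0) r1 nM.
apply: (moment_unique (E := codom k'')) s1P sP _ _.
- rewrite /= codom_uniq ?andbT; last exact: incr_inj.
  apply/negP => h; have : k ord0 \in codom k' by rewrite mem_codom_init h orbT.
  by move=> /(tail_lt ki); rewrite ltnn.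
- move=> j /codomP[i ->]; have r2 := represents_init r1.
  have := rM i; rewrite (r2 i) !mul0r !addr0; exact: mulfI.
rewrite size_codom card_ord nq map_cat undup_cat size_cat -addnn.
apply: leq_add; last first.
  by apply: leq_trans (size_undup _) _; rewrite size_map.
rewrite size_filter; apply: leq_trans (count_size _ _) _.
by rewrite -ltnS -leq_double; move: h1; rewrite nq; clear; lia.
Qed.

Hypotheses (us : uniq (map snd s)) (ss : size s = q).

(** The polynomial on [k'] with double zeros at the atoms of [s] has positive top coefficient, so
    [s] has the least top moment compatible with the middle ones. *)
Lemma even_top : pcone w k' M' -> w (k ord_max) * mint s 'X^(k ord_max) <= M 0 ord_max.
Proof.
move=> CM; have ki' := incr_tail ki.
have [||||p [[p0 sp pp rp ne] _]] := @nonneg_double _ (codom k') (map snd s).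
- exact: codom_uniq (incr_inj ki').
- by rewrite size_codom card_ord size_map ss nq.
- exact: us.
- exact: pos_atoms_snd sP.
have := pos_ev_ge0 w_gt0 (incr_inj ki') CM sp pp.
have [sp' p00] := tail_supp ki sp.
have -> : ev w k' M' p = ev w k M p by rewrite (ev_tail k M) p00 mul0r add0r.
rewrite even_ev // p00 mul0r add0r (mint_root rp) addr0.
have km : k' ord_max = k ord_max.
  by rewrite /k' /ktail (_ : lift ord0 ord_max = ord_max) //; apply: val_inj.
rewrite pmulr_rge0 ?subr_ge0; first by rewrite ler_pdivlMr // mulrC.
by rewrite -km lt_neqAle eq_sym ne ?codom_f // top_coef_ge0.
Qed.

(** Both gaps have the right sign: the lowest is strictly positive by assumption, the top one
    nonnegative by [even_top]. *)
Lemma even_interior : (pcone w k')° M' ->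
  w (k ord0) * mint s 'X^(k ord0) < M 0 ord0 -> (pcone w k)° M.
Proof.
move=> iM lt; apply: contrapT => /(pos_separation w_gt0 (incr_inj ki)).
move=> [p [p0 sp pp]]; apply/negP; rewrite -ltNge.
have := low_coef_ge0 ki sp pp; rewrite le_eqVlt => /orP[/eqP/esym pk|pk].
  rewrite ev_tail pk mul0r add0r.
  exact: (pos_interior_ev w_gt0 (incr_inj (incr_tail ki)) iM p0 (supp_tail sp pk) pp).
rewrite even_ev // -addrA ltr_pwDl //.
  by rewrite mulr_gt0 // subr_gt0 ltr_pdivlMr // mulrC.
rewrite addr_ge0 ?(mint_ge0 sP) // mulr_ge0 ?top_coef_ge0 // subr_ge0.
rewrite ler_pdivlMr // mulrC; apply: even_top; exact: interior_subset iM.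
Qed.

(** The test polynomial avoids the top exponent. Equality would confine a measure representing [M]
    to the [q] atoms of [s], too few for an interior point with [q.*2.+1] coordinates. *)
Lemma even_lower_bound : pcone w k M -> (pcone w k')° M' ->
  w (k ord0) * mint s 'X^(k ord0) < M 0 ord0.
Proof.
move=> CM iM; have ki' := incr_tail ki; have ki'' := incr_init ki'.
have uE : uniq (k ord0 :: codom k'').
  rewrite /= codom_uniq ?andbT; last exact: incr_inj.
  apply/negP => h; have : k ord0 \in codom k' by rewrite mem_codom_init h orbT.
  by move=> /(tail_lt ki); rewrite ltnn.
have [|||p [[p0 sp pp rp ne] only]] := @nonneg_double _ _ (map snd s) uE.
- by rewrite /= size_codom card_ord size_map ss nq.
- exact: us.
- exact: pos_atoms_snd sP.
have km : k' ord_max = k ord_max.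
  by rewrite /k' /ktail (_ : lift ord0 ord_max = ord_max) //; apply: val_inj.
have sp' : supp_in (codom k) p.
  by move=> j /sp; rewrite (codom_tail k) !inE (mem_codom_init k') => /orP[->//|->]; rewrite !orbT.
have pm : p`_(k ord_max) = 0.
  apply/eqP; apply: contraT => /sp; rewrite inE -km => /orP[/eqP h|/(init_lt ki')].
    by have := tail_lt ki (codom_f k' ord_max); rewrite h ltnn.
  by rewrite ltnn.
have pk : 0 < p`_(k ord0).
  by rewrite lt_neqAle eq_sym ne ?inE ?eqxx // low_coef_ge0.
have evE : ev w k M p = p`_(k ord0) * (M 0 ord0 / w (k ord0) - mint s 'X^(k ord0)).
  by rewrite even_ev // pm mul0r addr0 (mint_root rp) addr0.
have := pos_ev_ge0 w_gt0 (incr_inj ki) CM sp' pp.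
rewrite evE pmulr_rge0 // subr_ge0 ler_pdivlMr // mulrC le_eqVlt => /orP[/eqP eqM|//].
have ev0 : ev w k M p = 0 by rewrite evE -eqM [w _ * _ / _]mulrAC mulfV // mul1r subrr mulr0.
have [s1 [kap [s1P kap0 r1]]] := CM.
have := ev_represents w_gt0 (incr_inj ki) r1 sp'; rewrite ev0.
have h1 := mint_ge0 s1P pp; have h2 : 0 <= kap * p`_0 by rewrite mulr_ge0 ?nonneg_coef0.
move=> h3; have /(mint_eq0 s1P pp)/allP rs : mint s1 p = 0 by lra.
have := interior_atoms w_gt0 (incr_inj ki') s1P (represents_tail ki r1) iM.
have : (size (undup (map snd s1)) <= size (map snd s))%N.
  apply: uniq_leq_size (undup_uniq _) _ => z; rewrite mem_undup => zs.
  by apply: only; [exact: (allP (pos_atoms_snd s1P))|exact: rs].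
rewrite size_map ss => h4 h5.
have key : forall a b c : nat, a = b.*2 -> (c <= b)%N -> (a < c.*2)%N -> False by clear; lia.
by case: (key _ _ _ nq h4 h5).
Qed.

End Even.

End Extension.

(** * One-sided calculus *)

Section HalfLineCalculus.
Context {R : realType}.
Implicit Types (f g : R -> R) (s t l : R).

(** The difference quotient multiplied out: [s = t] needs no exclusion, and [s] ranges over R_-
    alone, so that 0 is treated like any other point. *)
Definition hasD f t l := forall e, 0 < e -> exists2 d, 0 < d &
  forall s, s <= 0 -> `|s - t| < d -> `|f s - f t - l * (s - t)| <= e * `|s - t|.

Lemma within_Rneg_proper t : t <= 0 -> ProperFilter (within (@Rneg R) (dnbhs t)).
Proof.
move=> t0; apply: Build_ProperFilter_ex => A /nbhs_ballP[e /= e0 eA].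
exists (t - e / 2); apply: eA.
- by rewrite /ball /= opprB addrCA subrr addr0 gtr0_norm; lra.
- by rewrite lt_eqF //; lra.
- by rewrite /Rneg /=; lra.
Qed.

Lemma hasDP f t l : t <= 0 ->
  hasD f t l <-> diff_quot f t s @[s --> within (@Rneg R) (dnbhs t)] --> l.
Proof.
move=> t0; split=> [fl|fl].
  apply/cvgrPdist_le => e e0; have [d d0 hd] := fl _ e0.
  apply/nbhs_ballP; exists d => //= s; rewrite /ball /= distrC => sd /= st sneg.
  have := hd s sneg sd; rewrite /diff_quot => h.
  have st0 : s - t != 0 by rewrite subr_eq0.
  rewrite -(ler_pM2r (_ : 0 < `|s - t|)) ?normr_gt0 // -normrM mulrBl mulfVK //.
  by rewrite distrC.
move=> e e0; move/cvgrPdist_le : fl => /(_ e e0) /nbhs_ballP[d /= d0 hd].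
exists d => // s sneg sd; have [->|st] := eqVneq s t.
  by rewrite !subrr mulr0 subr0 !normr0 mulr0.
have st0 : s - t != 0 by rewrite subr_eq0.
have := hd s; rewrite /ball /= distrC => /(_ sd st sneg).
rewrite -(ler_pM2r (_ : 0 < `|s - t|)) ?normr_gt0 // -normrM mulrBl /diff_quot mulfVK //.
by rewrite distrC.
Qed.

Lemma hasD_deriv f t l : t <= 0 -> hasD f t l -> derivable_neg f t /\ deriv_neg f t = l.
Proof.
move=> t0 /(hasDP _ _ t0) fl; have PF := within_Rneg_proper t0.
split; first by apply/cvg_ex; exists l.
exact/cvg_lim.
Qed.

Lemma derivable_hasD f t : t <= 0 -> derivable_neg f t -> hasD f t (deriv_neg f t).
Proof. by move=> t0 h; apply/(hasDP _ _ t0). Qed.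

Lemma not_derivable_deriv f t : ~ derivable_neg f t -> deriv_neg f t = 0.
Proof. by move=> h; rewrite /deriv_neg dvgP. Qed.

Lemma hasD_ext f g t l : t <= 0 -> (forall s, s <= 0 -> f s = g s) -> hasD f t l -> hasD g t l.
Proof.
move=> t0 fg fl e /fl[d d0 h]; exists d => // s s0 sd.
by rewrite -!fg // h.
Qed.

Lemma hasD_cst c t : hasD (fun=> c) t 0.
Proof. by move=> e e0; exists 1 => // s _ _; rewrite subrr mul0r subr0 normr0 mulr_ge0 // ltW. Qed.

Lemma hasDD f g t l m : hasD f t l -> hasD g t m -> hasD (fun s => f s + g s) t (l + m).
Proof.
move=> fl gm e e0; have e2 : 0 < e / 2 by lra.
have [d d0 hd] := fl _ e2; have [d' d'0 hd'] := gm _ e2.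
exists (Num.min d d'); first by rewrite lt_min d0.
move=> s s0; rewrite lt_min => /andP[sd sd'].
have h1 := hd s s0 sd; have h2 := hd' s s0 sd'; rewrite /=.
rewrite (_ : _ - _ - _ = (f s - f t - l * (s - t)) + (g s - g t - m * (s - t))); last by ring.
apply: le_trans (ler_normD _ _) _.
by rewrite (_ : e * _ = e / 2 * `|s - t| + e / 2 * `|s - t|) ?lerD //; field.
Qed.

Lemma hasDZ c f t l : hasD f t l -> hasD (fun s => c * f s) t (c * l).
Proof.
move=> fl e e0; have c1 : 0 < `|c| + 1 by rewrite ltr_wpDl.
have [d d0 hd] := fl _ (divr_gt0 e0 c1).
exists d => // s s0 sd; have h := hd s s0 sd; rewrite /=.
rewrite (_ : _ - _ - c * l * _ = c * (f s - f t - l * (s - t))); last by ring.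
rewrite normrM; apply: le_trans (ler_wpM2l (normr_ge0 c) h) _.
rewrite mulrA ler_wpM2r // mulrA ler_pdivrMr // mulrC ler_wpM2l ?(ltW e0) //.
by rewrite lerDl.
Qed.

Lemma hasD_sum n (F : 'I_n -> R -> R) (l : 'I_n -> R) t : (forall i, hasD (F i) t (l i)) ->
  hasD (fun s => \sum_i F i s) t (\sum_i l i).
Proof.
elim: n F l => [|n IH] F l h.
  rewrite big_ord0; have := hasD_cst 0 t; congr hasD.
  by apply/funext => s; rewrite big_ord0.
rewrite big_ord_recl; under eq_fun do rewrite big_ord_recl.
by apply: hasDD; [exact: h|apply: IH => i; exact: h].
Qed.

Lemma hasD_quadratic f t l d C : 0 < d -> 
  (forall s, s <= 0 -> `|s - t| < d -> `|f s - f t - l * (s - t)| <= C * `|s - t| ^+ 2) ->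
  hasD f t l.
Proof.
move=> d0 h e e0; exists (Num.min d (e / (`|C| + 1))).
  by rewrite lt_min d0 divr_gt0 // ltr_wpDl.
move=> s s0; rewrite lt_min => /andP[sd se]; apply: le_trans (h s s0 sd) _.
rewrite expr2 mulrA ler_wpM2r //.
have c1 : 0 < `|C| + 1 by rewrite ltr_wpDl.
rewrite ltr_pdivlMr // in se.
have := ler_norm C; have := normr_ge0 (s - t); nra.
Qed.

Lemma hasD_is_derive f t l : t < 0 -> hasD f t l -> is_derive t 1 f l.
Proof.
move=> t0 fl.
have h : h^-1 *: ((f \o shift t) (h *: (1 : R)) - f t) @[h --> 0^'] --> l.
  apply/cvgrPdist_le => e e0; have [d d0 hd] := fl _ e0.
  apply/nbhs_ballP; exists (Num.min d (- t)); first by rewrite /= lt_min d0; lra.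
  move=> h; rewrite /ball /= sub0r normrN lt_min => /andP[hdd ht] h0.
  have h1 : h + t <= 0 by have := ler_norm h; lra.
  have := hd (h + t) h1; rewrite addrK => /(_ hdd) h2.
  rewrite -(ler_pM2r (_ : 0 < `|h|)) ?normr_gt0 // -normrM mulrBl.
  rewrite /GRing.scale /= mulr1 mulrAC mulVf // mul1r.
  by rewrite distrC.
have dh : derivable f t 1 by apply/cvg_ex; exists l.
by apply: DeriveDef => //; exact/cvg_lim.
Qed.

Lemma is_derive_hasD f t l : is_derive t 1 f l -> hasD f t l.
Proof.
move=> fl; have [/cvg_ex[l' fl'] fv] := fl.
have : h^-1 *: ((f \o shift t) (h *: (1 : R)) - f t) @[h --> 0^'] --> l.
  by have <- := fv; rewrite /derive; apply/cvg_ex; exists l'.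
move=> /cvgrPdist_le h e /h /nbhs_ballP[d /= d0 hd]; exists d => // s s0 sd.
have [->|st] := eqVneq s t; first by rewrite !subrr mulr0 subr0 !normr0 mulr0.
have st0 : s - t != 0 by rewrite subr_eq0.
have := hd (s - t); rewrite /ball /= sub0r normrN => /(_ sd st0).
rewrite /GRing.scale /= mulr1 subrK.
rewrite -(ler_pM2r (_ : 0 < `|s - t|)) ?normr_gt0 // -normrM mulrBl.
by rewrite mulrAC mulVf // mul1r distrC.
Qed.

Definition lcont0 f := forall e, 0 < e -> exists2 d, 0 < d &
  forall s, - d < s -> s <= 0 -> `|f s - f 0| <= e.

Lemma hasD_lcont0 f l : hasD f 0 l -> lcont0 f.
Proof.
move=> fl e e0; have [d d0 hd] := fl 1 ltr01.
have l1 : 0 < `|l| + 1 by rewrite ltr_wpDl.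
exists (Num.min d (e / (`|l| + 1))); first by rewrite lt_min d0 divr_gt0.
move=> s; rewrite ltrNl lt_min => /andP[sd se] s0.
rewrite ltr_pdivlMr // in se.
have ns : `|s - 0| = - s by rewrite subr0 ler0_norm.
have := hd s s0; rewrite ns mul1r subr0 => /(_ sd) h.
rewrite (_ : f s - f 0 = (f s - f 0 - l * s) + l * s); last by ring.
apply: le_trans (ler_normD _ _) _; rewrite normrM (ler0_norm s0).
by apply: le_trans (lerD h (lexx _)) _; lra.
Qed.

Lemma lcont0_cvg f : lcont0 f -> f @ 0^'- --> f 0.
Proof.
move=> h; apply/cvgrPdist_le => e /h[d d0 hd]; near=> s.
rewrite distrC; apply: hd; last by near: s; apply: nbhs_left_le.
by near: s; apply: nbhs_left_gt; rewrite oppr_lt0.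
Unshelve. all: by end_near. Qed.

Lemma cvg_lcont0 f : f @ 0^'- --> f 0 -> lcont0 f.
Proof.
move=> /cvgrPdist_le h e e0; have /nbhs_ballP[d /= d0 hd] := h _ e0.
exists d => // s sd; rewrite le_eqVlt => /orP[/eqP ->|s0]; first by rewrite subrr normr0 ltW.
rewrite distrC; apply: hd => //; rewrite /ball /= sub0r normrN ltr0_norm //; lra.
Qed.

Lemma neg_MVT f df a b : (forall t, t < 0 -> is_derive t 1 f (df t)) -> lcont0 f ->
  a < b -> b <= 0 -> exists2 c, a < c < b & f b - f a = df c * (b - a).
Proof.
move=> fd f0 ab b0.
have cf t : t < 0 -> {for t, continuous f}.
  move=> t0; have [d _] := fd t t0.
  exact/differentiable_continuous/derivable1_diffP.
have [c cab ->] : exists2 c, c \in `]a, b[%R & f b - f a = df c * (b - a).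
  apply: MVT => // [x /itvP xab|].
    by apply: fd; apply: lt_le_trans b0; rewrite xab.
  apply/continuous_within_itvP => //; split.
  - by move=> x /itvP xab; apply: cf; apply: lt_le_trans b0; rewrite xab.
  - by apply: cvg_at_right_filter; apply: cf; exact: lt_le_trans b0.
  move: b0; rewrite le_eqVlt => /orP[/eqP ->|b0]; first exact: lcont0_cvg.
  by apply: cvg_at_left_filter; exact: cf.
by exists c => //; move: cab; rewrite in_itv.
Qed.

Lemma neg_nondecreasing f df : (forall t, t < 0 -> is_derive t 1 f (df t)) -> lcont0 f ->
  (forall t, t < 0 -> 0 <= df t) -> nondecreasing_neg f.
Proof.
move=> fd f0 df0 s t; rewrite le_eqVlt => /orP[/eqP -> //|st t0].
have [c /andP[_ ct] h] := neg_MVT fd f0 st t0.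
rewrite -subr_ge0 h mulr_ge0 //; last by lra.
by apply: df0; exact: lt_le_trans t0.
Qed.

Lemma nondecreasing_hasD f t l : t <= 0 -> nondecreasing_neg f -> hasD f t l -> 0 <= l.
Proof.
move=> t0 nf fl; rewrite leNgt; apply/negP => l0.
have l2 : 0 < - l / 2 by lra.
have [d d0 hd] := fl _ l2.
have s0 : t - d / 2 <= 0 by lra.
have ns : `|t - d / 2 - t| = d / 2 by rewrite addrAC subrr add0r normrN gtr0_norm //; lra.
have := hd _ s0; rewrite ns => /(_ _).
have dd : d / 2 < d by lra.
move=> /(_ dd); rewrite ler_norml => /andP[+ _].
have : f (t - d / 2) <= f t by apply: nf => //; lra.
have : 0 < - l * d by rewrite mulr_gt0 //; lra.
rewrite (_ : l * _ = - (l * d / 2)); last by ring.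
by lra.
Qed.

End HalfLineCalculus.

Section Preliminaries.
Context {R : realType}.
Implicit Types (p b : {poly R}).

Lemma horner_is_derive p (t : R) : is_derive t 1 (horner p) p^`().[t].
Proof.
apply: DeriveDef; first exact: derivable_horner.
by rewrite derivE derive1E.
Qed.

Lemma poly_lipschitz p (a c B : R) : (forall u, a <= u <= c -> `|p^`().[u]| <= B) ->
  forall u v, a <= u <= c -> a <= v <= c -> `|p.[u] - p.[v]| <= B * `|u - v|.
Proof.
move=> hB; suff h u v : a <= u <= c -> a <= v <= c -> u < v -> `|p.[u] - p.[v]| <= B * `|u - v|.
  move=> u v hu hv; have [uv|uv|->] := ltgtP u v; first exact: h.
    by rewrite distrC [`|u - v|]distrC; exact: h.
  by rewrite !subrr normr0 mulr0.
move=> /andP[au uc] /andP[av vc] uv; have [x xuv e] := poly_mvt p uv.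
rewrite distrC e normrM [`|u - v|]distrC ler_wpM2r // hB //.
by apply/andP; split; [apply: le_trans au _|apply: le_trans vc]; rewrite ltW // (itvP xuv).
Qed.

Lemma poly_bounded p (a c : R) : exists2 B, 0 <= B & forall u, a <= u <= c -> `|p.[u]| <= B.
Proof.
have [B hB] := @poly_itv_bound _ p a c; exists `|B| => // u hu.
by apply: le_trans (hB u hu) _; exact: ler_norm.
Qed.

Lemma mul_lower_bound (a x A Y : R) : `|a| <= A -> `|x| <= Y -> - (A * Y) <= a * x.
Proof.
move=> aA xY; rewrite lerNl -mulNr; apply: le_trans (ler_norm _) _.
by rewrite normrM normrN ler_pM.
Qed.

(** A substitute for integration against the increments of [G]. Under bisection the lengths halve
    while the increments of [G] add up, so after [j] rounds the error is divided by [2 ^+ j]. *)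
Lemma bisect_le (F G : R -> R) K s0 t0 : s0 <= t0 ->
  (forall s t, s0 <= s -> s <= t -> t <= t0 -> - (K * ((t - s) * (G t - G s))) <= F t - F s) ->
  F s0 <= F t0.
Proof.
move=> st0 h.
have hn j s t : s0 <= s -> s <= t -> t <= t0 ->
    - (K / 2 ^+ j * ((t - s) * (G t - G s))) <= F t - F s.
  elim: j s t => [|j IH] s t s0s st tt0; first by rewrite expr0 divr1 h.
  pose m := (s + t) / 2.
  have sm : s <= m by rewrite /m; lra.
  have mt : m <= t by rewrite /m; lra.
  have h1 := IH s m s0s sm (le_trans mt tt0).
  have h2 := IH m t (le_trans s0s sm) mt tt0.
  have e1 : m - s = (t - s) / 2 by rewrite /m; field.
  have e2 : t - m = (t - s) / 2 by rewrite /m; field.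
  rewrite e1 in h1; rewrite e2 in h2.
  rewrite (_ : K / _ * _ = K / 2 ^+ j * ((t - s) / 2 * (G t - G m)) +
     K / 2 ^+ j * ((t - s) / 2 * (G m - G s))); first by lra.
  by rewrite exprS; field; rewrite expf_neq0 ?pnatr_eq0.
rewrite leNgt; apply/negP => Flt.
set C := K * ((t0 - s0) * (G t0 - G s0)) in hn.
pose D := F s0 - F t0; have D0 : 0 < D by rewrite /D; lra.
have [j hj] : exists j, C / D < 2 ^+ j.
  exists (Num.bound `|C / D|); apply: le_lt_trans (ler_norm _) _.
  apply: lt_trans (archi_boundP (normr_ge0 _)) _.
  by rewrite -natrX ltr_nat ltn_expl.
have := hn j _ _ (lexx _) st0 (lexx _).
have p2 : 0 < 2 ^+ j :> R by rewrite exprn_gt0.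
rewrite ltr_pdivrMr // in hj.
rewrite mulrAC -/C lerNl => h3.
have : C / 2 ^+ j < D by rewrite ltr_pdivrMr // mulrC.
by rewrite /D; lra.
Qed.

Lemma lcont0_horner p : lcont0 (horner p).
Proof. exact: hasD_lcont0 (is_derive_hasD (horner_is_derive p 0)). Qed.

Lemma lcont0D (f h : R -> R) : lcont0 f -> lcont0 h -> lcont0 (fun t => f t + h t).
Proof. by move=> /lcont0_cvg cf /lcont0_cvg ch; apply: cvg_lcont0; exact: cvgD. Qed.

Lemma lcont0M (f h : R -> R) : lcont0 f -> lcont0 h -> lcont0 (fun t => f t * h t).
Proof. by move=> /lcont0_cvg cf /lcont0_cvg ch; apply: cvg_lcont0; exact: cvgM. Qed.

Lemma lcont0_cst (c : R) : lcont0 (fun=> c).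
Proof. by move=> e e0; exists 1 => // s _ _; rewrite subrr normr0 ltW. Qed.

Lemma lcont0_sum N (F : 'I_N -> R -> R) : (forall i, lcont0 (F i)) ->
  lcont0 (fun t => \sum_i F i t).
Proof.
elim: N F => [|N IH] F h.
  have := lcont0_cst 0; congr lcont0.
  by apply/funext => s; rewrite big_ord0.
under eq_fun do rewrite big_ord_recl.
by apply: lcont0D; [exact: h|apply: IH => i; exact: h].
Qed.

End Preliminaries.

(* [X j] is the derivative of order [j] of a function on R_-, [g] plays the role
   of a monotone derivative of [X n]. *)
Record deriv_chain (R : realType) (n : nat) (X : nat -> R -> R) (g : R -> R) : Prop := {
  dc_deriv : forall j, (j < n)%N -> forall t : R, t < 0 -> is_derive t 1 (X j) (X j.+1 t);
  dc_lcont : forall j, (j <= n)%N -> lcont0 (X j);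
  dc_ge0 : forall j, (j <= n)%N -> forall t : R, t <= 0 -> 0 <= X j t;
  dc_nd : forall j, (j <= n)%N -> nondecreasing_neg (X j);
  dc_g_ge0 : forall t : R, t <= 0 -> 0 <= g t;
  dc_g_nd : nondecreasing_neg g;
  dc_slope : forall s t : R, s <= t -> t <= 0 ->
    g s * (t - s) <= X n t - X n s <= g t * (t - s);
  dc_left : forall e : R, 0 < e -> exists2 d : R, 0 < d & g 0 - e <= g (- d);
  dc_lim : forall e : R, 0 < e -> exists2 a : R, a < 0 & forall t, t <= a -> X 0%N t <= e
}.

(** * Integration by parts against a monotone top derivative *)

Section Phi.
Context {R : realType}.
Variables (n : nat) (X : nat -> R -> R) (g : R -> R).
Hypothesis XP : deriv_chain n X g.
Let X_deriv := dc_deriv XP.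
Let X_lcont := dc_lcont XP.
Let X_ge0 := dc_ge0 XP.
Let X_nd := dc_nd XP.
Let g_ge0 := dc_g_ge0 XP.
Let g_nd := dc_g_nd XP.
Let g_slope := dc_slope XP.
Implicit Types (p b c : {poly R}).

(* Formally dPhi_b = b dg (repeated integration by parts), where [g] stands for
   the derivative of [X n]. *)
Definition Phi b t : R :=
  b.[t] * g t - \sum_(i < n.+1) (-1) ^+ i * (b^`(i.+1).[t] * X (n - i)%N t).

Lemma PhiD b c t : Phi (b + c) t = Phi b t + Phi c t.
Proof.
rewrite /Phi hornerD mulrDl [X in _ - X](_ : _ =
  \sum_(i < n.+1) (-1) ^+ i * (b^`(i.+1).[t] * X (n - i)%N t) +
  \sum_(i < n.+1) (-1) ^+ i * (c^`(i.+1).[t] * X (n - i)%N t)); first by ring.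
by rewrite -big_split; apply: eq_bigr => i _; rewrite derivnD hornerD mulrDl mulrDr.
Qed.

Lemma PhiZ a b t : Phi (a *: b) t = a * Phi b t.
Proof.
rewrite /Phi hornerZ mulrBr mulrA; congr (_ - _); rewrite mulr_sumr.
by apply: eq_bigr => i _; rewrite derivnZ hornerZ; ring.
Qed.

Lemma PhiC a t : Phi a%:P t = a * g t.
Proof.
by rewrite /Phi hornerC big1 ?subr0 // => i _; rewrite derivnC horner0 mul0r mulr0.
Qed.

(** The terms of [Phi] whose chain entry is differentiable; [X n] has only the slope bounds given by
    [g], and [g] is only monotone. *)
Let Theta b t : R := \sum_(i < n) (-1) ^+ i.+1 * (b^`(i.+2).[t] * X (n - i.+1)%N t).

Let PhiE b t : Phi b t = b.[t] * g t - b^`().[t] * X n t - Theta b t.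
Proof.
rewrite /Phi big_ord_recl expr0 mul1r subn0 opprD addrA derivn1; congr (_ - _).
Qed.

(** The derivative of the alternating sum telescopes: the first term survives, and the degree bound
    annihilates the last. *)
Let Theta_hasD b t : (size b <= n.+2)%N -> t < 0 -> hasD (Theta b) t (- (b^`(2).[t] * X n t)).
Proof.
move=> sb t0.
pose a i := (-1) ^+ i * (b^`(i.+2).[t] * X (n - i)%N t).
have -> : - (b^`(2).[t] * X n t) = \sum_(i < n) (a i.+1 - a i).
  rewrite -(big_mkord xpredT (fun i => a i.+1 - a i)) telescope_sumr //.
  rewrite /a expr0 mul1r subn0 (_ : b^`(n.+2) = 0) ?horner0 ?mul0r ?mulr0 ?sub0r //.
  by apply/eqP; rewrite -derivn_poly0.
apply: hasD_sum => i.
have ni : (n - i.+1 < n)%N by rewrite ltn_subrL /= (leq_ltn_trans _ (ltn_ord i)).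
have h : hasD (fun s => b^`(i.+2).[s] * X (n - i.+1)%N s) t
    (b^`(i.+3).[t] * X (n - i.+1)%N t + b^`(i.+2).[t] * X (n - i)%N t).
  apply: is_derive_hasD.
  have d1 := horner_is_derive b^`(i.+2) t; have d2 := X_deriv ni t0.
  have := is_deriveM d1 d2; rewrite -subSn ?ltn_ord // subSS => h.
  apply: is_derive_eq h _.
  by rewrite /GRing.scale /= -derivnS addrC mulrC [X in _ + X]mulrC mulrC; ring.
have := hasDZ ((-1) ^+ i.+1) h; rewrite /a exprS; congr hasD; ring.
Qed.

Let Theta_lcont b : lcont0 (Theta b).
Proof.
apply: lcont0_sum => i; apply: lcont0M; first exact: lcont0_cst.
by apply: lcont0M; [exact: lcont0_horner|apply: X_lcont; rewrite leq_subr].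
Qed.

(** On [[s, t]] the increment of [Phi b] is [b.[s] * (g t - g s)], which is nonnegative, up to
    errors of second order; [bisect_le] removes the errors. *)
Lemma Phi_le b s0 t0 : (size b <= n.+2)%N -> s0 <= t0 -> t0 <= 0 ->
  (forall u, s0 <= u <= t0 -> 0 <= b.[u]) -> Phi b s0 <= Phi b t0.
Proof.
move=> sb st0 t00 bp.
have [B1 B1_ge0 hB1] := poly_bounded b^`() s0 t0.
have [B2 B2_ge0 hB2] := poly_bounded b^`()^`() s0 t0.
have [B3 B3_ge0 hB3] := poly_bounded b^`()^`()^`() s0 t0.
set K := B1 + B2 * g 0 + B3 * X n 0 + B2 * g 0.
(* The errors are multiples of [(t - s) ^+ 2] and of [(t - s) * (g t - g s)]; the comparison
   function [t + g t] covers both. The constant collects the bounds [e1] to [e4]. *)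
apply: (@bisect_le _ _ (fun t => t + g t) K) => // s t s0s; rewrite le_eqVlt => /orP[/eqP ->|st] tt0.
  by rewrite !subrr mul0r mulr0 oppr0.
have t0' : t <= 0 := le_trans tt0 t00.
have s0' : s <= 0 := le_trans (ltW st) t0'.
have hin u : s <= u <= t -> s0 <= u <= t0.
  by move=> /andP[su ut]; rewrite (le_trans s0s su) (le_trans ut tt0).
have hs : s0 <= s <= t0 by apply: hin; rewrite lexx ltW.
have ht : s0 <= t <= t0 by apply: hin; rewrite lexx ltW.
have D0 : 0 < t - s by lra.
have g0 u : u <= 0 -> g u <= g 0 by move=> u0; exact: g_nd.
have X0 u : u <= 0 -> X n u <= X n 0 by move=> u0; exact: X_nd.
have dg : 0 <= g t - g s by rewrite subr_ge0; apply: g_nd => //; exact: ltW.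
have [xi /andP[sx xt] dTh] : exists2 c, s < c < t & Theta b t - Theta b s =
    - (b^`(2).[c] * X n c) * (t - s).
  apply: neg_MVT => // u u0; apply: hasD_is_derive => //; exact: Theta_hasD.
have xi0 : xi <= 0 by lra.
have hxi : s0 <= xi <= t0 by apply: hin; rewrite !ltW.
have [eta heta db] := poly_mvt b st.
have [zeta hzeta db'] := poly_mvt b^`() st.
have heta' : s0 <= eta <= t0 by apply: hin; rewrite !ltW ?(itvP heta).
have hzeta' : s0 <= zeta <= t0 by apply: hin; rewrite !ltW ?(itvP hzeta).
have /andP[sl1 sl2] := g_slope (ltW st) t0'.
have /andP[sl3 sl4] := g_slope (ltW sx) xi0.
have e1 : - (B1 * ((t - s) * (g t - g s))) <= b^`().[t] * (g t * (t - s) - (X n t - X n s)).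
  apply: mul_lower_bound; first exact: hB1.
  by rewrite ger0_norm; lra.
have e2 : - (B2 * (t - s) * ((t - s) * g 0)) <= (b^`().[eta] - b^`().[t]) * ((t - s) * g t).
  apply: mul_lower_bound.
    apply: le_trans (poly_lipschitz hB2 heta' ht) _; rewrite ler_wpM2l //.
    by rewrite ler0_norm ?subr_le0 ?(itvP heta) // opprB lerD2l lerN2 (itvP heta).
  by rewrite ger0_norm ?mulr_ge0 ?g_ge0 ?(ltW D0) // ler_wpM2l ?(ltW D0) ?g0.
have e3 : - (B3 * (t - s) * X n 0) <= (b^`()^`().[xi] - b^`()^`().[zeta]) * X n xi.
  apply: mul_lower_bound; last by rewrite ger0_norm ?X_ge0 ?X0.
  apply: le_trans (poly_lipschitz hB3 hxi hzeta') _; rewrite ler_wpM2l //.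
  have := itvP hzeta => hz; rewrite ler_norml; apply/andP; split.
    have : zeta <= t by rewrite hz. by lra.
  have : s <= zeta by rewrite hz. by lra.
have e4 : - (B2 * ((t - s) * g 0)) <= b^`()^`().[zeta] * (X n xi - X n s).
  apply: mul_lower_bound; first exact: hB2.
  have : 0 <= X n xi - X n s by rewrite subr_ge0; apply: X_nd => //; exact: ltW.
  move=> h; rewrite ger0_norm //; apply: le_trans sl4 _.
  rewrite mulrC; apply: ler_pM; rewrite ?g_ge0 ?g0 //; lra.
have bs : 0 <= b.[s] * (g t - g s) by rewrite mulr_ge0 // bp.
rewrite !PhiE.
(* An exact identity from the mean value forms of [b], its derivative and [Theta]; the first term is
   the main one, the others are bounded above. *)
have E : b.[t] * g t - b^`().[t] * X n t - Theta b t - (b.[s] * g s - b^`().[s] * X n s - Theta b s) =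
  b.[s] * (g t - g s) + b^`().[t] * (g t * (t - s) - (X n t - X n s)) +
  (b^`().[eta] - b^`().[t]) * ((t - s) * g t) +
  (t - s) * ((b^`()^`().[xi] - b^`()^`().[zeta]) * X n xi + b^`()^`().[zeta] * (X n xi - X n s)).
  have -> : b.[t] = b.[s] + b^`().[eta] * (t - s) by rewrite -db; ring.
  have -> : Theta b t = Theta b s - b^`()^`().[xi] * X n xi * (t - s).
    by rewrite -[LHS](subrK (Theta b s)) dTh derivnS derivn1; ring.
  have h : b^`().[s] = b^`().[t] - b^`()^`().[zeta] * (t - s) by rewrite -db'; ring.
  by rewrite h; ring.
rewrite E.
have e34 : - ((t - s) * (B3 * (t - s) * X n 0 + B2 * ((t - s) * g 0))) <=
  (t - s) * ((b^`()^`().[xi] - b^`()^`().[zeta]) * X n xi + b^`()^`().[zeta] * (X n xi - X n s)).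
  by rewrite -mulrN ler_pM2l //; lra.
have e5 : 0 <= (B2 * g 0 + B3 * X n 0 + B2 * g 0) * ((t - s) * (g t - g s)).
  by rewrite mulr_ge0 ?addr_ge0 ?mulr_ge0 ?g_ge0 ?X_ge0 // ltW.
have e6 : 0 <= B1 * ((t - s) * (t - s)) by rewrite !mulr_ge0 // ltW.
rewrite (_ : K * _ = B1 * ((t - s) * (g t - g s)) + B1 * ((t - s) * (t - s)) +
   (B2 * g 0 + B3 * X n 0 + B2 * g 0) * ((t - s) * (g t - g s)) +
   B2 * (t - s) * ((t - s) * g 0) +
   (t - s) * (B3 * (t - s) * X n 0 + B2 * ((t - s) * g 0))); last by rewrite /K; ring.
lra.
Qed.

Lemma Phi_ge_mul b s t beta : (size b <= n.+2)%N -> s <= t -> t <= 0 ->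
  (forall u, s <= u <= t -> beta <= b.[u]) -> beta * (g t - g s) <= Phi b t - Phi b s.
Proof.
move=> sb st t0 hb.
have sc : (size (b + (- beta)%:P)%R <= n.+2)%N.
  by apply: leq_trans (size_polyD _ _) _; rewrite geq_max sb (leq_trans (size_polyC_leq1 _)).
have := @Phi_le (b + (- beta)%:P) s t sc st t0.
have h u : s <= u <= t -> 0 <= (b + (- beta)%:P).[u].
  by move=> /hb; rewrite !hornerE subr_ge0.
by move=> /(_ h); rewrite !PhiD !PhiC; lra.
Qed.

End Phi.

Section PhiLimit.
Context {R : realType}.
Variables (n : nat) (X : nat -> R -> R) (g : R -> R).
Hypothesis XP : deriv_chain n X g.
Implicit Types (p b c : {poly R}).

Local Notation Phi := (Phi n X g).

(* |t|^k X_k(t) <= 2^k |t/2|^(k-1) X_(k-1)(t/2), by the mean value theorem on [t, t/2]. *)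
Lemma chain_decay k : (k <= n)%N -> forall e : R, 0 < e ->
  exists2 a : R, a < 0 & forall t, t <= a -> (- t) ^+ k * X k t <= e.
Proof.
elim: k => [|k IH] kn e e0.
  have [a a0 ha] := dc_lim XP e0; exists a => // t ta.
  by rewrite expr0 mul1r ha.
have e'0 : 0 < e / 2 ^+ k.+1 by rewrite divr_gt0 // exprn_gt0.
have [a a0 ha] := IH (ltnW kn) _ e'0.
exists (2 * a) => [|t ta]; first by lra.
have t2 : t / 2 <= a by lra.
have t0 : t < 0 by lra.
have [||c /andP[c1 c2] hc] := @neg_MVT _ (X k) (X k.+1) t (t / 2) (dc_deriv XP kn) (dc_lcont XP (ltnW kn)); try lra.
have h1 : X k.+1 t <= X k.+1 c by apply: (dc_nd XP kn); lra.
have h2 : 0 <= X k t by apply: (dc_ge0 XP (ltnW kn)); lra.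
have h3 : X k.+1 t * (- t / 2) <= X k (t / 2).
  apply: le_trans (_ : X k.+1 c * (- t / 2) <= _); first by rewrite ler_wpM2r //; lra.
  rewrite (_ : - t / 2 = t / 2 - t); last by field.
  by rewrite -hc; lra.
have := ha _ t2; rewrite ler_pdivlMr ?exprn_gt0 // => h4; apply: le_trans h4.
rewrite (_ : - (t / 2) = - t / 2); last by field.
rewrite expr_div_n exprS [2 ^+ k.+1]exprS.
rewrite (_ : _ / _ * _ * _ = 2 * ((- t) ^+ k * X k (t / 2))); last first.
  by field; rewrite expf_neq0 // pnatr_eq0.
have h5 : 0 <= (- t) ^+ k by rewrite exprn_ge0 //; lra.
have := ler_wpM2l h5 h3.
by move: ((- t) ^+ k) (X k (t / 2)) (X k.+1 t) => x y z h6; lra.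
Qed.

Lemma chain_decay_top (e : R) : 0 < e -> exists2 a : R, a < 0 &
  forall t, t <= a -> (- t) ^+ n.+1 * g t <= e.
Proof.
move=> e0; have e'0 : 0 < e / 2 ^+ n.+1 by rewrite divr_gt0 // exprn_gt0.
have [a a0 ha] := chain_decay (leqnn n) e'0.
exists (2 * a) => [|t ta]; first by lra.
have t2 : t / 2 <= a by lra.
have t0 : t < 0 by lra.
have h2 : 0 <= X n t by apply: (dc_ge0 XP (leqnn n)); lra.
have h3 : g t * (- t / 2) <= X n (t / 2).
  have : t <= t / 2 by lra.
  move=> /(dc_slope XP)/(_ _)/andP[|h _]; first by lra.
  by move: h; rewrite (_ : t / 2 - t = - t / 2); [lra|field].
have := ha _ t2; rewrite ler_pdivlMr ?exprn_gt0 // => h4; apply: le_trans h4.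
rewrite (_ : - (t / 2) = - t / 2); last by field.
rewrite expr_div_n exprS [2 ^+ n.+1]exprS.
rewrite (_ : _ / _ * _ * _ = 2 * ((- t) ^+ n * X n (t / 2))); last first.
  by field; rewrite expf_neq0 // pnatr_eq0.
have h5 : 0 <= (- t) ^+ n by rewrite exprn_ge0 //; lra.
have := ler_wpM2l h5 h3.
by move: ((- t) ^+ n) (X n (t / 2)) (g t) => x y z h6; lra.
Qed.

Lemma horner_growth p k : (size p <= k.+1)%N -> exists2 C : R, 0 <= C &
  forall t, 1 <= - t -> `|p.[t]| <= C * (- t) ^+ k.
Proof.
move=> sp; exists (\sum_(i < k.+1) `|p`_i|); first by rewrite sumr_ge0.
move=> t t1; rewrite (horner_coef_wide _ sp) mulr_suml.
apply: le_trans (ler_norm_sum _ _ _) _; apply: ler_sum => i _.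
rewrite normrM ler_wpM2l // normrX -normrN ger0_norm; last by lra.
by apply: ler_weXn2l => //; rewrite -ltnS.
Qed.

Lemma small_sum N (F : 'I_N -> R -> R) :
  (forall i (e : R), 0 < e -> exists2 a : R, a < 0 & forall t, t <= a -> `|F i t| <= e) ->
  forall e : R, 0 < e -> exists2 a : R, a < 0 & forall t, t <= a -> `|\sum_i F i t| <= e.
Proof.
elim: N F => [|N IH] F h e e0.
  by exists (-1) => [|t _]; [lra|rewrite big_ord0 normr0 ltW].
have e2 : 0 < e / 2 by lra.
have [a a0 ha] := h ord0 _ e2.
have [a' a'0 ha'] := IH (fun i => F (lift ord0 i)) (fun i => h _) _ e2.
exists (Num.min a a') => [|t]; first by rewrite gt_min a0.
rewrite le_min => /andP[ta ta']; rewrite big_ord_recl.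
apply: le_trans (ler_normD _ _) _.
by have := ha _ ta; have := ha' _ ta'; lra.
Qed.

Lemma small_mul p k (f : R -> R) : (size p <= k.+1)%N -> (forall t, t <= 0 -> 0 <= f t) ->
  (forall e : R, 0 < e -> exists2 a : R, a < 0 & forall t, t <= a -> (- t) ^+ k * f t <= e) ->
  forall e : R, 0 < e -> exists2 a : R, a < 0 & forall t, t <= a -> `|p.[t] * f t| <= e.
Proof.
move=> sp f0 h e e0; have [C C0 hC] := horner_growth sp.
have [|a a0 ha] := h (e / (C + 1)); first by rewrite divr_gt0 //; lra.
exists (Num.min a (-1)) => [|t]; first by rewrite gt_min a0.
rewrite le_min => /andP[ta t1].
have ft : 0 <= f t by apply: f0; lra.
rewrite normrM (ger0_norm ft).
have t1' : 1 <= - t by lra.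
have h1 := ler_wpM2r ft (hC t t1'); apply: le_trans h1 _.
have := ha t ta; rewrite ler_pdivlMr; last by lra.
have : 0 <= (- t) ^+ k * f t by rewrite mulr_ge0 // exprn_ge0 //; lra.
rewrite -mulrA; move: ((- t) ^+ k * f t) => z; nra.
Qed.

(** The degree of each derivative of [b] is at most the decay order of the chain entry it
    multiplies. *)
Lemma Phi_lim b : (size b <= n.+2)%N -> forall e : R, 0 < e ->
  exists2 a : R, a < 0 & forall t, t <= a -> `|Phi b t| <= e.
Proof.
move=> sb e e0; have e2 : 0 < e / 2 by lra.
have [a a0 ha] := small_mul sb (dc_g_ge0 XP) chain_decay_top e2.
have hi (i : 'I_n.+1) (e' : R) : 0 < e' -> exists2 a : R, a < 0 &
    forall t, t <= a -> `|(-1) ^+ i * (b^`(i.+1).[t] * X (n - i)%N t)| <= e'.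
  move=> e'0; have nin : (n - i <= n)%N by rewrite leq_subr.
  have sbi : (size b^`(i.+1) <= (n - i).+1)%N.
    rewrite cauchyreals.size_derivn; move: (ltn_ord i) sb; move: (size b) (i : nat) => z j; clear; lia.
  have [a1 a10 ha1] := small_mul sbi (dc_ge0 XP nin) (chain_decay nin) e'0.
  by exists a1 => // t ta; rewrite normrM normrX normrN1 expr1n mul1r ha1.
have [a' a'0 ha'] := small_sum hi e2.
exists (Num.min a a') => [|t]; first by rewrite gt_min a0.
rewrite le_min => /andP[ta ta']; apply: le_trans (ler_normB _ _) _.
by have := ha _ ta; have := ha' _ ta'; lra.
Qed.

Lemma Phi_ge0 b t : (size b <= n.+2)%N -> (forall u, u <= 0 -> 0 <= b.[u]) -> t <= 0 ->
  0 <= Phi b t.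
Proof.
move=> sb bp t0; rewrite leNgt; apply/negP => h.
have [|a a0 ha] := @Phi_lim b sb (- Phi b t / 2); first by lra.
pose s := Num.min a t.
have st : s <= t by rewrite /s ge_min lexx orbT.
have := Phi_le XP sb st t0 (fun u hu => bp u (le_trans (proj2 (andP hu)) t0)).
have := ha s; rewrite {1}/s ge_min lexx => /(_ isT).
by rewrite ler_norml => /andP[? ?]; lra.
Qed.

Lemma Phi_eq0 b t : (size b <= n.+2)%N -> (forall u, u <= 0 -> 0 <= b.[u]) ->
  Phi b 0 = 0 -> t <= 0 -> Phi b t = 0.
Proof.
move=> sb bp b0 t0; apply/eqP; rewrite eq_le Phi_ge0 // andbT -b0.
by apply: (Phi_le XP) => // u /andP[_]; exact: bp.
Qed.

(** If [b dg] has total mass zero, then [dg] is carried by the zeros of [b]. Only zeros at negative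
    points count, because [dc_left] excludes a mass at 0. *)
Lemma Phi_support b c : (size b <= n.+2)%N -> (size c <= n.+2)%N ->
  (forall u, u <= 0 -> 0 <= b.[u]) -> Phi b 0 = 0 ->
  (forall u, u < 0 -> root b u -> root c u) -> Phi c 0 = 0.
Proof.
move=> sb sc bp b0 bc.
(* On [s, t] with t < 0, |c| <= e + K b, so Phi_c varies by at most e (g t - g s). *)
have cst_le c' s t e : (size c' <= n.+2)%N -> (forall u, u < 0 -> root b u -> root c' u) ->
    s <= t -> t < 0 -> 0 < e -> - (e * (g t - g s)) <= Phi c' t - Phi c' s.
  move=> sc' bc' st t0 e0.
  have [||K K0 hK] := @nonneg_perturb _ b c' s t e _ _ e0.
  - by move=> u /andP[_ ut]; apply: bp; lra.
  - move=> u /andP[_ ut] ru; suff /eqP -> : root c' u by [].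
    by apply: bc' => //; lra.
  have sD : (size (c' + e%:P + K *: b)%R <= n.+2)%N.
    rewrite (leq_trans (size_polyD _ _)) // geq_max (leq_trans (size_scale_leq _ _)) // andbT.
    by rewrite (leq_trans (size_polyD _ _)) // geq_max sc' (leq_trans (size_polyC_leq1 _)).
  have := Phi_le XP sD st (ltW t0) hK; rewrite !PhiD !PhiC !PhiZ.
  rewrite !(Phi_eq0 sb bp b0) ?(ltW t0) //; last by lra.
  by lra.
have cst s t : s <= t -> t < 0 -> Phi c t = Phi c s.
  move=> st t0; apply/eqP; rewrite -subr_eq0; apply/negPn/negP => ne.
  set z := Phi c t - Phi c s in ne.
  have dg : 0 <= g t - g s by rewrite subr_ge0; apply: (dc_g_nd XP) => //; lra.
  pose e := `|z| / (2 * (g t - g s + 1)).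
  have z0 : 0 < `|z| by rewrite normr_gt0.
  have e0 : 0 < e by rewrite divr_gt0 //; lra.
  have ed : e * (g t - g s) < `|z|.
    rewrite /e mulrAC ltr_pdivrMr; last by lra.
    by rewrite ltr_pM2l //; lra.
  have h1 := cst_le c s t e sc bc st t0 e0.
  have sNc : (size (-1 *: c)%R <= n.+2)%N by rewrite (leq_trans (size_scale_leq _ _)).
  have := cst_le (-1 *: c) s t e sNc _ st t0 e0; rewrite !PhiZ => h2.
  have : `|z| <= e * (g t - g s).
    rewrite ler_norml; apply/andP; split; first exact: h1.
    have : - (e * (g t - g s)) <= - z.
      apply: le_trans (h2 _) _; last by rewrite /z; lra.
      by move=> u u0 /(bc u u0); rewrite rootZ // oppr_eq0 oner_eq0.
    by lra.
  by move=> h; have := lt_le_trans ed h; rewrite ltxx.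
have neg0 t : t < 0 -> Phi c t = 0.
  move=> t0; apply/eqP; apply/negPn/negP => ne.
  have [|a a0 ha] := @Phi_lim c sc (`|Phi c t| / 2).
    by rewrite divr_gt0 // normr_gt0.
  have := ha (Num.min a t); rewrite ge_min lexx => /(_ isT).
  rewrite -(@cst (Num.min a t) t) ?ge_min ?lexx ?orbT //.
  by have : 0 < `|Phi c t|; [rewrite normr_gt0|lra].
have [B B0 hB] := poly_bounded c (-1) 0.
apply/eqP; apply/negPn/negP => ne.
have z0 : 0 < `|Phi c 0| by rewrite normr_gt0.
(* Beyond [t] the increment of [Phi c] is at most [B * (g 0 - g t)]; this choice keeps it below half
   of the supposed nonzero value at 0. *)
have [|d d0 hd] := @dc_left _ _ _ _ XP (`|Phi c 0| / (2 * (B + 1))).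
  by rewrite divr_gt0 //; lra.
pose t := Num.max (- d) (-1).
have t0 : t < 0 by rewrite gt_max; apply/andP; split; lra.
have t1 : -1 <= t by rewrite le_max lexx orbT.
have tB u : t <= u <= 0 -> `|c.[u]| <= B.
  by move=> /andP[tu u0]; apply: hB; rewrite u0 (le_trans t1).
have h1 := @Phi_ge_mul _ _ _ _ XP c t 0 (- B) sc (ltW t0) (lexx _).
have sNc : (size (-1 *: c)%R <= n.+2)%N by rewrite (leq_trans (size_scale_leq _ _)).
have h2 := @Phi_ge_mul _ _ _ _ XP (-1 *: c) t 0 (- B) sNc (ltW t0) (lexx _).
have g1 : g 0 - g t <= `|Phi c 0| / (2 * (B + 1)).
  have : g (- d) <= g t by apply: (dc_g_nd XP); [rewrite le_max lexx|exact: ltW].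
  by lra.
have h3 : B * (g 0 - g t) <= `|Phi c 0| / 2.
  apply: le_trans (ler_wpM2l B0 g1) _.
  rewrite mulrA ler_pdivrMr; last by lra.
  by rewrite (_ : _ / 2 * _ = `|Phi c 0| * (B + 1)); [nra|field].
have h1' : - B * (g 0 - g t) <= Phi c 0.
  have := h1 _; rewrite (neg0 t) // subr0; apply=> u /tB.
  by rewrite ler_norml => /andP[].
have h2' : - B * (g 0 - g t) <= - Phi c 0.
  have := h2 _; rewrite !PhiZ (neg0 t) // mulr0 subr0 mulN1r; apply=> u /tB.
  by rewrite hornerZ mulN1r ler_norml lerN2 => /andP[].
have : `|Phi c 0| <= `|Phi c 0| / 2 by rewrite ler_norml; apply/andP; split; lra.
by lra.
Qed.

End PhiLimit.

(** * Atomic positive functionals *)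

Section PositiveFunctional.
Context {R : realType}.
Implicit Types (p q h P : {poly R}).

(** Factors of ['X - z] are removed in pairs, which preserves nonnegativity. *)
Lemma nonneg_split P z : P != 0 -> nonneg_pos P -> 0 < z ->
  exists h, [/\ nonneg_pos h, h.[z] != 0, (size h <= size P)%N
    & forall y, root P y -> y != z -> root h y].
Proof.
move=> + + z0; have [N] := ubnP (size P); elim: N => // N IH in P *; rewrite ltnS => sP P0 pP.
have [rz|nrz] := boolP (root P z); last by exists P; split.
have : ('X - z%:P) ^+ 2 %| P by rewrite -mup_geq // nonneg_mup_ge2.
move=> /dvdpP[h Ph].
have h0 : h != 0 by apply: contra_neq P0; rewrite Ph => ->; rewrite mul0r.
have hz u : 0 < u -> u != z -> 0 <= h.[u].
  move=> u0 uz; have := pP u u0; rewrite Ph hornerM horner_exp hornerXsubC.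
  by rewrite pmulr_lge0 // exprn_even_gt0 //= subr_eq0.
have hp : nonneg_pos h.
  move=> u u0; have [->|] := eqVneq u z; last exact: hz.
  have <- : (h \Po ('X + z%:P))`_0 = h.[z] by rewrite -horner_coef0 horner_comp !hornerE.
  apply: nonneg_coef0 => v v0; rewrite horner_comp !hornerE hz //; first by rewrite addr_gt0.
  by rewrite -subr_eq0 addrK gt_eqF.
have sh : size P = (size h).+2.
  by rewrite Ph size_Mmonic ?monic_exp ?monicXsubC // size_exp_XsubC addnS /= addn2.
have [|h' [h'p h'z sh' rh']] := IH h _ h0 hp; first by rewrite (leq_trans _ sP) // sh.
exists h'; split=> //; first by rewrite sh (leq_trans sh') // ltnW.
move=> y ry yz; apply: rh' => //; move: ry.
by rewrite Ph rootM => /orP[//|]; rewrite root_exp_XsubC (negbTE yz).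
Qed.

(* [L] is carried by the positive zeros of [P]; the mass of [z] is read off on
   [P] divided by its [(X - z)]-part, which vanishes at the other zeros. *)
Lemma functional_atomic D (L : {poly R} -> R) P :
  (forall p q, L (p + q) = L p + L q) -> (forall a p, L (a *: p) = a * L p) ->
  (forall p, (size p <= D)%N -> nonneg_pos p -> 0 <= L p) ->
  (forall p, (size p <= D)%N -> (forall z, 0 < z -> root P z -> root p z) -> L p = 0) ->
  P != 0 -> nonneg_pos P -> (size P <= D)%N ->
  exists2 s, pos_atoms s & forall p, (size p <= D)%N -> L p = mint s p.
Proof.
move=> LD LZ Lpos Lsupp P0 pP sP.
pose Z := [seq z <- rootsR P | 0 < z].
have ZE z : (z \in Z) = (0 < z) && root P z.
  by rewrite mem_filter -(roots_on_rootsR P0) in_itv.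
have uZ : uniq Z by rewrite filter_uniq // uniq_roots.
have /choice[h hP] : forall z, exists h, z \in Z -> [/\ nonneg_pos h, h.[z] != 0,
    (size h <= size P)%N & forall y, root P y -> y != z -> root h y].
  move=> z; have [zZ|_] := boolP (z \in Z); last by exists 0.
  have := zZ; rewrite ZE => /andP[z0 _].
  by have [h ?] := nonneg_split P0 pP z0; exists h.
pose m z := L (h z) / (h z).[z].
have hz z : z \in Z -> 0 < (h z).[z].
  move=> zZ; have [hp h0 _ _] := hP z zZ; rewrite lt_neqAle eq_sym h0 hp //.
  by move: zZ; rewrite ZE => /andP[].
have m_ge0 z : z \in Z -> 0 <= m z.
  move=> zZ; have [hp _ sh _] := hP z zZ; rewrite divr_ge0 ?(ltW (hz _ zZ)) //.
  by apply: Lpos => //; exact: leq_trans sP.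
have LE p : (size p <= D)%N -> L p = \sum_(z <- Z) m z * p.[z].
  move=> sp; pose q := p - \sum_(z <- Z) (p.[z] / (h z).[z]) *: h z.
  have : L q = 0.
    apply: Lsupp.
      rewrite (leq_trans (size_polyD _ _)) // geq_max sp size_polyN /=.
      rewrite big_seq; apply: (big_ind (fun q => size q <= D)%N).
      - by rewrite size_poly0.
      - by move=> a b sa sb; rewrite (leq_trans (size_polyD _ _)) // geq_max sa.
      - move=> z /hP[_ _ sh _]; rewrite (leq_trans (size_scale_leq _ _)) //.
        exact: leq_trans sP.
    move=> y y0 ry; have yZ : y \in Z by rewrite ZE y0.
    rewrite /root !hornerE horner_sum (bigD1_seq y) //= big_seq_cond big1.
      by rewrite hornerZ mulfVK ?(lt0r_neq0 (hz _ yZ)) // addr0 subrr.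
    move=> z /andP[/hP[_ _ _ hr] zy]; rewrite hornerZ.
    have /eqP -> : root (h z) y by apply: hr; rewrite // eq_sym.
    by rewrite mulr0.
  rewrite LD -scaleN1r LZ mulN1r => /eqP; rewrite subr_eq0 => /eqP ->.
  have L0 : L 0 = 0 by rewrite -(scale0r 0) LZ mul0r.
  elim/big_rec2 : _ => [//|z a b _ <-].
  by rewrite LD LZ /m; congr (_ + _); ring.
exists [seq (m z, z) | z <- [seq z <- Z | 0 < m z]].
  apply/allP => x /mapP[z + ->]; rewrite mem_filter ZE /= => /andP[-> /andP[-> _]].
  by [].
move=> p /LE ->; rewrite /mint big_map big_filter [RHS]big_mkcond /=.
rewrite !big_seq; apply: eq_bigr => z zZ; case: ltP => // mz.
have -> : m z = 0 by apply/eqP; rewrite eq_le mz m_ge0.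
by rewrite mul0r.
Qed.

(** For small [u^-1] the reversed polynomial is close to its constant term, the leading coefficient
    of [P], which is positive. *)
Lemma nonneg_far P : P != 0 -> nonneg_pos P ->
  exists2 B, 1 <= B & exists2 rho, 0 < rho & forall u, B <= u -> rho <= P.[u].
Proof.
move=> P0 pP; set N := (size P).-1.
have sN : (size P <= N.+1)%N by exact: leqSpred.
have lc : (rev_poly N P)`_0 = lead_coef P by rewrite coef_rev // subn0.
have lc0 : 0 < lead_coef P.
  rewrite lt_neqAle eq_sym lead_coef_eq0 P0 lead_coefE nonneg_top //.
  by move=> j hj; apply: nth_default; exact: leq_trans sN hj.
have [K K0 hK] := horner_near0 (rev_poly N P).
have d0 : 0 < (2 * K + 1) / lead_coef P by rewrite divr_gt0 //; lra.
exists (1 + (2 * K + 1) / lead_coef P); first by lra.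
exists (lead_coef P / 2) => [|u hu]; first by lra.
have u0 : 0 < u by lra.
have u1 : 1 <= u by lra.
have v1 : 0 <= u^-1 <= 1 by rewrite invr_ge0 ltW //= invf_le1.
have := hK _ v1; rewrite lc horner_rev ?invr_eq0 ?gt_eqF // invrK => h.
have Ku : K * u^-1 <= lead_coef P / 2.
  rewrite ler_pdivrMr //.
  have : (2 * K + 1) <= lead_coef P * u.
    by rewrite [lead_coef P * u]mulrC -ler_pdivrMr //; lra.
  by lra.
have : lead_coef P / 2 <= u^-1 ^+ N * P.[u].
  by move: h; rewrite ler_norml => /andP[? ?]; lra.
move=> h2; apply: le_trans h2 _; rewrite ler_piMl ?pP //.
by rewrite exprn_ile1 //; case/andP: v1.
Qed.

(** Compactness handles a bounded interval. Near infinity [P] is only bounded away from 0, hence the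
    factor [1 + 'X^m], with [m] above the degree of [q]. *)
Lemma nonneg_perturb_pos P q e : P != 0 -> nonneg_pos P ->
  (forall u, 0 <= u -> root P u -> root q u) -> 0 < e ->
  exists K m, 0 <= K /\ nonneg_pos (q + e%:P + K *: (P * (1 + 'X^m))).
Proof.
move=> P0 pP Pq e0.
have [B B1 [rho rho0 hrho]] := nonneg_far P0 pP.
pose m := (size q).+1.
pose C := \sum_(i < m) `|q`_i|.
have C0 : 0 <= C by rewrite sumr_ge0.
have Xm u : 0 <= u -> 1 <= (1 + 'X^m : {poly R}).[u].
  by move=> u0; rewrite !hornerE lerDl exprn_ge0.
have PX_ge0 u : 0 <= u -> 0 <= (P * (1 + 'X^m)).[u].
  move=> u0; rewrite hornerM mulr_ge0 //; last by have := Xm u u0; lra.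
  by move: u0; rewrite le_eqVlt => /orP[/eqP <-|/pP//]; rewrite horner_coef0 nonneg_coef0.
have [||K1 K10 hK1] := @nonneg_perturb _ (P * (1 + 'X^m)) q 0 B e _ _ e0.
- by move=> u /andP[u0 _]; exact: PX_ge0.
- move=> u /andP[u0 _]; rewrite rootM => /orP[/(Pq u u0)/eqP -> //|].
  by have := Xm u u0; rewrite /root => h /eqP h'; rewrite h' in h; lra.
exists (K1 + C / rho), m; split; first by rewrite addr_ge0 // divr_ge0 // ltW.
move=> u u0; have [uB|Bu] := leP u B.
  rewrite scalerDl addrA hornerD addr_ge0 // ?hK1 ?(ltW u0) //.
  by rewrite hornerZ mulr_ge0 ?PX_ge0 ?(ltW u0) // divr_ge0 // ltW.
have u1 : 1 <= u by lra.
have hq : `|q.[u]| <= C * u ^+ m.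
  rewrite (horner_coef_wide _ (leqnSn _)) mulr_suml.
  apply: le_trans (ler_norm_sum _ _ _) _; apply: ler_sum => i _.
  rewrite normrM ler_wpM2l // ger0_norm ?exprn_ge0 ?(ltW u0) //.
  by apply: ler_weXn2l => //; exact: ltnW.
have um : 0 <= u ^+ m by rewrite exprn_ge0 // ltW.
have h1 : C * u ^+ m <= C / rho * (P * (1 + 'X^m)).[u].
  rewrite -mulrA ler_wpM2l // ler_pdivlMl // hornerM ler_pM //; first exact: ltW.
    by apply: hrho; exact: ltW.
  by rewrite !hornerE lerDr.
rewrite !hornerD hornerC hornerZ mulrDl.
have h2 : 0 <= K1 * (P * (1 + 'X^m)).[u] by rewrite mulr_ge0 ?PX_ge0 ?(ltW u0).
move: hq; rewrite ler_norml => /andP[? _]; lra.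
Qed.

End PositiveFunctional.

Section ChainFunctional.
Context {R : realType}.
Variables (n : nat) (X : nat -> R -> R) (g : R -> R).
Implicit Types (p q P : {poly R}).

(** For the one-knot spline of order [n.+1] with knot [-a] and coefficient 1 this is [a ^+ n.+1 *
    p.[a^-1]], a point evaluation. In general it is the integral of [p] against the representing
    measure. *)
Definition chain_functional p : R :=
  p`_n.+1 * g 0 + \sum_(k < n.+1) (n.+1 - k)`!%:R * p`_k * X k 0.

(* (-t)^(n+1) p(-1/t) *)
Let bpoly p := \poly_(j < n.+2) ((-1) ^+ j * p`_(n.+1 - j)).

Let horner_bpoly p t : (bpoly p).[t] = (rev_poly n.+1 p).[- t].
Proof.
rewrite !horner_poly; apply: eq_bigr => i _.
by rewrite [(- t) ^+ _]exprNn; ring.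
Qed.

Let Phi_bpoly p : Phi n X g (bpoly p) 0 = chain_functional p.
Proof.
rewrite /Phi /chain_functional horner_coef0 coef_poly /= expr0 mul1r; congr (_ + _).
rewrite -sumrN (reindex_inj rev_ord_inj) /=; apply: eq_bigr => i _.
have ni : (i <= n)%N by rewrite -ltnS.
rewrite subSS subKn // horner_coef0 -derivnS coef_derivn addn0 ffactnn coef_poly.
rewrite ltnS subSS [((n - i).+1 <= n.+1)%N]ltnS leq_subr -subSn // subKn ?leqW //.
rewrite subSn // exprS.
have s1 : (-1) ^+ (n - i) * (-1) ^+ (n - i) = 1 :> R by rewrite -exprMn mulrNN mulr1 expr1n.
move: ((n - i).+1`!) ((-1) ^+ (n - i)) s1 => f z s1.
by transitivity (z * z * (f%:R * p`_i * X i 0)); [ring|rewrite s1 mul1r].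
Qed.

Hypothesis XP : deriv_chain n X g.

Let bpoly_ge0 p u : (size p <= n.+2)%N -> nonneg_pos p -> u <= 0 -> 0 <= (bpoly p).[u].
Proof.
move=> sp pp; rewrite le_eqVlt => /orP[/eqP ->|u0].
  rewrite horner_coef0 coef_poly /= expr0 mul1r; apply: nonneg_top => // j jn.
  by apply: nth_default; exact: leq_trans sp jn.
have u0' : 0 < - u by lra.
rewrite horner_bpoly horner_rev ?gt_eqF // mulr_ge0 ?exprn_ge0 ?(ltW u0') // pp //.
by rewrite invr_gt0.
Qed.

Lemma chain_functional_ge0 p : (size p <= n.+2)%N -> nonneg_pos p -> 0 <= chain_functional p.
Proof.
move=> sp pp; rewrite -Phi_bpoly; apply: (Phi_ge0 XP) => //; first exact: size_poly.
by move=> u; exact: bpoly_ge0.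
Qed.

(** The substitution [u = -1/t] carries the positive zeros of [P] to the negative zeros of its
    reversal. *)
Lemma chain_functional_support P p : (size P <= n.+2)%N -> (size p <= n.+2)%N ->
  nonneg_pos P -> chain_functional P = 0 -> (forall z, 0 < z -> root P z -> root p z) ->
  chain_functional p = 0.
Proof.
move=> sP sp pP LP Pp; rewrite -Phi_bpoly; apply: (Phi_support XP (b := bpoly P)).
- exact: size_poly.
- exact: size_poly.
- by move=> u; exact: bpoly_ge0.
- by rewrite Phi_bpoly.
move=> u u0; have u0' : 0 < - u by lra.
have nz : - u != 0 by rewrite gt_eqF.
rewrite /root !horner_bpoly !horner_rev // !mulf_eq0 expf_eq0 /= (negbTE nz) /=.
by apply: Pp; rewrite invr_gt0.
Qed.

Lemma chain_functionalD p q : chain_functional (p + q) = chain_functional p + chain_functional q.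
Proof.
rewrite /chain_functional coefD mulrDl addrACA -big_split; congr (_ + _).
by apply: eq_bigr => i _; rewrite coefD mulrDr mulrDl.
Qed.

Lemma chain_functionalZ a p : chain_functional (a *: p) = a * chain_functional p.
Proof.
rewrite /chain_functional coefZ mulrDr mulr_sumr mulrA; congr (_ + _).
by apply: eq_bigr => i _; rewrite coefZ; ring.
Qed.

Lemma chain_functional_atomic P : P != 0 -> nonneg_pos P -> (size P <= n.+2)%N ->
  chain_functional P = 0 ->
  exists2 s, pos_atoms s & forall p, (size p <= n.+2)%N -> chain_functional p = mint s p.
Proof.
move=> P0 pP sP LP; apply: (functional_atomic (P := P)) => //.
- exact: chain_functionalD.
- exact: chain_functionalZ.
- exact: chain_functional_ge0.
- by move=> p sp; exact: chain_functional_support.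
Qed.

End ChainFunctional.

(* [X j] is the derivative of order [j] of an absolutely monotone function which
   tends to 0 at [-oo]. *)
Record smooth_chain (R : realType) (X : nat -> R -> R) : Prop := {
  sc_deriv : forall j (t : R), t <= 0 -> hasD (X j) t (X j.+1 t);
  sc_ge0 : forall j (t : R), t <= 0 -> 0 <= X j t;
  sc_lim : forall e : R, 0 < e -> exists2 a : R, a < 0 & forall t, t <= a -> X 0%N t <= e
}.

(** * Absolutely monotone functions as a limit of finite orders *)

Section SmoothChain.
Context {R : realType}.
Implicit Types (X : nat -> R -> R) (p q P : {poly R}) (t : R).

Lemma smooth_is_derive X j t : smooth_chain X -> t < 0 -> is_derive t 1 (X j) (X j.+1 t).
Proof. by move=> XP t0; apply: hasD_is_derive => //; apply: (sc_deriv XP); exact: ltW. Qed.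

Lemma smooth_lcont X j : smooth_chain X -> lcont0 (X j).
Proof. by move=> XP; exact: hasD_lcont0 (sc_deriv XP j (lexx 0)). Qed.

Lemma smooth_nd X j : smooth_chain X -> nondecreasing_neg (X j).
Proof.
move=> XP; apply: (neg_nondecreasing (df := X j.+1)).
- by move=> t; exact: smooth_is_derive.
- exact: smooth_lcont.
- by move=> t /ltW; exact: (sc_ge0 XP).
Qed.

Lemma smooth_deriv_chain X n : smooth_chain X -> deriv_chain n X (X n.+1).
Proof.
move=> XP; split.
- by move=> j _ t; exact: smooth_is_derive.
- by move=> j _; exact: smooth_lcont.
- by move=> j _; exact: (sc_ge0 XP).
- by move=> j _; exact: smooth_nd.
- exact: (sc_ge0 XP).
- exact: smooth_nd.
- move=> s t; rewrite le_eqVlt => /orP[/eqP -> _|st t0]; first by rewrite !subrr !mulr0 lexx.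
  have [c /andP[sc ct] ->] := neg_MVT (fun t => @smooth_is_derive X n t XP) (smooth_lcont n XP) st t0.
  rewrite !ler_pM2r ?subr_gt0 //; apply/andP; split; apply: (smooth_nd _ XP); lra.
- move=> e e0; have [d d0 hd] := smooth_lcont n.+1 XP e0.
  exists (d / 2); first by lra.
  have := hd (- (d / 2)); rewrite ltrN2 ler_norml => /(_ _ _)/andP[]; try lra.
- exact: (sc_lim XP).
Qed.

Lemma smooth_shift X t0 : smooth_chain X -> t0 <= 0 -> smooth_chain (fun j t => X j (t + t0)).
Proof.
move=> XP t00; split.
- move=> j t tn e e0; have tt : t + t0 <= 0 by lra.
  have [d d0 hd] := sc_deriv XP j tt e0; exists d => // s s0 sd.
  have := hd (s + t0); rewrite (_ : s + t0 - (t + t0) = s - t); last by ring.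
  by apply => //; lra.
- by move=> j t tn; apply: (sc_ge0 XP); lra.
- move=> e e0; have [a a0 ha] := sc_lim XP e0; exists a => // t ta.
  by apply: ha; lra.
Qed.

(** The operator [p(d/dt)] applied to [X 0] at [t]. Multiplying [p] by ['X] differentiates in [t],
    and on [e ^ (u t)] the value is [p.[u] * e ^ (u t)]. *)
Definition smooth_functional X t p : R := \sum_(k < size p) p`_k * X k t.

Lemma smooth_functional_wide X t p N : (size p <= N)%N ->
  smooth_functional X t p = \sum_(k < N) p`_k * X k t.
Proof.
move=> pN; rewrite /smooth_functional (big_ord_widen _ (fun k => p`_k * X k t) pN) big_mkcond.
by apply: eq_bigr => i _; case: ltnP => // h; rewrite nth_default ?mul0r.
Qed.

Lemma smooth_functionalD X t p q :
  smooth_functional X t (p + q) = smooth_functional X t p + smooth_functional X t q.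
Proof.
rewrite (smooth_functional_wide _ _ (size_polyD p q)).
rewrite (smooth_functional_wide _ _ (leq_maxl (size p) (size q))).
rewrite (smooth_functional_wide _ _ (leq_maxr (size p) (size q))) -big_split.
by apply: eq_bigr => i _; rewrite coefD mulrDl.
Qed.

Lemma smooth_functionalZ X t a p : smooth_functional X t (a *: p) = a * smooth_functional X t p.
Proof.
rewrite (smooth_functional_wide _ _ (size_scale_leq a p)) mulr_sumr.
by apply: eq_bigr => i _; rewrite coefZ mulrA.
Qed.

Lemma smooth_functionalC X t a : smooth_functional X t a%:P = a * X 0%N t.
Proof.
by rewrite (smooth_functional_wide _ _ (size_polyC_leq1 a)) big_ord1 coefC.
Qed.

Lemma smooth_functional_hasD X t p : smooth_chain X -> t <= 0 ->
  hasD (smooth_functional X ^~ p) t (smooth_functional X t (p * 'X)).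
Proof.
move=> XP t0; have sX : (size (p * 'X)%R <= (size p).+1)%N.
  have [->|p0] := eqVneq p 0; first by rewrite mul0r size_poly0.
  by rewrite size_mulX.
rewrite (smooth_functional_wide _ _ sX) big_ord_recl coefMX mul0r add0r.
apply: (@hasD_ext _ (fun s => \sum_(k < size p) p`_k * X k s)) => //.
apply: hasD_sum => i; rewrite coefMX /=; apply: hasDZ; exact: (sc_deriv XP).
Qed.

(** The ratio between the coefficient of [X k] in [chain_functional], rescaled and divided by the
    factorial of [n.+1], and its coefficient in [smooth_functional]. *)
Let fact_ratio k n : R := (n.+1 - k)`!%:R * n.+1%:R ^+ k / n.+1`!%:R.

Let fact_ratio_cvg k : fact_ratio k n @[n --> \oo] --> (1 : R).
Proof.
elim: k => [|k IH].
  apply: cvg_near_cst; apply: nearW => n.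
  by rewrite /fact_ratio subn0 expr0 mulr1 divff // pnatr_eq0 -lt0n fact_gt0.
have h : (n.+1%:R / (n.+1 - k)%:R : R) @[n --> \oo] --> (1 : R).
  apply/cvgrPdist_le => e e0.
  exists (k + Num.bound (k%:R / e))%N => // n /= hn.
  have kn : (k <= n)%N by apply: leq_trans hn; rewrite leq_addr.
  have b0 : 0 <= k%:R / e by rewrite divr_ge0 ?ler0n // ltW.
  have := archi_boundP b0; set B := Num.bound _ in hn * => hB.
  have d0 : 0 < (n.+1 - k)%:R :> R by rewrite ltr0n subn_gt0 ltnS.
  have Bn : B%:R <= (n.+1 - k)%:R :> R.
    by rewrite ler_nat leq_subRL ?leqW // (leq_trans hn).
  have -> : 1 - n.+1%:R / (n.+1 - k)%:R = - (k%:R / (n.+1 - k)%:R) :> R.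
    have -> : n.+1%:R = (n.+1 - k)%:R + k%:R :> R by rewrite -natrD subnK // leqW.
    by field; rewrite gt_eqF.
  rewrite normrN ger0_norm ?divr_ge0 ?ler0n // ler_pdivrMr // mulrC -ler_pdivrMr //.
  by apply: ltW; apply: lt_le_trans Bn.
have e : {near \oo, (fun n => fact_ratio k n * (n.+1%:R / (n.+1 - k)%:R)) =1 fact_ratio k.+1}.
  exists k => // n /= kn.
  rewrite /fact_ratio subSS subSn // factS natrM exprS.
  have h1 : (n - k).+1%:R != 0 :> R by rewrite pnatr_eq0.
  have h2 : n.+1`!%:R != 0 :> R by rewrite pnatr_eq0 -lt0n fact_gt0.
  move: ((n - k).+1%:R : R) h1 (n.+1`!%:R : R) h2 => x x0 y y0.
  by field; rewrite x0 y0.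
have c := cvgM IH h; rewrite mulr1 in c.
exact: cvg_trans (near_eq_cvg e) (c _).
Qed.

(** The inequality holds at each finite order. Applied to [p] rescaled by [n.+1] it becomes, for
    large [n], the inequality for exponentials. The shift reduces the claim to [t = 0]. *)
Lemma smooth_functional_ge0 X t p : smooth_chain X -> t <= 0 -> nonneg_pos p ->
  0 <= smooth_functional X t p.
Proof.
move=> XP t0 pp.
suff h Y : smooth_chain Y -> 0 <= smooth_functional Y 0 p.
  by have := h _ (smooth_shift XP t0); rewrite /smooth_functional; under eq_bigr do rewrite add0r.
move=> {XP t0 X} YP.
have cv : (\sum_(k < size p) fact_ratio k n * (p`_k * Y k 0)) @[n --> \oo] -->
    smooth_functional Y 0 p.
  rewrite [X in _ --> X](_ : _ = \sum_(k < size p) 1 * (p`_k * Y k 0)); last first.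
    by apply: eq_bigr => i _; rewrite mul1r.
  apply: cvg_big => [|k _]; first exact: add_continuous.
  by apply: cvgM; [exact: fact_ratio_cvg|exact: cvg_cst].
apply: (cvgr_to_ge cv).
exists (size p) => // n /= pn.
pose q : {poly R} := \poly_(i < size p) (p`_i * n.+1%:R ^+ i).
have qE u : q.[u] = p.[u * n.+1%:R].
  rewrite horner_poly horner_coef; apply: eq_bigr => i _.
  by rewrite exprMn; ring.
have sq : (size q <= n.+1)%N := leq_trans (size_poly _ _) (leqW pn).
have pq : nonneg_pos q by move=> u u0; rewrite qE pp // mulr_gt0.
have := chain_functional_ge0 (smooth_deriv_chain n YP) (leqW sq) pq.
rewrite /chain_functional nth_default // mul0r add0r => h.
have f0 : 0 < n.+1`!%:R :> R by rewrite ltr0n fact_gt0.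
rewrite -(ler_pM2l f0) mulr0; apply: le_trans h _.
rewrite (big_ord_widen_cond n.+1 xpredT (fun k => fact_ratio k n * (p`_k * Y k 0)) (leqW pn)) mulr_sumr.
rewrite big_mkcond [X in _ <= X]big_mkcond /= le_eqVlt; apply/orP; left; apply/eqP.
apply: eq_bigr => k _; rewrite coef_poly; case: ltnP => // _; last by rewrite mulr0 mul0r.
by rewrite /fact_ratio; field; rewrite gt_eqF.
Qed.

(** As a function of [t], [L t P] is nonnegative and nondecreasing, so its vanishing at 0 spreads to
    R_- and to all its derivatives [L t (P * 'X^j)]. The perturbation argument then gives
    [L t (p * 'X) = 0], so [L t p] is constant; it decays at -oo. *)
Lemma smooth_functional_support X P p : smooth_chain X -> P != 0 -> nonneg_pos P ->
  smooth_functional X 0 P = 0 -> (forall z, 0 < z -> root P z -> root p z) ->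
  smooth_functional X 0 p = 0.
Proof.
move=> XP P0 pP LP Pp; set L := smooth_functional X in LP *.
have Ldv q t : t < 0 -> is_derive t 1 (L ^~ q) (L t (q * 'X)).
  by move=> t0; apply: hasD_is_derive => //; apply: smooth_functional_hasD => //; exact: ltW.
have Llc q : lcont0 (L ^~ q) by exact: hasD_lcont0 (smooth_functional_hasD q XP (lexx 0)).
have LP0 t : t <= 0 -> L t P = 0.
  move=> t0; apply/eqP; rewrite eq_le smooth_functional_ge0 // andbT -LP.
  apply: (neg_nondecreasing (f := L ^~ P) (df := fun t => L t (P * 'X))) => // u u0.
  apply: smooth_functional_ge0 => //; first exact: ltW.
  by move=> v v0; rewrite hornerMX mulr_ge0 ?pP // ltW.
have LPX j t : t <= 0 -> L t (P * 'X^j) = 0.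
  elim: j t => [|j IH] t t0; first by rewrite expr0 mulr1 LP0.
  have [_ h1] := hasD_deriv t0 (smooth_functional_hasD (P * 'X^j) XP t0).
  have [_ h2] := hasD_deriv t0 (hasD_ext t0 (fun s s0 => esym (IH s s0)) (hasD_cst 0 t)).
  by rewrite exprSr mulrA /L -h1 h2.
(* The factor ['X] provides the zero at 0 that the perturbation requires when [P] vanishes there. *)
have Lp1 t : t <= 0 -> L t (p * 'X) = 0.
  move=> t0.
  have ge q e : (forall z, 0 < z -> root P z -> root q z) -> root q 0 -> 0 < e ->
      - (e * X 0%N t) <= L t q.
    move=> Pq q0 e0.
    have [|K [m [K0 hK]]] := @nonneg_perturb_pos _ P q e P0 pP _ e0.
      by move=> u; rewrite le_eqVlt => /orP[/eqP <- //|]; exact: Pq.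
    have := smooth_functional_ge0 XP t0 hK; rewrite !smooth_functionalD smooth_functionalC.
    rewrite smooth_functionalZ mulrDr mulr1 smooth_functionalD -/(L t P) -/(L t (P * 'X^m)).
    by rewrite LP0 // LPX // addr0 mulr0 addr0 -/(L t q); lra.
  have rX c z : 0 < z -> root P z -> root (c *: (p * 'X)) z.
    by move=> z0 /(Pp z z0) rp; rewrite /root hornerZ hornerM (eqP rp) mul0r mulr0.
  have r0 c : root (c *: (p * 'X)) 0 by rewrite /root hornerZ hornerMX !mulr0.
  have X0 := sc_ge0 XP 0%N t0.
  have h c : 0 <= L t (c *: (p * 'X)).
    rewrite leNgt; apply/negP => hlt.
    pose e := - L t (c *: (p * 'X)) / (2 * (X 0%N t + 1)).
    have e0 : 0 < e by rewrite divr_gt0 //; lra.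
    have := ge _ e (rX c) (r0 c) e0.
    have : e * (X 0%N t + 1) = - L t (c *: (p * 'X)) / 2 by rewrite /e; field; rewrite gt_eqF //; lra.
    by nra.
  by have := h 1; have := h (-1); rewrite /L !smooth_functionalZ; lra.
have Lcst t : t < 0 -> L t p = L 0 p.
  move=> t0; have [c /andP[_ c0] h] := neg_MVT (Ldv p) (Llc p) t0 (lexx 0).
  by move: h; rewrite Lp1 ?(ltW c0) // mul0r => /eqP; rewrite subr_eq0 => /eqP.
apply/eqP; apply/negPn/negP => ne.
have z0 : 0 < `|L 0 p| / 2 by rewrite divr_gt0 // normr_gt0.
have hk (i : 'I_(size p)) (e : R) : 0 < e -> exists2 a : R, a < 0 &
    forall t, t <= a -> `|p`_i * X i t| <= e.
  move=> e0.
  have sC : (size (p`_i)%:P <= i.+1)%N by rewrite (leq_trans (size_polyC_leq1 _)).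
  have [a a0 ha] := small_mul sC (sc_ge0 XP i)
    (chain_decay (smooth_deriv_chain i XP) (leqnn i)) e0.
  by exists a => // t /ha; rewrite hornerC.
have [a a0 ha] := small_sum hk z0.
have := ha a (lexx a); rewrite -/(smooth_functional X a p) -/(L a p) Lcst //.
by have : 0 < `|L 0 p|; [rewrite normr_gt0|lra].
Qed.

Lemma smooth_functional_atomic X P : smooth_chain X -> P != 0 -> nonneg_pos P ->
  smooth_functional X 0 P = 0 -> forall D, (size P <= D)%N ->
  exists2 s, pos_atoms s & forall p, (size p <= D)%N -> smooth_functional X 0 p = mint s p.
Proof.
move=> XP P0 pP LP D sP; apply: (functional_atomic (P := P)) => //.
- exact: smooth_functionalD.
- exact: smooth_functionalZ.
- by move=> p _; exact: smooth_functional_ge0.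
- by move=> p _; exact: smooth_functional_support.
Qed.

End SmoothChain.

(** * Essential norms of convex functions *)

Section EssentialNorm.
Context {R : realType}.
Implicit Types (f : R -> R).
Local Notation mu := (@lebesgue_measure R).

Lemma lebesgue_setT_gt0 : (0 < mu setT)%E.
Proof.
have -> : [set: R] = [set` `]-oo, +oo[ ] by rewrite set_itvE.
by rewrite lebesgue_measure_itv /= addye // ltry.
Qed.

Lemma norm_negE f : norm_neg f = ess_sup mu (abse \o (EFin \o (f \_ (@Rneg R)))).
Proof. by rewrite /norm_neg unlock /Lnorm lebesgue_setT_gt0. Qed.

Lemma countable_negligible (N : set R) : countable N -> mu.-negligible N.
Proof.
move=> cN; apply/negligibleP; last exact: countable_lebesgue_measure0.
by apply: countable_measurable => // t; exact: measurable_set1.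
Qed.

Lemma norm_neg_le f (G : R) : 0 <= G -> (forall t, t <= 0 -> `|f t| <= G) ->
  (norm_neg f <= G%:E)%E.
Proof.
move=> G0 fG; rewrite norm_negE; apply/ess_supP; apply: aeW => t /=.
rewrite lee_fin patchE; case: ifPn => [/set_mem|_]; last by rewrite normr0.
exact: fG.
Qed.

Lemma norm_neg_ge0 f : (0 <= norm_neg f)%E.
Proof. exact: Lnorm_ge0. Qed.

(** The countable set and the exceptional set of the essential bound are negligible, while the
    interval has positive measure. *)
Lemma norm_neg_ae f (C a b : R) (N : set R) : (norm_neg f <= C%:E)%E -> countable N ->
  a < b -> b <= 0 -> exists t, [/\ a < t < b, ~ N t & `|f t| <= C].
Proof.
rewrite norm_negE => /ess_supP hC cN ab b0.
apply: contrapT => hno.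
have sub : [set` `]a, b[] `<=` N `|` ~` [set t | ((abse \o (EFin \o (f \_ (@Rneg R)))) t <= C%:E)%E].
  move=> t; rewrite /= in_itv /= => tab.
  have [Nt|nNt] := pselect (N t); first by left.
  right => /= h; apply: hno; exists t; split=> //.
  have tn : t <= 0 by case/andP: tab => _ /ltW tb; exact: le_trans b0.
  by move: h; rewrite lee_fin patchE ifT //; apply/mem_set.
have [A [mA A0 NA]] : mu.-negligible (N `|`
    ~` [set t | ((abse \o (EFin \o (f \_ (@Rneg R)))) t <= C%:E)%E]).
  by apply: negligibleU; [exact: countable_negligible|exact: hC].
have : (mu ([set` `]a, b[] : set R) <= mu A)%E.
  apply: le_measure; rewrite ?inE //; exact: subset_trans sub NA.
rewrite lebesgue_measure_itv /= lte_fin ab -EFinD.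
have -> : mu A = 0%E by exact: A0.
by rewrite lee_fin; lra.
Qed.

Lemma norm_neg_eq f (G : R) : 0 <= G -> (forall t, t <= 0 -> `|f t| <= G) ->
  (forall C, C < G -> exists a N, [/\ a < 0, countable N &
     forall t, a < t -> t < 0 -> ~ N t -> C < `|f t|]) -> norm_neg f = G%:E.
Proof.
move=> G0 fG h; apply/eqP; rewrite eq_le norm_neg_le //= leNgt; apply/negP => lt.
have := norm_neg_ge0 f; case E : (norm_neg f) lt => [C| |] // ; rewrite lte_fin => CG _.
have [a [N [a0 cN hN]]] := h C CG.
have [|t [/andP[at_ t0] Nt ft]] := @norm_neg_ae f C a 0 N _ cN a0 (lexx _); first by rewrite E.
by have := hN t at_ t0 Nt; rewrite ltNge ft.
Qed.

Lemma norm_neg_nondecreasing f : nondecreasing_neg f -> (forall t, t <= 0 -> 0 <= f t) ->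
  lcont0 f -> norm_neg f = (f 0)%:E.
Proof.
move=> nf f0 cf; apply: norm_neg_eq; first exact: f0.
  by move=> t t0; rewrite ger0_norm ?f0 // nf.
move=> C Cf; have e0 : 0 < (f 0 - C) / 2 by lra.
have [d d0 hd] := cf _ e0; exists (- d), set0; split=> //; first by lra.
move=> t td t0 _; have := hd t td (ltW t0); rewrite ler_norml => /andP[h _].
by rewrite ger0_norm ?f0 ?ltW //; lra.
Qed.

End EssentialNorm.

(** * One-sided slopes of a convex function *)

Section ConvexSlopes.
Context {R : realType}.
Variable y : R -> R.
Hypothesis y_convex : convex_neg y.
Implicit Types (s t u : R).

Definition slope s t := (y t - y s) / (t - s).

Lemma convex_neg_le s t u : s < t -> t < u -> u <= 0 ->
  y t * (u - s) <= y s * (u - t) + y u * (t - s).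
Proof.
move=> st tu u0.
have us : 0 < u - s by lra.
have k0 : 0 <= (u - t) / (u - s) by rewrite divr_ge0; lra.
have k1 : (u - t) / (u - s) <= 1 by rewrite ler_pdivrMr //; lra.
have sR : s \in (@Rneg R) by apply/mem_set; rewrite /Rneg /=; lra.
have uR : u \in (@Rneg R) by apply/mem_set.
have := y_convex (Itv01 k0 k1) sR uR.
rewrite !convRE /=.
have -> : conv (Itv01 k0 k1) (s : convex_lmodType R^o) u = t.
  rewrite /conv /= /unstable.onem; rewrite /GRing.scale /=.
  by field; rewrite gt_eqF.
rewrite /unstable.onem => h; have := ler_wpM2r (ltW us) h.
rewrite (_ : (_ + _) * (u - s) = y s * (u - t) + y u * (t - s)) //.
by field; rewrite gt_eqF.
Qed.

Lemma slope_le_right s t u : s < t -> t <= u -> u <= 0 -> slope s t <= slope s u.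
Proof.
move=> st; rewrite le_eqVlt => /orP[/eqP <- //|tu u0].
rewrite /slope ler_pdivrMr ?subr_gt0 // mulrAC ler_pdivlMr; last by lra.
by have := convex_neg_le st tu u0; lra.
Qed.

Lemma slope_le_left s t u : s <= t -> t < u -> u <= 0 -> slope s u <= slope t u.
Proof.
rewrite le_eqVlt => /orP[/eqP <- //|st] tu u0.
rewrite /slope ler_pdivrMr; last by lra.
rewrite mulrAC ler_pdivlMr ?subr_gt0 //.
by have := convex_neg_le st tu u0; lra.
Qed.

(** The left derivative. Slopes of a convex function increase towards [t], so a supremum stands for
    the limit; at 0 its finiteness comes from the bound on the essential norm. *)
Definition lslope t := sup [set slope s t | s in [set s | s < t]].

Let lslope_set_neq0 t : [set slope s t | s in [set s | s < t]] !=set0.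
Proof. by exists (slope (t - 1) t), (t - 1) => //=; lra. Qed.

Let lslope_has_sup t : t < 0 -> has_sup [set slope s t | s in [set s | s < t]].
Proof.
move=> t0; split; first exact: lslope_set_neq0.
exists (slope t 0) => _ [s /= st <-].
apply: le_trans (slope_le_right st (ltW t0) (lexx 0)) _.
exact: slope_le_left (ltW st) t0 (lexx 0).
Qed.

Let slope_lslope_neg s t : s < t -> t < 0 -> slope s t <= lslope t.
Proof. by move=> st t0; apply: ub_le_sup; [exact: (lslope_has_sup t0).2|exists s]. Qed.

Lemma lslope_slope s t : s < t -> t <= 0 -> lslope s <= slope s t.
Proof.
move=> st t0; apply: ge_sup; first exact: lslope_set_neq0.
move=> _ [u /= us <-]; apply: le_trans (slope_le_right us (ltW st) t0) _.
exact: slope_le_left (ltW us) st t0.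
Qed.

(** A jump of the derivative, expressed through right slopes so that no right derivative is
    required. *)
Definition corners : set R := [set t | t < 0 /\
  exists2 e, 0 < e & forall u, t < u -> u <= 0 -> lslope t + e <= slope t u].

(** Every jump contains a rational, and monotonicity of slopes prevents one rational from serving
    two corners. *)
Lemma corners_countable : countable corners.
Proof.
pose F (q : rat) := [set t | [/\ t < 0, lslope t < ratr q
  & forall u, t < u -> u <= 0 -> ratr q <= slope t u]].
have sub : corners `<=` \bigcup_(q in setT) F q.
  move=> t [t0 [e e0 he]].
  have [q] := @rat_in_itvoo _ (lslope t) (lslope t + e) (ltac:(lra)).
  rewrite in_itv /= => /andP[q1 q2]; exists q => //; split=> // u tu u0.
  exact: ltW (lt_le_trans q2 (he u tu u0)).
apply: sub_countable (subset_card_le sub) _.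
apply: bigcup_countable => [|q _]; first exact: countableP.
apply: finite_set_countable.
have F1 t t' : F q t -> F q t' -> ~ t < t'.
  move=> [t0 _ h] [t'0 h' _] tt'; have := h t' tt' (ltW t'0).
  by have := slope_lslope_neg tt' t'0; lra.
have [->|/set0P[t Ft]] := eqVneq (F q) set0; first exact: finite_set0.
apply: (@sub_finite_set _ _ [set t]); last exact: finite_set1.
move=> t' Ft'; have [h|h|//] := ltgtP t' t; [by case: (F1 _ _ Ft' Ft)|by case: (F1 _ _ Ft Ft')].
Qed.

Lemma corners_hasD t : t < 0 -> ~ corners t -> hasD y t (lslope t).
Proof.
move=> t0 Nt e e0.
have [_ [s0 /= s0t <-] hs0] : exists2 z, [set slope s t | s in [set s | s < t]] z & lslope t - e < z.
  by apply: sup_adherent => //; exact: lslope_has_sup.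
have [u0 [tu0 u00 hu0]] : exists u, [/\ t < u, u <= 0 & slope t u < lslope t + e].
  apply: contrapT => h; apply: Nt; split=> //; exists e => // u tu un.
  by rewrite leNgt; apply/negP => h'; apply: h; exists u.
exists (Num.min (t - s0) (u0 - t)); first by rewrite lt_min !subr_gt0 s0t.
move=> s sn; rewrite lt_min => /andP[h1 h2].
have [st|st|->] := ltgtP s t; last by rewrite !subrr mulr0 subr0 !normr0 mulr0.
- rewrite ltr0_norm ?subr_lt0 // opprB in h1 *.
  have a1 := slope_lslope_neg st t0.
  have a2 : slope s0 t <= slope s t by apply: slope_le_left; lra.
  have ts0 : 0 < t - s by lra.
  rewrite (_ : _ - _ - _ = (lslope t - slope s t) * (t - s)); last first.
    by rewrite /slope; field; rewrite gt_eqF.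
  by rewrite normrM !ger0_norm; [rewrite ler_wpM2r; lra|lra|lra].
rewrite gtr0_norm ?subr_gt0 // in h2 *.
have a1 := lslope_slope st sn.
have a2 : slope t s <= slope t u0 by apply: slope_le_right; lra.
have ts0 : 0 < s - t by lra.
rewrite (_ : _ - _ - _ = (slope t s - lslope t) * (s - t)); last first.
  by rewrite /slope; field; rewrite gt_eqF.
by rewrite normrM !ger0_norm; [rewrite ler_wpM2r; lra|lra|lra].
Qed.

Hypothesis y_nd : nondecreasing_neg y.
Hypothesis y_lcont : lcont0 y.
Variable C : R.
Hypothesis y_norm : (norm_neg (deriv_neg y) <= C%:E)%E.

Let slope_ge0 s t : s < t -> t <= 0 -> 0 <= slope s t.
Proof. by move=> st t0; rewrite divr_ge0 ?subr_ge0 ?(ltW st) // y_nd // ltW. Qed.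

(** Between [t] and 0 there is a point that is not a corner and at which the derivative is at most
    [C]; slopes further left are smaller. *)
Let slope_neg_le s t : s < t -> t < 0 -> slope s t <= C.
Proof.
move=> st t0.
have [u [/andP[tu u0] Nu]] := norm_neg_ae y_norm corners_countable t0 (lexx 0).
have [_ ->] := hasD_deriv (ltW u0) (corners_hasD u0 Nu).
apply: le_trans; apply: le_trans (ler_norm _).
apply: le_trans (slope_lslope_neg st t0) _.
apply: le_trans (lslope_slope tu (ltW u0)) _.
exact: slope_lslope_neg.
Qed.

(** Left continuity carries the bound to slopes ending at 0, which makes [lslope 0] a genuine
    supremum. *)
Let slope_le s t : s < t -> t <= 0 -> slope s t <= C.
Proof.
move=> st; rewrite le_eqVlt => /orP[/eqP t0|]; last exact: slope_neg_le.
rewrite t0 in st *; rewrite leNgt; apply/negP => h.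
have C0 : 0 <= C.
  have a1 : s - 1 < s by lra.
  exact: le_trans (slope_ge0 a1 (ltW st)) (slope_neg_le a1 st).
have e0 : 0 < (slope s 0 - C) * (- s) / 2 by rewrite divr_gt0 // mulr_gt0 //; lra.
have [d d0 hd] := y_lcont e0.
pose t1 := Num.max (- (d / 2)) (s / 2).
have t1d : - d < t1 by rewrite lt_max; apply/orP; left; lra.
have t10 : t1 < 0 by rewrite gt_max; apply/andP; split; lra.
have st1 : s < t1 by rewrite lt_max; apply/orP; right; lra.
have := hd t1 t1d (ltW t10); rewrite ler_norml => /andP[h1 _].
have := slope_neg_le st1 t10; rewrite /slope ler_pdivrMr ?subr_gt0 // => h2.
have h3 : slope s 0 * (- s) = y 0 - y s by rewrite /slope sub0r divfK // oppr_eq0 lt_eqF.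
have : C * (t1 - s) <= C * (- s) by rewrite ler_wpM2l //; lra.
have := mulrBl (- s) (slope s 0) C; rewrite h3 => h4.
rewrite h4 in h1 e0; lra.
Qed.

Let lslope_has_sup0 t : t <= 0 -> has_sup [set slope s t | s in [set s | s < t]].
Proof.
move=> t0; split; first exact: lslope_set_neq0.
by exists C => _ [s /= st <-]; exact: slope_le.
Qed.

Lemma slope_lslope s t : s < t -> t <= 0 -> slope s t <= lslope t.
Proof. by move=> st t0; apply: ub_le_sup; [exact: (lslope_has_sup0 t0).2|exists s]. Qed.

Lemma lslope_ge0 t : t <= 0 -> 0 <= lslope t.
Proof.
move=> t0; have t1 : t - 1 < t by lra.
exact: le_trans (slope_ge0 t1 t0) (slope_lslope t1 t0).
Qed.

Lemma lslope_nd : nondecreasing_neg lslope.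
Proof.
move=> s t; rewrite le_eqVlt => /orP[/eqP -> //|st] t0.
exact: le_trans (lslope_slope st t0) (slope_lslope st t0).
Qed.

Lemma lslope_slope_mul s t : s <= t -> t <= 0 ->
  lslope s * (t - s) <= y t - y s <= lslope t * (t - s).
Proof.
rewrite [s <= t]le_eqVlt => /orP[/eqP -> _|st t0]; first by rewrite !subrr !mulr0 lexx.
have ts : 0 < t - s by lra.
have := lslope_slope st t0; have := slope_lslope st t0.
by rewrite /slope ler_pdivrMr // ler_pdivlMr // => -> ->.
Qed.

Let slope_near0 D : D < lslope 0 -> exists s t1, [/\ s < t1, t1 < 0 &
  forall t, t1 < t -> t < 0 -> D < slope s t].
Proof.
move=> DG.
have [_ [s /= s0 <-] hs] : exists2 z, [set slope s 0 | s in [set s | s < 0]] z &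
    lslope 0 - (lslope 0 - D) < z.
  by apply: sup_adherent; [lra|exact: lslope_has_sup0].
have e0 : 0 < (slope s 0 - D) * (- s) / 2 by rewrite divr_gt0 // mulr_gt0 //; lra.
have [d d0 hd] := y_lcont e0.
have h3 : slope s 0 * (- s) = y 0 - y s by rewrite /slope sub0r divfK // oppr_eq0 lt_eqF.
pose z := (slope s 0 - D) * (- s) / 2.
have z0 : 0 < z / (`|D| + 1) by rewrite divr_gt0 // ltr_wpDl.
exists s, (Num.max (Num.max (- d) (s / 2)) (- (z / (`|D| + 1)))); split.
- by rewrite !lt_max; apply/orP; left; apply/orP; right; lra.
- by rewrite !gt_max; apply/andP; split; [apply/andP; split|]; lra.
move=> t; rewrite !gt_max => /andP[/andP[td ts] tz] t0.
have st : 0 < t - s by lra.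
rewrite /slope ltr_pdivlMr //.
have := hd t td (ltW t0); rewrite ler_norml => /andP[h1 _].
have Dt : D * t < z.
  have : `|D * t| <= `|D| * (- t) by rewrite normrM [`|t|]ltr0_norm.
  rewrite ltrNl ltr_pdivlMr in tz; last by rewrite ltr_wpDl.
  by rewrite ler_norml => /andP[_ ?]; lra.
have := mulrBl (- s) (slope s 0) D; rewrite h3 => h4.
rewrite /z h4 in Dt; rewrite h4 in h1 e0; lra.
Qed.

Lemma lslope_left e : 0 < e -> exists2 d, 0 < d & lslope 0 - e <= lslope (- d).
Proof.
move=> e0; have [|s [t1 [st1 t10 h]]] := @slope_near0 (lslope 0 - e); first by lra.
exists (- (t1 / 2)); rewrite ?opprK; first by lra.
have tt : t1 < t1 / 2 by lra.
have t0 : t1 / 2 < 0 by lra.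
apply: ltW; apply: lt_le_trans (h _ tt t0) _.
by apply: slope_lslope; lra.
Qed.

(** Off the countable set of corners the derivative is [lslope], which is left-continuous at 0.
    Where the derivative does not exist its default value 0 respects the upper bound. *)
Lemma norm_neg_deriv : norm_neg (deriv_neg y) = (lslope 0)%:E.
Proof.
have d_ge0 t l : t <= 0 -> hasD y t l -> 0 <= l by move=> t0; exact: nondecreasing_hasD.
apply: norm_neg_eq; first exact: lslope_ge0.
  move=> t t0; have [dt|ndt] := pselect (derivable_neg y t); last first.
    by rewrite not_derivable_deriv // normr0 lslope_ge0.
  have hD := derivable_hasD t0 dt; rewrite ger0_norm; last exact: d_ge0 hD.
  apply: le_trans (lslope_nd t0 (lexx 0)); rewrite leNgt; apply/negP => h.
  have e0 : 0 < (deriv_neg y t - lslope t) / 2 by lra.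
  have [d d0 hd] := hD _ e0.
  have s0 : t - d / 2 <= 0 by lra.
  have ns : `|t - d / 2 - t| = d / 2 by rewrite addrAC subrr add0r normrN gtr0_norm //; lra.
  have := hd _ s0; rewrite ns => /(_ ltac:(lra)).
  rewrite ler_norml => /andP[_ h1].
  have st : t - d / 2 <= t by lra.
  have /andP[_] := lslope_slope_mul st t0.
  have : 0 < (deriv_neg y t - lslope t) * d by rewrite mulr_gt0 //; lra.
  rewrite (_ : t - d / 2 - t = - (d / 2)) in h1; last by ring.
  rewrite (_ : t - (t - d / 2) = d / 2); last by ring.
  lra.
move=> D DG; have [s [t1 [st1 t10 h]]] := slope_near0 DG.
exists t1, corners; split=> //; first exact: corners_countable.
move=> t tt t0 Nt; have [_ ->] := hasD_deriv (ltW t0) (corners_hasD t0 Nt).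
apply: lt_le_trans (ler_norm _); apply: lt_le_trans (h t tt t0) _.
by apply: slope_lslope; [exact: lt_trans tt|exact: ltW].
Qed.

End ConvexSlopes.

(** * Norm vectors lie in the moment cone *)

Section Necessity.
Context {R : realType}.
Implicit Types (x : R -> R) (p P : {poly R}).

(** By contradiction: a vector outside the cone has [ev w k M p <= 0] for some nonnegative [p].
    Positivity of [L] and of the mass at 0 forces [L p = 0], and then [Latom] turns [L] into an
    atomic measure representing the vector. *)
Lemma pcone_of_functional (w : nat -> R) N (k : 'I_N -> nat) (M : 'rV[R]_N) D
    (L : {poly R} -> R) kap : (forall j, 0 < w j) -> injective k ->
  (forall i, k i < D)%N -> 0 <= kap ->
  (forall p q, L (p + q) = L p + L q) -> (forall a p, L (a *: p) = a * L p) ->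
  (forall p, (size p <= D)%N -> nonneg_pos p -> 0 <= L p) ->
  (forall P, P != 0 -> nonneg_pos P -> (size P <= D)%N -> L P = 0 ->
    exists2 s, pos_atoms s & forall p, (size p <= D)%N -> L p = mint s p) ->
  (forall i, M 0 i = w (k i) * (L 'X^(k i) + kap * (k i == 0%N)%:R)) ->
  pcone w k M.
Proof.
move=> w0 ki kD kap0 LD LZ Lpos Latom hM.
have wN0 j : w j != 0 by rewrite gt_eqF.
apply: contrapT => nM.
have [|p [p0 sp pp]] := pos_separation w0 ki (M := M).
  by move=> /interior_subset.
have sD : (size p <= D)%N.
  apply/leq_sizeP => j Dj; apply/eqP; apply: contraLR Dj => /sp /codomP[i ->].
  by rewrite -ltnNge.
have LS (F : 'I_N -> {poly R}) : L (\sum_i F i) = \sum_i L (F i).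
  elim/big_rec2 : _ => [|i a b _ <-]; last by rewrite LD.
  by rewrite -(scale0r 0) LZ mul0r.
have -> : ev w k M p = L p + kap * p`_0.
  rewrite {2 3}(sparseE ki sp) LS coef_sum mulr_sumr -big_split /=.
  apply: eq_bigr => i _; rewrite hM LZ coefZ coefXn [w _ * _]mulrC mulfK //.
  by rewrite mulrDr; congr (_ + _); rewrite mulrCA; case: (k i).
have h1 := Lpos p sD pp; have h2 : 0 <= kap * p`_0 by rewrite mulr_ge0 ?nonneg_coef0.
move=> h3; have Lp : L p = 0 by lra.
have [s sP hs] := Latom p p0 pp sD Lp.
apply: nM; exists s, kap; split=> // i.
by rewrite hM hs // size_polyXn.
Qed.

(** The factor left in the norm of order [j] of a one-knot spline with knot [-a] once its
    coefficient and [a ^+ (r - j)] (for [Class_AM] too) are taken out. *)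
Definition wt (r : nat) (X : function_class) (j : nat) : R :=
  match X with Class_Lr_cup => (r - j)`!%:R^-1 | Class_AM => 1 end.

Lemma wt_gt0 r X j : 0 < wt r X j.
Proof. by case: X => /=; rewrite ?ltr01 // invr_gt0 ltr0n fact_gt0. Qed.

(** For a nonnegative nondecreasing [x] this removes the limit at -oo, which no derivative sees; it
    returns later as the mass at 0. *)
Let inf_shift x j : R := if j is 0%N then - inf [set x t | t in @Rneg R] else 0.

Definition shifted_derivn x j t : R := derivn_neg j x t + inf_shift x j.

Lemma shifted_hasD x j t : t <= 0 -> derivable_neg (derivn_neg j x) t ->
  hasD (shifted_derivn x j) t (shifted_derivn x j.+1 t).
Proof.
move=> t0 dx; rewrite /shifted_derivn /inf_shift.
apply: hasDD; last exact: hasD_cst.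
exact: derivable_hasD.
Qed.

Section NonnegNondecreasing.
Variable x : R -> R.
Hypotheses (x_ge0 : forall t, t <= 0 -> 0 <= x t) (x_nd : nondecreasing_neg x).

Let has_inf_x : has_inf [set x t | t in @Rneg R].
Proof.
split; first by exists (x 0), 0; rewrite //= /Rneg /=.
by exists 0 => _ [t t0 <-]; exact: x_ge0.
Qed.

Lemma shifted0_ge0 t : t <= 0 -> 0 <= shifted_derivn x 0 t.
Proof.
by move=> t0; rewrite /shifted_derivn subr_ge0; apply: ge_inf; [exact: has_inf_x.2|exists t].
Qed.

Lemma inf_x_ge0 : 0 <= inf [set x t | t in @Rneg R].
Proof. by apply: lb_le_inf; [exact: has_inf_x.1|move=> _ [t t0 <-]; exact: x_ge0]. Qed.

Lemma shifted0_lim e : 0 < e -> exists2 a : R, a < 0 & forall t, t <= a -> shifted_derivn x 0 t <= e.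
Proof.
move=> e0; have [_ [a a0 <-] ha] := inf_adherent e0 has_inf_x.
rewrite /Rneg /= in a0.
exists (a - 1) => [|t ta]; first by lra.
rewrite /shifted_derivn lerBlDl.
by apply: le_trans (ltW ha); apply: x_nd; lra.
Qed.

End NonnegNondecreasing.

Lemma abs_cont_lcont0 (y : R -> R) : loc_abs_cont_neg y -> lcont0 y.
Proof.
move=> /(_ (-1) 0) acy e e0; have N10 : (-1 : R) <= 0 by lra.
have [d d0 hd] := acy N10 (lexx _) e e0.
exists (Num.min d 1); first by rewrite lt_min d0 ltr01.
move=> s; rewrite ltrNl lt_min => /andP[sd s1] s0.
have s1' : -1 <= s by rewrite lerNl ltW.
have := hd 1%N (fun=> s) (fun=> 0); rewrite !big_ord1 distrC => h; apply/ltW/h.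
- by [].
- by move=> i j _ _ _; rewrite !ord1.
- by rewrite sub0r.
Qed.

(** The left derivative of the last convex derivative serves as the top of the chain: it is defined
    everywhere on R_-, and its value at 0 is the essential norm. *)
Lemma Lr_cup_chain n x : Lr_cup n.+2 x ->
  deriv_chain n.+1 (shifted_derivn x) (lslope (derivn_neg n.+1 x)) /\
  (forall j, (j < n.+2)%N -> norm_neg (derivn_neg j x) = (derivn_neg j x 0)%:E) /\
  norm_neg (derivn_neg n.+2 x) = (lslope (derivn_neg n.+1 x) 0)%:E.
Proof.
move=> [[_ dx acy [_ nlt]] x_ge0 hnc]; set y := derivn_neg n.+1 x in acy *.
have ndj j (jn : (j < n.+2)%N) : nondecreasing_neg (derivn_neg j x) := (hnc j jn).1.
have [C hC] : exists C : R, (norm_neg (deriv_neg y) <= C%:E)%E.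
  have := norm_neg_ge0 (deriv_neg y); move: nlt; rewrite -[derivn_neg n.+2 x]/(deriv_neg y).
  by case: (norm_neg _) => [c| |] // _ _; exists c.
have y_lc : lcont0 y by exact: abs_cont_lcont0.
have y_nd : nondecreasing_neg y by exact: ndj.
have y_cv : convex_neg y by exact: (hnc n.+1 (ltnSn _)).2.
have hD j t : (j < n.+1)%N -> t <= 0 -> hasD (derivn_neg j x) t (derivn_neg j.+1 x t).
  by move=> jn t0; apply: derivable_hasD => //; exact: dx.
have ge0 j t : (j < n.+2)%N -> t <= 0 -> 0 <= derivn_neg j x t.
  case: j => [|j] jn t0; first exact: x_ge0.
  by apply: nondecreasing_hasD (hD j t _ t0) => //; apply: ndj; exact: ltnW.
have lc j : (j < n.+2)%N -> lcont0 (derivn_neg j x).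
  rewrite ltnS leq_eqVlt => /orP[/eqP -> //|jn].
  exact: hasD_lcont0 (hD j 0 jn (lexx 0)).
have lc' j : (j < n.+2)%N -> lcont0 (shifted_derivn x j).
  by move=> jn e /(lc j jn)[d d0 hd]; exists d => // s sd s0; rewrite /shifted_derivn opprD addrACA subrr addr0 hd.
split; last split.
- split.
  + by move=> j jn t t0; apply: hasD_is_derive => //; apply: shifted_hasD; [exact: ltW|apply: dx => //; exact: ltW].
  + by move=> j jn; exact: lc'.
  + case=> [|j] jn t t0; first exact: shifted0_ge0.
    by rewrite /shifted_derivn addr0 ge0.
  + by move=> j jn s t st t0; rewrite lerD2r; exact: ndj.
  + by move=> t; exact: (lslope_ge0 y_cv y_nd y_lc hC).
  + exact: (lslope_nd y_cv y_nd y_lc hC).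
  + move=> s t st t0; rewrite /shifted_derivn !addr0.
    exact: (lslope_slope_mul y_cv y_nd y_lc hC).
  + by move=> e; exact: (lslope_left y_cv y_nd y_lc hC).
  + by move=> e; apply: shifted0_lim => //; exact: (ndj 0%N).
- by move=> j jn; apply: norm_neg_nondecreasing; [exact: ndj|move=> t; exact: ge0|exact: lc].
- exact: (norm_neg_deriv y_cv y_nd y_lc hC).
Qed.

Lemma Lr_cup_pcone n N (k : 'I_N -> nat) M x : injective k -> (forall i, k i <= n.+2)%N ->
  Lr_cup n.+2 x -> has_norms k M x -> pcone (wt n.+2 Class_Lr_cup) k M.
Proof.
move=> ki kr xL hM; have [XP [nx nr]] := Lr_cup_chain xL.
set X := shifted_derivn x in XP; set g := lslope _ in XP nr.
have [_ x_ge0 _] := xL.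
have x_nd : nondecreasing_neg x by case: xL => _ _ /(_ 0%N isT)[].
(* The factorial cancels [wt] at exponent 0, so that the mass at 0 restores exactly the subtracted
   infimum. *)
apply: (@pcone_of_functional _ _ _ _ n.+3 (chain_functional n.+1 X g)
  (n.+2`!%:R * inf [set x t | t in @Rneg R])) => //.
- by move=> j; exact: wt_gt0.
- by rewrite mulr_ge0 ?ler0n // inf_x_ge0.
- exact: chain_functionalD.
- exact: chain_functionalZ.
- by move=> p; exact: chain_functional_ge0.
- by move=> P P0 pP sP LP; exact: (chain_functional_atomic XP P0).
move=> i; apply: EFin_inj; rewrite -hM /chain_functional coefXn.
have := kr i; rewrite leq_eqVlt => /orP[/eqP kin|kin].
  rewrite kin nr eqxx mul1r big1 ?addr0.
    by rewrite /= subnn fact0 invr1 mul1r mulr0 addr0.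
  by move=> j _; rewrite coefXn ltn_eqF ?mulr0 ?mul0r //.
rewrite nx // [(n.+2 == k i)%N]gtn_eqF // mul0r add0r.
rewrite (bigD1 (Ordinal kin)) //= big1 => [|j ji]; last first.
  rewrite coefXn; case: eqP => [jk|_]; last by rewrite mulr0 mul0r.
  by case/eqP: ji; apply: val_inj.
rewrite coefXn eqxx mulr1 addr0 /X /shifted_derivn; congr (_%:E).
have f0 : (n.+2 - k i)`!%:R != 0 :> R by rewrite pnatr_eq0 -lt0n fact_gt0.
case: (k i) f0 => [|j] f0 /=; last by rewrite addr0 mulr0 addr0 mulKf.
by rewrite subn0 mulr1 -mulrDr subrK mulKf.
Qed.

Lemma AM_pcone r N (k : 'I_N -> nat) (M : 'rV[R]_N) x : injective k -> (forall i, k i <= r)%N ->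
  AM x -> has_norms k M x -> pcone (wt r Class_AM) k M.
Proof.
move=> ki kr xA hM; set X := shifted_derivn x.
have x_ge0 t : t <= 0 -> 0 <= x t by move=> t0; have [] := xA 0%N t t0.
have hD j t : t <= 0 -> hasD (derivn_neg j x) t (derivn_neg j.+1 x t).
  by move=> t0; apply: derivable_hasD => //; have [] := xA j t t0.
have ndj j : nondecreasing_neg (derivn_neg j x).
  apply: (@neg_nondecreasing _ _ (derivn_neg j.+1 x)).
  - by move=> t t0; apply: hasD_is_derive => //; apply: hD; exact: ltW.
  - exact: hasD_lcont0 (hD j 0 (lexx 0)).
  - by move=> t /ltW t0; have [] := xA j.+1 t t0.
have x_nd : nondecreasing_neg x := ndj 0%N.
have XP : smooth_chain X.
  split.
  - by move=> j t t0; apply: shifted_hasD => //; have [] := xA j t t0.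
  - case=> [|j] t t0; first exact: shifted0_ge0.
    by rewrite /X /shifted_derivn addr0; have [] := xA j.+1 t t0.
  - by move=> e; exact: shifted0_lim.
apply: (@pcone_of_functional _ _ _ _ r.+1 (smooth_functional X 0)
  (inf [set x t | t in @Rneg R])) => //.
- by apply: inf_x_ge0.
- exact: smooth_functionalD.
- exact: smooth_functionalZ.
- by move=> p _; exact: smooth_functional_ge0.
- by move=> P P0 pP sP LP; exact: (smooth_functional_atomic XP P0 pP LP sP).
move=> i; apply: EFin_inj; rewrite -hM.
rewrite (norm_neg_nondecreasing (ndj (k i))); last 2 first.
- by move=> t t0; have [] := xA (k i) t t0.
- exact: hasD_lcont0 (hD (k i) 0 (lexx 0)).
congr (_%:E); rewrite /= mul1r (@smooth_functional_wide _ _ _ _ (k i).+1) ?size_polyXn //.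
rewrite big_ord_recr /= big1 => [|j _]; last by rewrite coefXn ltn_eqF ?mul0r.
rewrite coefXn eqxx mul1r add0r /X /shifted_derivn.
by case: (k i) => [|j] /=; rewrite ?mulr1 ?subrK // mulr0 !addr0.
Qed.

End Necessity.

(** * Ideal splines *)

Section Splines.
Context {R : realType}.
Implicit Types (f : R -> R).

Lemma derivn_neg_chain J (F : nat -> R -> R) :
  (forall j, (j < J)%N -> forall t : R, t <= 0 -> hasD (F j) t (F j.+1 t)) ->
  forall j, (j <= J)%N -> forall t, t <= 0 -> derivn_neg j (F 0%N) t = F j t.
Proof.
move=> hF; elim=> [//|j IH] jJ t t0.
have [_ <-] := hasD_deriv t0 (hasD_ext t0 (fun s s0 => esym (IH (ltnW jJ) s s0)) (hF j jJ t t0)).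
by [].
Qed.

Lemma derivn_neg_chain_hasD J (F : nat -> R -> R) :
  (forall j, (j < J)%N -> forall t : R, t <= 0 -> hasD (F j) t (F j.+1 t)) ->
  forall j, (j < J)%N -> forall t, t <= 0 -> hasD (derivn_neg j (F 0%N)) t (F j.+1 t).
Proof.
move=> hF j jJ t t0.
exact: (hasD_ext t0 (fun s s0 => esym (derivn_neg_chain hF (ltnW jJ) s0)) (hF j jJ t t0)).
Qed.

Lemma lcont0_ext f (h : R -> R) : (forall s, s <= 0 -> f s = h s) -> lcont0 f -> lcont0 h.
Proof.
by move=> fh hf e /hf[d d0 hd]; exists d => // s sd s0; rewrite -!fh // hd.
Qed.

Lemma nondecreasing_neg_ext f (h : R -> R) : (forall s, s <= 0 -> f s = h s) ->
  nondecreasing_neg f -> nondecreasing_neg h.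
Proof. by move=> fh hf s t st t0; rewrite -!fh //; [exact: hf|exact: le_trans t0]. Qed.

Section AMSpline.
Variables (r m : nat) (lam a : 'I_m -> R) (c : R).
Hypotheses (lam0 : forall s, 0 < lam s) (a0 : forall s, 0 < a s) (c0 : 0 <= c).

(** The added constant realises a mass at 0 and is seen by the order 0 only. *)
Let F (j : nat) (t : R) :=
  \sum_(s < m) lam s * a s ^+ r * (a s)^-1 ^+ j * expR (t / a s) + c * (j == 0%N)%:R.

Let F_hasD j t : t <= 0 -> hasD (F j) t (F j.+1 t).
Proof.
move=> t0; rewrite /F; apply: hasDD; last by rewrite mulr0; exact: hasD_cst.
apply: hasD_sum => s; rewrite exprSr mulrA -[X in hasD _ _ X]mulrA; apply: hasDZ.
apply: is_derive_hasD.
have d1 : is_derive t 1 (fun u : R => u / a s) (a s)^-1.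
  have := is_deriveM (is_derive_id t 1) (is_derive_cst ((a s)^-1 : R) t 1).
  by move=> h; apply: is_derive_eq h _; rewrite scaler0 add0r /GRing.scale /= mulr1.
have d2 := is_derive_expR (t / a s).
have := @is_derive1_comp R expR (fun u : R => u / a s) t _ _ d2 d1; move=> h.
by apply: is_derive_eq h _; rewrite mulrC.
Qed.

Let F_ge0 j t : 0 <= F j t.
Proof.
rewrite /F addr_ge0 ?mulr_ge0 // sumr_ge0 // => s _.
by rewrite !mulr_ge0 ?exprn_ge0 ?expR_ge0 ?invr_ge0 // ltW.
Qed.

Let F0E : F 0%N = fun t => spline_fun r Class_AM lam a t + c.
Proof.
apply/funext => t; rewrite /F mulr1; congr (_ + _); apply: eq_bigr => s _.
by rewrite expr0 mulr1.
Qed.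

Lemma AM_spline : AM (fun t => spline_fun r Class_AM lam a t + c).
Proof.
rewrite -F0E => j t t0.
have hF i (_ : (i < j.+1)%N) u (u0 : u <= 0) := F_hasD i u0.
split; last by rewrite (derivn_neg_chain hF).
by have [] := hasD_deriv t0 (derivn_neg_chain_hasD hF (ltnSn j) t0).
Qed.

Lemma AM_spline_norm j : (j <= r)%N ->
  norm_neg (derivn_neg j (fun t => spline_fun r Class_AM lam a t + c)) =
  (\sum_(s < m) lam s * a s ^+ (r - j) + c * (j == 0%N)%:R)%:E.
Proof.
rewrite -F0E => jr.
have hF i (_ : (i < j.+1)%N) u (u0 : u <= 0) := F_hasD i u0.
have hE u (u0 : u <= 0) : F j u = derivn_neg j (F 0%N) u.
  by rewrite (derivn_neg_chain hF).
have Fnd : nondecreasing_neg (F j).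
  apply: (@neg_nondecreasing _ _ (F j.+1)) => [t t0||t t0].
  - by apply: hasD_is_derive => //; apply: F_hasD; exact: ltW.
  - exact: hasD_lcont0 (F_hasD j (lexx 0)).
  - exact: F_ge0.
rewrite norm_neg_nondecreasing.
- rewrite -hE // /F; congr ((_ + _)%:E); apply: eq_bigr => s _.
  rewrite mul0r expR0 mulr1 -mulrA; congr (_ * _).
  by rewrite exprVn -{1}(subnK jr) exprD mulfK // expf_neq0 // gt_eqF.
- exact: nondecreasing_neg_ext Fnd.
- by move=> t t0; rewrite -hE.
- exact: lcont0_ext (hasD_lcont0 (F_hasD j (lexx 0))).
Qed.

End AMSpline.

Definition hinge (a t : R) := Num.max (a + t) 0.

Lemma hinge_ge0 a t : 0 <= hinge a t.
Proof. by rewrite le_max lexx orbT. Qed.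

Lemma hinge_nd a s t : s <= t -> hinge a s <= hinge a t.
Proof. by move=> st; rewrite ge_max !le_max lexx orbT andbT lerD2l st. Qed.

Lemma hinge_lip a s t : s <= t -> hinge a t - hinge a s <= t - s.
Proof.
move=> st; rewrite /hinge; have [h1|h1] := leP (a + t) 0; have [h2|h2] := leP (a + s) 0; lra.
Qed.

Lemma hinge_convex (a p q s u : R) : 0 <= p -> 0 <= q -> p + q = 1 ->
  hinge a (p * s + q * u) <= p * hinge a s + q * hinge a u.
Proof.
move=> p0 q0 pq; rewrite {1}/hinge ge_max; apply/andP; split; last first.
  by rewrite addr_ge0 ?mulr_ge0 ?hinge_ge0.
have h1 : p * (a + s) <= p * hinge a s by rewrite ler_wpM2l // le_max lexx.
have h2 : q * (a + u) <= q * hinge a u by rewrite ler_wpM2l // le_max lexx.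
have : p * a + q * a = a by rewrite -mulrDl pq mul1r.
lra.
Qed.

(** Induction through a product of functions that increase together: for [p + q = 1],
    [(pA + qB)(pC + qD)] falls short of [pAC + qBD] by [pq(A - B)(C - D)], which is nonnegative. *)
Lemma hinge_exp_convex (a p q s u : R) m : 0 <= p -> 0 <= q -> p + q = 1 ->
  hinge a (p * s + q * u) ^+ m.+1 <= p * hinge a s ^+ m.+1 + q * hinge a u ^+ m.+1.
Proof.
move=> p0 q0 pq; elim: m => [|m IH]; first by rewrite !expr1; exact: hinge_convex.
rewrite exprS; set z := p * s + q * u in IH *.
apply: le_trans (ler_pM (hinge_ge0 _ _) _ (hinge_convex a s u p0 q0 pq) IH) _.
  by rewrite exprn_ge0 ?hinge_ge0.
rewrite ![hinge _ _ ^+ m.+2]exprS.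
have h : 0 <= (hinge a s - hinge a u) * (hinge a s ^+ m.+1 - hinge a u ^+ m.+1).
  have [su|us] := leP s u.
    rewrite mulr_le0 ?subr_le0 ?hinge_nd //.
    by rewrite lerXn2r ?nnegrE ?hinge_ge0 ?hinge_nd.
  rewrite mulr_ge0 ?subr_ge0 ?hinge_nd ?(ltW us) //.
  by rewrite lerXn2r ?nnegrE ?hinge_ge0 ?hinge_nd ?(ltW us).
have := mulr_ge0 (mulr_ge0 p0 q0) h.
have qE : q = 1 - p by lra.
rewrite qE; move: (hinge a s) (hinge a u) (hinge a s ^+ m.+1) (hinge a u ^+ m.+1) => A B C D.
by lra.
Qed.

(** Away from the knot this is calculus of polynomials; at the knot an exponent of at least 2 makes
    the remainder quadratic. *)
Lemma hinge_hasD a t m : hasD (fun u => hinge a u ^+ m.+2) t (m.+2%:R * hinge a t ^+ m.+1).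
Proof.
have [h|h|h] := ltgtP (a + t) 0.
- apply: (@hasD_quadratic _ _ _ _ (- (a + t)) 0) => [|s _ sd]; first by lra.
  have as0 : a + s < 0 by have := ler_norm (s - t); lra.
  rewrite /hinge !max_r ?(ltW h) ?(ltW as0) // !expr0n /=.
  by rewrite !mulr0 mul0r !subr0 normr0 mul0r.
- have d0 : is_derive t 1 (fun u : R => (a + u) ^+ m.+2) (m.+2%:R * (a + t) ^+ m.+1).
    pose p : {poly R} := (a%:P + 'X) ^+ m.+2.
    have -> : (fun u : R => (a + u) ^+ m.+2) = horner p.
      by apply/funext => u; rewrite /p horner_exp !hornerE.
    apply: is_derive_eq (horner_is_derive p t) _.
    rewrite /p deriv_exp derivD derivC derivX add0r mul1r hornerMn horner_exp !hornerE.
    by rewrite mulr_natl.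
  have := is_derive_hasD d0 => hd e e0; have [d dpos hd'] := hd e e0.
  exists (Num.min d (a + t)); first by rewrite lt_min dpos.
  move=> s s0; rewrite lt_min => /andP[sd sd']; have := hd' s s0 sd.
  have as0 : 0 < a + s by have := ler_norm (t - s); rewrite distrC; lra.
  by rewrite /hinge !max_l ?(ltW h) ?(ltW as0).
apply: (@hasD_quadratic _ _ _ _ 1 1) => [|s _ sd]; first exact: ltr01.
rewrite /hinge h maxxx !expr0n /= mulr0 mul0r !subr0 mul1r.
have sa : a + s = s - t by lra.
rewrite sa normrX exprS exprS mulrA -expr2.
have hs : `|Num.max (s - t) 0| <= `|s - t|.
  by have [h'|h'] := leP (s - t) 0; rewrite ?normr0 ?normr_ge0.
have h1 : `|Num.max (s - t) 0| ^+ m <= 1.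
  by rewrite exprn_ile1 //; lra.
have h2 : `|Num.max (s - t) 0| ^+ 2 <= `|s - t| ^+ 2 by rewrite lerXn2r ?nnegrE.
rewrite -[leRHS]mulr1; apply: ler_pM => //.
Qed.

Lemma convex_negI f : (forall p q s u, 0 <= p -> 0 <= q -> p + q = 1 -> s <= 0 -> u <= 0 ->
  f (p * s + q * u) <= p * f s + q * f u) -> convex_neg f.
Proof.
move=> h p s u /set_mem s0 /set_mem u0; rewrite convRE.
by apply: h => //; rewrite ?unstable.onem_ge0 // ?unstable.add_onemK.
Qed.

Lemma lipschitz_loc_abs_cont f L : 0 <= L ->
  (forall s t, s <= t -> t <= 0 -> `|f t - f s| <= L * (t - s)) -> loc_abs_cont_neg f.
Proof.
move=> L0 hf a b ab b0 e e0; exists (e / (L + 1)); first by rewrite divr_gt0 //; lra.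
move=> N u v huv _; rewrite ltr_pdivlMr; last by lra.
move=> h; apply: le_lt_trans h; rewrite mulr_suml; apply: ler_sum => i _.
have [_ [uv vb]] := huv i.
apply: le_trans (hf _ _ uv (le_trans vb b0)) _.
by rewrite mulrC ler_wpM2l ?subr_ge0 // lerDl.
Qed.

Lemma measurable_fun_countable_ext (D : set R) f h (N : set R) : measurable D -> countable N ->
  measurable_fun D f -> (forall t, D t -> ~ N t -> h t = f t) -> measurable_fun D h.
Proof.
move=> mD cN mf fh _ B mB.
have cm (E : set R) : E `<=` N -> measurable E.
  move=> EN; apply: countable_measurable => [t|]; first exact: measurable_set1.
  exact: sub_countable (subset_card_le EN) cN.
have -> : D `&` h @^-1` B = ((D `&` f @^-1` B) `\` N) `|` (D `&` h @^-1` B `&` N).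
  apply/seteqP; split=> t /=.
    move=> [Dt ht]; have [Nt|Nt] := pselect (N t); [by right|left].
    by rewrite -fh.
  by move=> [[[Dt ft] Nt]|[]//]; rewrite fh.
apply: measurableU; last by apply: cm => t [].
apply: measurableD; last exact: cm.
exact: mf.
Qed.

Section CupSpline.
Variables (n m : nat) (lam a : 'I_m -> R) (c : R).
Hypotheses (lam0 : forall s, 0 < lam s) (a0 : forall s, 0 < a s) (c0 : 0 <= c).

Local Notation f := (fun t => spline_fun n.+2 Class_Lr_cup lam a t + c).

Let F (j : nat) (t : R) :=
  (n.+2 - j)`!%:R^-1 * (\sum_(s < m) lam s * hinge (a s) t ^+ (n.+2 - j)) + c * (j == 0%N)%:R.

Let F0E : F 0%N = f.
Proof. by apply/funext => t; rewrite /F subn0 mulr1. Qed.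

Let F_hasD j : (j < n.+1)%N -> forall t, t <= 0 -> hasD (F j) t (F j.+1 t).
Proof.
move=> jn t t0; rewrite /F; apply: hasDD; last by rewrite mulr0; exact: hasD_cst.
have -> : (n.+2 - j)%N = (n - j).+2 by rewrite !subSn // ltnW.
have -> : (n.+2 - j.+1)%N = (n - j).+1 by rewrite subSS subSn.
have h : hasD (fun t => \sum_(s < m) lam s * hinge (a s) t ^+ (n - j).+2) t
    (\sum_(s < m) lam s * ((n - j).+2%:R * hinge (a s) t ^+ (n - j).+1)).
  by apply: hasD_sum => s; apply: hasDZ; exact: hinge_hasD.
have := hasDZ (n - j).+2`!%:R^-1 h; congr hasD.
under eq_bigr do rewrite mulrCA.
by rewrite -mulr_sumr mulrA factS natrM invfM [_ * _ * (n - j).+2%:R]mulrAC mulVf ?mul1r //.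
Qed.

Let fE j t : (j < n.+2)%N -> t <= 0 -> derivn_neg j f t = F j t.
Proof. by move=> jn t0; rewrite -F0E; exact: (derivn_neg_chain F_hasD). Qed.

Let F_ge0 j t : 0 <= F j t.
Proof.
rewrite /F addr_ge0 ?mulr_ge0 ?invr_ge0 ?ler0n // sumr_ge0 // => s _.
by rewrite mulr_ge0 ?(ltW (lam0 _)) ?exprn_ge0 ?hinge_ge0.
Qed.

Let F_nd j s t : s <= t -> F j s <= F j t.
Proof.
move=> st; rewrite lerD2r ler_wpM2l ?invr_ge0 ?ler0n //; apply: ler_sum => i _.
by rewrite ler_wpM2l ?(ltW (lam0 _)) // lerXn2r ?nnegrE ?hinge_ge0 ?hinge_nd.
Qed.

Let F_convex j : (j < n.+2)%N -> convex_neg (derivn_neg j f).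
Proof.
move=> jn; apply: convex_negI => p q s u p0 q0 pq s0 u0.
have z0 : p * s + q * u <= 0.
  have : p * s <= 0 by rewrite mulr_ge0_le0.
  have : q * u <= 0 by rewrite mulr_ge0_le0.
  by lra.
rewrite !fE // /F.
have -> : (n.+2 - j)%N = (n.+1 - j).+1 by rewrite subSn.
set C := c * _; set K := _^-1.
have K0 : 0 <= K by rewrite invr_ge0 ler0n.
have CE : C = p * C + q * C by rewrite -mulrDl pq mul1r.
rewrite {1}CE !mulrDr addrACA lerD2r.
rewrite ![_ * (K * _)]mulrCA -mulrDr ler_wpM2l // !mulr_sumr -big_split /=.
apply: ler_sum => i _; rewrite ![_ * (lam i * _)]mulrCA -mulrDr ler_wpM2l ?(ltW (lam0 _)) //.
exact: hinge_exp_convex.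
Qed.

Let Lam := \sum_(s < m) lam s.

Let Lam_ge0 : 0 <= Lam. Proof. by rewrite sumr_ge0 // => s _; exact: ltW. Qed.

Let y_lip s t : s <= t -> t <= 0 -> `|derivn_neg n.+1 f t - derivn_neg n.+1 f s| <= Lam * (t - s).
Proof.
move=> st t0; rewrite !fE //; last exact: le_trans t0.
rewrite ger0_norm ?subr_ge0 ?F_nd // /F mulr0 !addr0 subSn // subnn invr1 !mul1r -sumrB mulr_suml.
by apply: ler_sum => i _; rewrite !expr1 -mulrBr ler_wpM2l ?(ltW (lam0 _)) // hinge_lip.
Qed.

(** A visibly measurable representative of the top derivative; the two agree off the finitely many
    knots. *)
Let steps (t : R) := \sum_(s < m) lam s * (0 < a s + t)%R%:R.

Let hinge1_hasD b t : b + t != 0 -> hasD (hinge b) t (0 < b + t)%R%:R.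
Proof.
move=> bt e e0; exists `|b + t|; first by rewrite normr_gt0.
move=> s _ sd; rewrite [X in `|X|](_ : _ = 0) ?normr0 ?mulr_ge0 ?(ltW e0) //.
have [h|h|h] := ltgtP 0 (b + t); last by rewrite h eqxx in bt.
  rewrite (gtr0_norm h) in sd.
  have bs : 0 < b + s by have := ler_norm (t - s); rewrite distrC; lra.
  by rewrite /hinge !max_l ?ltW //; rewrite /= mul1r; ring.
rewrite (ltr0_norm h) in sd.
have bs : b + s < 0 by have := ler_norm (s - t); lra.
by rewrite /hinge !max_r ?ltW //; rewrite /= mul0r; ring.
Qed.

Let top_hasD t : t <= 0 -> (forall s, a s + t != 0) -> hasD (derivn_neg n.+1 f) t (steps t).
Proof.
move=> t0 nt; apply: (@hasD_ext _ (F n.+1)) => // [s s0|]; first by rewrite fE.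
have -> : F n.+1 = fun t => \sum_(s < m) lam s * hinge (a s) t.
  apply/funext => u; rewrite /F mulr0 addr0 subSn // subnn invr1 mul1r.
  by apply: eq_bigr => s _; rewrite expr1.
by apply: hasD_sum => s; apply: hasDZ; exact: hinge1_hasD.
Qed.

(** At any point, knots included, a derivative is controlled by the Lipschitz constant, and a
    missing one has the default value 0. *)
Let top_bound t : t <= 0 -> `|derivn_neg n.+2 f t| <= Lam.
Proof.
move=> t0; rewrite -[derivn_neg n.+2 f]/(deriv_neg (derivn_neg n.+1 f)).
have := y_lip; set y := derivn_neg n.+1 f => ylip.
have [dt|ndt] := pselect (derivable_neg y t); last by rewrite not_derivable_deriv // normr0.
have hD := derivable_hasD t0 dt; rewrite leNgt; apply/negP => h.
have e0 : 0 < (`|deriv_neg y t| - Lam) / 2 by lra.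
have [d d0 hd] := hD _ e0.
have s0 : t - d / 2 <= 0 by lra.
have st : t - d / 2 <= t by lra.
have ns : `|t - d / 2 - t| = d / 2 by rewrite addrAC subrr add0r normrN gtr0_norm //; lra.
have dd : d / 2 < d by lra.
have := hd _ s0; rewrite ns => /(_ dd) h1.
have := ylip _ _ st t0; rewrite distrC (_ : t - (t - d / 2) = d / 2); last by ring.
move=> h2.
have h3 : `|deriv_neg y t * (t - d / 2 - t)| <= Lam * (d / 2) + (`|deriv_neg y t| - Lam) / 2 * (d / 2).
  rewrite [X in `|X|](_ : _ = (y (t - d / 2) - y t) -
    (y (t - d / 2) - y t - deriv_neg y t * (t - d / 2 - t))); last by ring.
  by apply: le_trans (ler_normB _ _) _; rewrite lerD.
rewrite normrM ns in h3.
have : 0 < (`|deriv_neg y t| - Lam) * d by rewrite mulr_gt0 //; lra.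
lra.
Qed.

Let knots_far : exists2 b : R, b < 0 & forall s, - a s < b.
Proof.
have h : forall k (d : 'I_k -> R), (forall i, 0 < d i) -> exists2 b : R, b < 0 & forall i, - d i < b.
  elim=> [|k IH] d d0; first by exists (-1) => [|[]//]; lra.
  have [b b0 hb] := IH (fun i => d (lift ord0 i)) (fun i => d0 _).
  exists (Num.max b (- (d ord0 / 2))) => [|i].
    by rewrite gt_max b0; have := d0 ord0; lra.
  rewrite lt_max; case: (unliftP ord0 i) => [j ->|->]; first by rewrite hb.
  by apply/orP; right; have := d0 ord0; lra.
exact: h.
Qed.

(** To the right of all knots every step is active, so the bound [Lam] is reached there. *)
Let top_norm : norm_neg (derivn_neg n.+2 f) = Lam%:E.
Proof.
apply: norm_neg_eq => // C CL; have [b b0 hb] := knots_far.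
exists b, set0; split=> // t bt t0 _.
have at0 s : 0 < a s + t by have := hb s; lra.
have [_ e] := hasD_deriv (ltW t0) (top_hasD (ltW t0) (fun s => lt0r_neq0 (at0 s))).
rewrite -[derivn_neg n.+2 f]/(deriv_neg (derivn_neg n.+1 f)) e.
have -> : steps t = Lam by apply: eq_bigr => s _; rewrite at0 mulr1.
by apply: lt_le_trans CL _; exact: ler_norm.
Qed.

Let low_norm j : (j < n.+2)%N -> norm_neg (derivn_neg j f) = (F j 0)%:E.
Proof.
move=> jn; rewrite -(fE jn (lexx 0)); apply: norm_neg_nondecreasing.
- by move=> s t st t0; rewrite !fE //; [exact: F_nd|exact: le_trans t0].
- by move=> t t0; rewrite fE.
move: (jn); rewrite ltnS leq_eqVlt => /orP[/eqP ->|jn'].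
  move=> e e0; have L1 : 0 < Lam + 1 by rewrite ltr_wpDl.
  exists (e / (Lam + 1)); first by rewrite divr_gt0.
  move=> s sd s0; rewrite distrC; apply: le_trans (y_lip s0 (lexx 0)) _.
  rewrite ltrNl ltr_pdivlMr // in sd; lra.
rewrite -F0E.
exact: hasD_lcont0 (derivn_neg_chain_hasD F_hasD jn' (lexx 0)).
Qed.

Let steps_measurable : measurable_fun [set: R] steps.
Proof.
apply: measurable_sum => s; apply: measurable_funM; first exact: measurable_cst.
have -> : (fun t : R => (0 < a s + t)%R%:R : R) = \1_([set` `](- a s), +oo[]).
  apply/funext => t; rewrite indicE; congr (nat_of_bool _)%:R.
  by rewrite mem_setE in_itv /= andbT; apply/idP/idP; lra.
by apply: measurable_indic; exact: measurable_itv.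
Qed.

Let mRneg : measurable (@Rneg R).
Proof.
have -> : @Rneg R = [set` `]-oo, 0]] by apply/seteqP; split=> t /=; rewrite in_itv.
exact: measurable_itv.
Qed.

Lemma Lr_cup_spline : Lr_cup n.+2 f.
Proof.
split; [split| |].
- split; last by rewrite -[f]/(derivn_neg 0 f) low_norm // ltry.
  apply: measurable_funS (measurableT) (subsetT _) _.
  apply: measurable_funD; last exact: measurable_cst.
  apply: measurable_funM; first exact: measurable_cst.
  apply: measurable_sum => s; apply: measurable_funM; first exact: measurable_cst.
  apply: measurable_funX; apply: measurable_maxr; last exact: measurable_cst.
  by apply: measurable_funD; [exact: measurable_cst|exact: measurable_id].
- move=> j t jn t0; rewrite -F0E.
  by have [] := hasD_deriv t0 (derivn_neg_chain_hasD F_hasD jn t0).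
- exact: lipschitz_loc_abs_cont Lam_ge0 y_lip.
- split; last by rewrite top_norm ltry.
  apply: (@measurable_fun_countable_ext _ steps _ [set t | exists s, t = - a s]) => //.
  + have -> : [set t | exists s, t = - a s] = (fun s => - a s) @` [set: 'I_m].
      by apply/seteqP; split=> t /= [s]; [move=> ->; exists s|move=> _ <-; exists s].
    by apply: finite_set_countable; apply: finite_image; exact: finite_finset.
  + exact: measurable_funS (measurableT) (subsetT _) steps_measurable.
  move=> t t0 Nt; have nt s : a s + t != 0.
    by apply/eqP => h; apply: Nt; exists s; lra.
  by have [_ e] := hasD_deriv t0 (top_hasD t0 nt).
- by move=> t t0; have := F_ge0 0 t; rewrite F0E.
move=> j jn; split; last exact: F_convex.
by move=> s t st t0; rewrite !fE //; [exact: F_nd|exact: le_trans t0].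
Qed.

Lemma Lr_cup_spline_norm j : (j <= n.+2)%N ->
  norm_neg (derivn_neg j f) = ((n.+2 - j)`!%:R^-1 * (\sum_(s < m) lam s * a s ^+ (n.+2 - j)) +
    c * (j == 0%N)%:R)%:E.
Proof.
rewrite leq_eqVlt => /orP[/eqP ->|jn].
  rewrite top_norm subnn invr1 mul1r mulr0 addr0; congr (_%:E).
  by apply: eq_bigr => s _; rewrite expr0 mulr1.
rewrite low_norm // /F; congr ((_ * _ + _)%:E); apply: eq_bigr => s _.
by rewrite /hinge addr0 max_l // ltW.
Qed.

End CupSpline.

End Splines.

(** * Adding the lowest moment *)

Section ConeExtension.
Context {R : realType}.
Variable w : nat -> R.
Hypothesis w_gt0 : forall j, 0 < w j.

Section Odd.
Variables (N m : nat) (k : 'I_N.+1 -> nat) (s : seq (R * R)) (M : 'rV[R]_N.+1).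
Hypotheses (ki : incr k) (Nm : N = m.*2) (sP : pos_atoms s) (us : uniq (map snd s)).
Let k' := ktail k.
Let M' := col' ord0 M.
Hypothesis rM : represents w k' s 0 M'.
Hypothesis s_int : (pcone w k')° M' -> size s = m.
Hypothesis s_bnd : ~ (pcone w k')° M' -> (size s < m)%N.
Let B := w (k ord0) * mint s 'X^(k ord0).

(** Over a boundary point any two representing measures have together fewer than [N] atoms, so the
    lowest moment is determined; only at exponent 0 can a mass at 0 raise the coordinate above it.
    Over an interior point [s] attains the lower bound. *)
Lemma odd_pcone : pcone w k M <->
  [\/ (pcone w k')° M' /\ B <= M 0 ord0,
      [/\ ~ (pcone w k')° M', (0 < k ord0)%N & M 0 ord0 = B]
    | [/\ ~ (pcone w k')° M', k ord0 = 0%N & B <= M 0 ord0]].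
Proof.
split=> [cM|].
  have [i'|i'] := pselect ((pcone w k')° M').
    by apply: Or31; split=> //; exact (odd_lower_bound w_gt0 ki Nm sP us (s_int i') rM cM).
  have [s1 [kap [s1P kap0 rM1]]] := cM.
  have := represents_tail ki rM1; rewrite -/k' -/M' => rM1'.
  have s1m := boundary_atoms w_gt0 (incr_inj (incr_tail ki)) s1P (lexx 0) rM1' i'.
  have e1 : mint s1 'X^(k ord0) = mint s 'X^(k ord0).
    apply: (@moment_unique _ (codom k') _ _ _ _ s1P sP).
    - by rewrite -codom_tail; exact/codom_uniq/incr_inj.
    - move=> j /codomP[i ->]; have := rM1' i; rewrite rM !mul0r !addr0.
      by move=> /(mulfI (lt0r_neq0 (w_gt0 _))).
    apply: leq_trans (uniq_leq_size (s2 := undup (map snd s1) ++ map snd s) (undup_uniq _) _) _.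
      by move=> z; rewrite mem_undup map_cat !mem_cat mem_undup.
    rewrite size_cat size_map size_codom card_ord; have := s_bnd i'.
    by move: s1m; clear -Nm; lia.
  have MB : M 0 ord0 = B + w (k ord0) * (kap * (k ord0 == 0%N)%:R) by rewrite rM1 e1 mulrDr.
  have [k0|k0] := posnP (k ord0).
    by apply: Or33; split=> //; rewrite MB lerDl !mulr_ge0 // ltW.
  by apply: Or32; split=> //; rewrite MB eqn0Ngt k0 !mulr0 addr0.
have eqc : M 0 ord0 = B -> pcone w k M.
  move=> MB; exists s, 0; split=> //; apply: (represents_cons ki rM).
  by rewrite mul0r addr0.
case=> [[i']|[_ _ /eqc //]|[_ k0]].
  rewrite le_eqVlt => /orP[/eqP/esym/eqc //|].
  by move=> /(interior_above w_gt0 ki sP i' rM)/interior_subset.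
move=> BM; exists s, ((M 0 ord0 - B) / w (k ord0)); split=> //.
  by rewrite divr_ge0 ?subr_ge0 // ltW.
apply: (represents_cons ki rM).
have -> : (k ord0 == 0%N) = true by rewrite k0.
rewrite mulr1 mulrDr -/B [_ * (_ / _)]mulrC divfK ?subrKC //.
exact: lt0r_neq0.
Qed.

Lemma odd_pcone_interior : (pcone w k)° M <-> (pcone w k')° M' /\ B < M 0 ord0.
Proof.
split=> [iM|[i' BM]]; last exact (interior_above w_gt0 ki sP i' rM BM).
have i' : (pcone w k')° M' := interior_tail w_gt0 ki iM.
by split=> //; exact (odd_lower_bound_strict w_gt0 ki Nm sP us (s_int i') rM iM).
Qed.
End Odd.

Section Even.
Variables (n q : nat) (k : 'I_n.+3 -> nat) (s : seq (R * R)) (M : 'rV[R]_n.+3).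
Hypotheses (ki : incr k) (nq : n.+1 = q.*2) (sP : pos_atoms s) (us : uniq (map snd s)).
Let k' := ktail k.
Let M' := col' ord0 M.
Let k'' := kinit k'.
Let M'' := col' ord_max M'.
Hypothesis rM : represents w k'' s 0 M''.
Hypothesis cM' : pcone w k' M'.
Hypothesis s_int : (pcone w k'')° M'' -> size s = q.
Hypothesis s_bnd : ~ (pcone w k'')° M'' -> (size s < q)%N.
Let B := w (k ord0) * mint s 'X^(k ord0).

Let s_le : (size s <= q)%N.
Proof. by have [/s_int ->|/s_bnd/ltnW] := pselect ((pcone w k'')° M''). Qed.

Let s_eq : (pcone w k')° M' -> size s = q.
Proof. by move=> i'; apply: s_int; exact (interior_init w_gt0 (incr_tail ki) i'). Qed.

(** Although [s] matches the middle coordinates only, over a boundary point its lowest moment is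
    that of every measure representing [M']. Over an interior point [even_lower_bound] and
    [even_interior] give the strict inequality. *)
Lemma even_pcone : pcone w k M <->
  [\/ (pcone w k')° M' /\ B < M 0 ord0,
      [/\ ~ (pcone w k')° M', (0 < k ord0)%N & M 0 ord0 = B]
    | [/\ ~ (pcone w k')° M', k ord0 = 0%N & B <= M 0 ord0]].
Proof.
split=> [cM|].
  have [i'|i'] := pselect ((pcone w k')° M').
    by apply: Or31; split=> //; exact (even_lower_bound w_gt0 ki nq sP rM us (s_eq i') cM i').
  have [s1 [kap [s1P kap0 rM1]]] := cM.
  have e1 := even_boundary_eq w_gt0 ki nq sP rM s1P s_le (represents_tail ki rM1) i'.
  have MB : M 0 ord0 = B + w (k ord0) * (kap * (k ord0 == 0%N)%:R) by rewrite rM1 e1 mulrDr.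
  have [k0|k0] := posnP (k ord0).
    by apply: Or33; split=> //; rewrite MB lerDl !mulr_ge0 // ltW.
  by apply: Or32; split=> //; rewrite MB eqn0Ngt k0 !mulr0 addr0.
(* A measure for [M'] is required here, since [s] need not reproduce the top coordinate. *)
have [s1 [kap [s1P kap0 rM1]]] := cM'.
have rM1' : represents w k' s1 0 M'.
  move=> i; rewrite rM1 gtn_eqF ?mulr0 //.
  by apply: leq_ltn_trans (leq0n (k ord0)) _; exact: ki.
have e1 i' := even_boundary_eq w_gt0 ki nq sP rM s1P s_le rM1' i'.
case=> [[i' BM]|[i' _ MB]|[i' k0 BM]].
- exact: interior_subset (even_interior w_gt0 ki nq sP rM us (s_eq i') i' BM).
- exists s1, 0; split=> //; apply: (represents_cons ki rM1').
  by rewrite mul0r addr0 (e1 i').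
exists s1, ((M 0 ord0 - B) / w (k ord0)); split=> //.
  by rewrite divr_ge0 ?subr_ge0 // ltW.
apply: (represents_cons ki rM1').
rewrite (e1 i'); have -> : (k ord0 == 0%N) = true by rewrite k0.
rewrite mulr1 mulrDr -/B [_ * (_ / _)]mulrC divfK ?subrKC //.
exact: lt0r_neq0.
Qed.

Lemma even_pcone_interior : (pcone w k)° M <-> (pcone w k')° M' /\ B < M 0 ord0.
Proof.
split=> [iM|[i' BM]]; last exact (even_interior w_gt0 ki nq sP rM us (s_eq i') i' BM).
have i' : (pcone w k')° M' := interior_tail w_gt0 ki iM.
split=> //.
exact (even_lower_bound w_gt0 ki nq sP rM us (s_eq i') (interior_subset iM) i').
Qed.
End Even.
End ConeExtension.

(** * From moment cones to admissible sets and [phi] *)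

Section Admissible.
Context {R : realType}.
Variables (r0 : nat) (X : function_class).
Local Notation r := r0.+2.
Local Notation w := (@wt R r X).

Lemma spline_class m (lam a : 'I_m -> R) c : (forall s, 0 < lam s) -> (forall s, 0 < a s) ->
  0 <= c -> class_set r X (fun t => spline_fun r X lam a t + c).
Proof. by case: X => lam0 a0 c0 /=; [exact: Lr_cup_spline|exact: AM_spline]. Qed.

Lemma spline_norm m (lam a : 'I_m -> R) c j : (forall s, 0 < lam s) -> (forall s, 0 < a s) ->
  0 <= c -> (j <= r)%N -> norm_neg (derivn_neg j (fun t => spline_fun r X lam a t + c)) =
  (w j * (\sum_(s < m) lam s * a s ^+ (r - j)) + c * (j == 0%N)%:R)%:E.
Proof.
case: X => lam0 a0 c0 jr; first by rewrite Lr_cup_spline_norm.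
by rewrite AM_spline_norm // mul1r.
Qed.

Lemma spline_norm0 m (lam a : 'I_m -> R) j : (forall s, 0 < lam s) -> (forall s, 0 < a s) ->
  (j <= r)%N -> norm_neg (derivn_neg j (spline_fun r X lam a)) =
  (w j * \sum_(s < m) lam s * a s ^+ (r - j))%:E.
Proof.
move=> lam0 a0 jr; have := spline_norm lam0 a0 (lexx 0) jr; rewrite mul0r addr0 => <-.
by congr (norm_neg (derivn_neg _ _)); apply/funext => t; rewrite addr0.
Qed.

(* A knot [- a] with coefficient [lam] is an atom of mass [lam * a ^+ r] at [a^-1]. *)
Lemma ideal_spline_atoms m f : ideal_spline r X m f -> exists s,
  [/\ @pos_atoms R s, uniq (map snd s), size s = m
    & forall j, (j <= r)%N -> norm_neg (derivn_neg j f) = (w j * mint s 'X^j)%:E].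
Proof.
move=> [lam [a [lam0 a0 ai ->]]].
exists [seq (lam i * a i ^+ r, (a i)^-1) | i <- enum 'I_m]; split.
- apply/allP => _ /mapP[i _ ->] /=.
  by rewrite invr_gt0 a0 mulr_gt0 ?exprn_gt0.
- rewrite -map_comp map_inj_uniq ?enum_uniq // => i j /= /invr_inj; exact: ai.
- by rewrite size_map size_enum_ord.
move=> j jr; rewrite spline_norm0 //; congr (_ * _)%:E.
rewrite /mint big_map big_enum /=; apply: eq_bigr => i _.
rewrite hornerXn exprVn -mulrA; congr (_ * _).
by rewrite -{2}(subnK jr) exprD mulfK // expf_neq0 // lt0r_neq0.
Qed.

Lemma atoms_spline s : @pos_atoms R s -> exists lam a : 'I_(size s) -> R,
  [/\ forall i, 0 < lam i, forall i, 0 < a i, uniq (map snd s) -> injective a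
    & forall j, (j <= r)%N -> \sum_i lam i * a i ^+ (r - j) = mint s 'X^j].
Proof.
move=> sP; pose x (i : 'I_(size s)) := nth (0, 0) s i.
have xs i : x i \in s by exact: mem_nth.
have x1 i : 0 < (x i).1 by have /andP[] := allP sP _ (xs i).
have x2 i : 0 < (x i).2 by have /andP[] := allP sP _ (xs i).
exists (fun i => (x i).1 * (x i).2 ^+ r), (fun i => (x i).2^-1); split.
- by move=> i; rewrite mulr_gt0 ?exprn_gt0.
- by move=> i; rewrite invr_gt0.
- move=> us i j /invr_inj xij; apply/val_inj/eqP.
  rewrite -(nth_uniq 0 _ _ us) ?size_map ?ltn_ord //.
  by rewrite !(nth_map (0, 0)) ?ltn_ord //; apply/eqP.
move=> j jr; rewrite /mint (big_nth (0, 0)) big_mkord; apply: eq_bigr => i _.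
rewrite hornerXn -/(x i) -mulrA; congr (_ * _).
by rewrite exprVn -{1}(subnKC jr) exprD mulfK // expf_neq0 // lt0r_neq0.
Qed.

Lemma atoms_ideal_spline s : @pos_atoms R s -> uniq (map snd s) ->
  exists2 f, ideal_spline r X (size s) f
    & forall j, (j <= r)%N -> norm_neg (derivn_neg j f) = (w j * mint s 'X^j)%:E.
Proof.
move=> sP us; have [lam [a [lam0 a0 /(_ us) ai h]]] := atoms_spline sP.
exists (spline_fun r X lam a); first by exists lam, a.
by move=> j jr; rewrite spline_norm0 // h.
Qed.

Section Index.
Variables (N : nat) (k : 'I_N -> nat).
Hypotheses (ki : injective k) (kr : forall i, (k i <= r)%N).

Lemma admissible_pcone (M : 'rV[R]_N) : M != 0 -> admissible r X k M <-> pcone w k M.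
Proof.
move=> M0; split=> [[_ [x]]|[s [kap [sP kap0 rM]]]].
  by move: kr; case: (X) => kr' /=; [exact: Lr_cup_pcone|exact: AM_pcone].
split=> //; have [lam [a [lam0 a0 _ h]]] := atoms_spline sP.
(* The mass at 0 becomes an additive constant of the spline. *)
have c0 : 0 <= kap * w 0 by rewrite mulr_ge0 // ltW // wt_gt0.
exists (fun t => spline_fun r X lam a t + kap * w 0); first exact: spline_class.
move=> i; rewrite spline_norm // h // rM mulrDr; congr (_ + _)%:E.
by case: eqP => [->|_]; rewrite ?mulr0 // !mulr1 mulrC.
Qed.

(** The cone and the admissible set differ at the zero vector only, and a small neighbourhood of [M]
    avoids it. *)
Lemma admissible_interior (M : 'rV[R]_N) : M != 0 ->
  (admissible r X k)° M <-> (pcone w k)° M.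
Proof.
move=> M0; split=> /interior_rVP[e e0 he]; apply/interior_rVP.
  by exists e => // v /he hv; apply/admissible_pcone => //; have [] := hv.
have /rV0Pn[i Mi] := M0.
exists (Num.min e `|M 0 i|); first by rewrite lt_min e0 normr_gt0.
move=> v vM; apply/admissible_pcone.
  apply/rV0Pn; exists i; apply/eqP => vi; have := vM i.
  by rewrite vi sub0r normrN lt_min ltxx andbF.
by apply: he => j; have := vM j; rewrite lt_min => /andP[].
Qed.

Lemma admissible_boundary (M : 'rV[R]_N) : M != 0 ->
  (boundary (admissible r X k) `&` admissible r X k) M <-> ~ (pcone w k)° M /\ pcone w k M.
Proof.
move=> M0; have AE := admissible_pcone M0; have AiE := admissible_interior M0.
split=> [[[_ h] /AE cM]|[h /AE cM]]; first by split=> // /AiE.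
by split=> //; split=> [|/AiE //]; exact: subset_closure.
Qed.

(** Existence of a suitable spline makes the defining property hold for the value chosen by [get].
    Whichever spline that is, the property yields atoms in the number on which the bounds rest. *)
Lemma phi_atoms q (M : 'rV[R]_N) : (forall i, 0 < k i)%N -> N = q.*2 -> M != 0 ->
  pcone w k M -> exists s,
  [/\ pos_atoms s, uniq (map snd s), represents w k s 0 M,
      ((pcone w k)° M -> size s = q) /\ (~ (pcone w k)° M -> size s < q)%N
    & forall j, (j <= r)%N ->
      norm_neg (derivn_neg j (phi r X k M)) = (w j * mint s 'X^j)%:E].
Proof.
move=> k0 Nq M0 cM.
have q0 : (0 < q)%N.
  rewrite lt0n; apply/eqP => q0; case/rV0Pn: M0 => i _.
  by case: i => i; rewrite Nq q0.
have Nh : N./2 = q by rewrite Nq doubleK.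
have hnorms s f : (forall j, (j <= r)%N -> norm_neg (derivn_neg j f) = (w j * mint s 'X^j)%:E) ->
    has_norms k M f <-> represents w k s 0 M.
  move=> hf; split=> h i; have := h i; rewrite hf // mul0r addr0; first by case.
  by move=> ->.
have [f hf] : exists f, is_phi r X k M f.
  (* The interior case takes the measure of minimal mass; on the boundary any representing measure
     has few atoms once equal positions are merged. *)
  have [iM|iM] := pselect ((pcone w k)° M).
    have [s [sP us ss rM]] := lower_principal (@wt_gt0 R r X) ki k0 Nq iM.
    have [f hf fn] := atoms_ideal_spline sP us.
    exists f; split; first exact/(hnorms s f fn).
    by left; split; [apply/admissible_interior|rewrite Nh -ss].
  have [s1 [kap [s1P kap0 rM1]]] := cM.
  have rM1' : represents w k s1 0 M by move=> i; rewrite rM1 gtn_eqF // !mulr0.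
  have s1q := boundary_atoms (@wt_gt0 R r X) ki s1P (lexx 0) rM1' iM.
  have [s [sP sE smint]] := merge_atoms s1P.
  have us : uniq (map snd s) by rewrite sE undup_uniq.
  have rM : represents w k s 0 M by move=> i; rewrite rM1' smint.
  have [f hf fn] := atoms_ideal_spline sP us.
  exists f; split; first exact/(hnorms s f fn).
  right; split; first by apply/admissible_boundary.
  exists (size s) => //; rewrite -(size_map snd) sE; move: s1q; rewrite {}Nq.
  have key z : (z.*2 < q.*2)%N -> (z <= q.*2.-1./2)%N by clear; lia.
  exact: key.
have [hn] : is_phi r X k M (phi r X k M) by exact: (getPex (ex_intro _ f hf)).
move=> [[/(admissible_interior M0) iM /ideal_spline_atoms[s [sP us ss sn]]]|].
  exists s; split=> //; first exact/(hnorms s _ sn).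
  by split=> // _; rewrite ss.
move=> [/(admissible_boundary M0)[iM _]] [m mN] /ideal_spline_atoms[s [sP us ss sn]].
exists s; split=> //; first exact/(hnorms s _ sn).
split=> // _; rewrite ss; apply: leq_ltn_trans mN _.
by move: q0; rewrite Nq; clear; lia.
Qed.

End Index.
End Admissible.

Theorem mainTheorem1 (R : realType) (r n : nat) (k : 'I_n.+3 -> nat)
    (X : function_class) (M : 'rV[R]_n.+3) :
  (forall i j : 'I_n.+3, (i < j)%N -> (k i < k j)%N) ->
  k ord_max = r ->
  (forall i, 0 < M 0 i) ->
  let k1 := k ord0 in
  let M1 := (M 0 ord0)%:E in
  let k' := (fun i : 'I_n.+2 => k (lift ord0 i)) in
  let M' : 'rV[R]_n.+2 := col' ord0 M in
  let k'' := (fun i : 'I_n.+1 => k' (lift ord_max i)) in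
  let M'' : 'rV[R]_n.+1 := col' ord_max M' in
  let A := admissible r X k in
  let A' := admissible r X k' in
  let phi'_norm := norm_neg (derivn_neg k1 (phi r X k' M')) in
  let phi''_norm := norm_neg (derivn_neg k1 (phi r X k'' M'')) in
  [/\ odd n.+3 ->
        (A M <->
         [\/ A'° M' /\ (phi'_norm <= M1)%E,
             [/\ (boundary A' `&` A') M', (0 < k1)%N & M1 = phi'_norm]
           | [/\ (boundary A' `&` A') M', k1 = 0%N & (phi'_norm <= M1)%E]]),
      ~~ odd n.+3 ->
        (A M <->
         [\/ A'° M' /\ (phi''_norm < M1)%E,
             [/\ (boundary A' `&` A') M', (0 < k1)%N & M1 = phi''_norm]
           | [/\ (boundary A' `&` A') M', k1 = 0%N & (phi''_norm <= M1)%E]]),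
      odd n.+3 -> (A° M <-> A'° M' /\ (phi'_norm < M1)%E)
    & ~~ odd n.+3 -> (A° M <-> A'° M' /\ (phi''_norm < M1)%E)].
Proof.
move=> ki kr Mpos k1 M1 k' M' k'' M'' A A' phi'_norm phi''_norm.
have ki' : incr k' := incr_tail ki; have ki'' : incr k'' := incr_init ki'.
have kler i : (k i <= r)%N.
  rewrite -kr; have [|h] := ltnP i (@ord_max n.+2); first by move/ki/ltnW.
  by rewrite (_ : i = ord_max) //; apply/val_inj/anti_leq; rewrite h -ltnS ltn_ord.
have k'_gt0 i : (0 < k' i)%N by apply: leq_ltn_trans (leq0n k1) _; exact: ki.
(* At least three increasing exponents ending at [r] force [r] to be at least 2. *)
have [r0 rE] : exists r0, r = r0.+2.
  exists r.-2; have h := ki ord0 (inord 1); have h' := ki (inord 1) ord_max.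
  move: h h'; rewrite !inordK // kr => /(_ isT) h /(_ isT) h'.
  by move: h h'; clear; lia.
move: kler @A @A' @phi'_norm @phi''_norm; rewrite {}rE => kler A A' phi'_norm phi''_norm.
pose w := @wt R r0.+2 X; have w_gt0 : forall j, 0 < w j := @wt_gt0 R r0.+2 X.
have Mn0 : M != 0 by apply/rV0Pn; exists ord0; exact: lt0r_neq0.
have M'n0 : M' != 0 by apply/rV0Pn; exists ord0; rewrite mxE; exact: lt0r_neq0.
have M''n0 : M'' != 0 by apply/rV0Pn; exists ord0; rewrite !mxE; exact: lt0r_neq0.
have AE := admissible_pcone X (incr_inj ki) kler Mn0.
have AiE := admissible_interior X (incr_inj ki) kler Mn0.
have A'iE := admissible_interior X (incr_inj ki') (fun i => kler _) M'n0.
have A'bE := admissible_boundary X (incr_inj ki') (fun i => kler _) M'n0.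
have tail : pcone w k M -> pcone w k' M'.
  move=> [s [kap [sP kap0 rM]]]; exists s, 0; split=> //.
  exact (represents_tail ki rM).
(* If [M'] is outside the cone, both sides of all four equivalences fail, whatever [phi] is. *)
have [cM'|ncM'] := pselect (pcone w k' M'); last first.
  have nc : ~ pcone w k M by move/tail.
  have ni : ~ (pcone w k)° M by move/interior_subset.
  have ni' : ~ (pcone w k')° M' by move/interior_subset.
  rewrite /A /A'; split=> _; split.
  - by move/AE.
  - by case=> [[/A'iE]|[/A'bE[]]|[/A'bE[]]].
  - by move/AE.
  - by case=> [[/A'iE]|[/A'bE[]]|[/A'bE[]]].
  - by move/AiE.
  - by case=> /A'iE.
  - by move/AiE.
  - by case=> /A'iE.
have k1r : (k1 <= r0.+2)%N := kler ord0.
have cM'' : pcone w k'' M''.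
  have [s [kap [sP kap0 rM]]] := cM'; exists s, kap; split=> //.
  exact (represents_init rM).
split=> dodd.
- have [|s [sP us rM [si sb] sn]] := @phi_atoms _ _ X _ _ (incr_inj ki') (fun i => kler _)
    n.+2./2 M' k'_gt0 _ M'n0 cM'; first by move: dodd; clear; lia.
  rewrite /phi'_norm sn // /M1 lee_fin.
  apply: iff_trans AE _; apply: iff_trans (odd_pcone w_gt0 ki _ sP us rM si sb) _.
    by move: dodd; clear; lia.
  split; case=> [[/A'iE h h']|[h k0 h']|[h k0 h']].
  + by apply: Or31.
  + by apply: Or32; split=> //; [apply/A'bE|congr _%:E].
  + by apply: Or33; split=> //; apply/A'bE.
  + by apply: Or31.
  + by apply: Or32; split=> //; [move/A'bE: h => []|case: h'].
  + by apply: Or33; split=> //; move/A'bE: h => [].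
- have [|s [sP us rM [si sb] sn]] := @phi_atoms _ _ X _ _ (incr_inj ki'') (fun i => kler _)
    n.+1./2 M'' (fun i => k'_gt0 _) _ M''n0 cM''; first by move: dodd; clear; lia.
  rewrite /phi''_norm sn // /M1 lee_fin lte_fin.
  apply: iff_trans AE _; apply: iff_trans (even_pcone w_gt0 ki _ sP us rM cM' si sb) _.
    by move: dodd; clear; lia.
  split; case=> [[/A'iE h h']|[h k0 h']|[h k0 h']].
  + by apply: Or31.
  + by apply: Or32; split=> //; [apply/A'bE|congr _%:E].
  + by apply: Or33; split=> //; apply/A'bE.
  + by apply: Or31.
  + by apply: Or32; split=> //; [move/A'bE: h => []|case: h'].
  + by apply: Or33; split=> //; move/A'bE: h => [].
- have [|s [sP us rM [si sb] sn]] := @phi_atoms _ _ X _ _ (incr_inj ki') (fun i => kler _)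
    n.+2./2 M' k'_gt0 _ M'n0 cM'; first by move: dodd; clear; lia.
  rewrite /phi'_norm sn // /M1 lte_fin.
  apply: iff_trans AiE _; apply: iff_trans (odd_pcone_interior w_gt0 ki _ sP us rM si) _.
    by move: dodd; clear; lia.
  by split=> -[/A'iE].
have [|s [sP us rM [si sb] sn]] := @phi_atoms _ _ X _ _ (incr_inj ki'') (fun i => kler _)
  n.+1./2 M'' (fun i => k'_gt0 _) _ M''n0 cM''; first by move: dodd; clear; lia.
rewrite /phi''_norm sn // /M1 lte_fin.
apply: iff_trans AiE _; apply: iff_trans (even_pcone_interior w_gt0 ki _ sP us rM si) _.
  by move: dodd; clear; lia.
by split=> -[/A'iE].
Qed.
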